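(* Assume that the elements of $\mathbf X$ and $\mathbf W$ are uniformly bounded, that $\mathbf X'\mathbf V^{-1}(\lambda)\mathbf X/k$ is positive definite and converges to a positive definite matrix, and that the $d_i$'s are bounded above and bounded away from zero. Let $\Delta^U=R^U(\pi,\widehat{\boldsymbol\mu}^{\mathrm{CEB}}(\hat\lambda,\mathbf t))-R^U(\pi,\widehat{\boldsymbol\mu}^{\mathrm{CM}}(\mathbf t))$. Then, as $k\to\infty$, $$\Delta^U/k=\Delta_{\mathrm{APR}}(\lambda)/k+O(k^{-3/2}),$$ where $$\Delta_{\mathrm{APR}}(\lambda)=-\mathrm{tr}[\mathbf D\mathbf Q_{\mathbf W}\mathbf D\mathbf V^{-1}(\lambda)]+\mathrm{tr}[(\mathbf X'\mathbf V^{-1}(\lambda)\mathbf X)^{-1}\mathbf X'\mathbf V^{-1}(\lambda)\mathbf D\mathbf Q_{\mathbf W}\mathbf D\mathbf V^{-1}(\lambda)\mathbf X]+\mathrm{tr}[\mathbf D\mathbf Q_{\mathbf W}\mathbf D\mathbf V^{-3}(\lambda)]\frac{2k}{(\mathrm{tr}[\mathbf V^{-1}(\lambda)])^2}.$$ A necessary condition for $\Delta_{\mathrm{APR}}(\lambda)\le0$ for all $\lambda>0$ is $$\mathrm{tr}[\mathbf D\mathbf Q_{\mathbf W}]\ge\mathrm{tr}[(\mathbf X'\mathbf D^{-1}\mathbf X)^{-1}\mathbf X'\mathbf Q_{\mathbf W}\mathbf X]+\mathrm{tr}[\mathbf Q_{\mathbf W}\mathbf D^{-1}]\frac{2k}{(\mathrm{tr}[\mathbf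 D^{-1}])^2}.$$ A sufficient condition for $\Delta_{\mathrm{APR}}(\lambda)\le0$ for all $\lambda>0$ is $$\min_{\lambda>0}\left\{\frac{\mathrm{tr}[\mathbf D\mathbf Q_{\mathbf W}\mathbf D\mathbf V^{-1}(\lambda)]}{\mathrm{Ch}_{\max}(\mathbf D\mathbf Q_{\mathbf W}\mathbf D\mathbf V^{-1}(\lambda))}\right\}\ge p+2\,\frac{k\,\mathrm{tr}[\mathbf D^{-2}]}{(\mathrm{tr}[\mathbf D^{-1}])^2}.$$
   Context: Fay--Herriot model: $\mathbf y\,|\,\boldsymbol\mu\sim\mathcal N_k(\boldsymbol\mu,\mathbf D)$, $\mathbf D=\mathrm{diag}(d_1,\dots,d_k)$ known with $d_1\ge\cdots\ge d_k>0$, and $\boldsymbol\mu\sim\mathcal N_k(\mathbf X\boldsymbol\beta,\lambda\mathbf I)$ (this distribution of $\boldsymbol\mu$ is denoted $\pi$), where $\mathbf X$ is a known $k\times p$ matrix of rank $p$ and $\boldsymbol\beta\in\mathbb R^p$, $\lambda>0$ are unknown. $\mathbf Q$ is a $k\times k$ (symmetric) positive definite matrix; $\mathbf W$ is a $k\times m$ matrix of rank $m$, $m<k$; $\mathbf t=\mathbf t(\mathbf y)$ is a given $\mathbb R^m$-valued function with finite second moments. The asymptotics are for $k\to\infty$ with $p$, $m$ and $\lambda$ fixed. The unconditional risk is $R^U(\pi,\widehat{\boldsymbol\mu})=E[(\widehat{\boldsymbol\mu}-\boldsymbol\mu)'\mathbf Q(\widehat{\boldsymbol\mu}-\boldsymbol\mu)]$,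 the expectation being over the joint distribution of $(\mathbf y,\boldsymbol\mu)$. Notation: $\mathbf V(\lambda)=\mathbf D+\lambda\mathbf I$, $$\mathbf A(\lambda)=\mathbf V(\lambda)^{-1}-\mathbf V(\lambda)^{-1}\mathbf X(\mathbf X'\mathbf V(\lambda)^{-1}\mathbf X)^{-1}\mathbf X'\mathbf V(\lambda)^{-1}.$$ $\hat\lambda=\max\{\lambda^*,0\}$, where $\lambda^*$ is the solution of $\mathbf y'\mathbf A(\lambda^* )\mathbf y=k-p$ (so $\hat\lambda$ is the positive solution if one exists and $0$ otherwise). $\widehat{\boldsymbol\mu}^{\mathrm{EB}}(\hat\lambda)=\mathbf y-\mathbf D\mathbf A(\hat\lambda)\mathbf y$. With $\mathbf P_{\mathbf W}=\mathbf Q^{-1}\mathbf W(\mathbf W'\mathbf Q^{-1}\mathbf W)^{-1}\mathbf W'$, $$\widehat{\boldsymbol\mu}^{\mathrm{CEB}}(\hat\lambda,\mathbf t)=(\mathbf I-\mathbf P_{\mathbf W})\widehat{\boldsymbol\mu}^{\mathrm{EB}}(\hat\lambda)+\mathbf Q^{-1}\mathbf W(\mathbf W'\mathbf Q^{-1}\mathbf W)^{-1}\mathbf t(\mathbf y),$$ $$\widehat{\boldsymbol\mu}^{\mathrm{CM}}(\mathbf t)=\mathbf y+\mathbf Q^{-1}\mathbf W(\mathbf W'\mathbf Q^{-1}\mathbf W)^{-1}\{\mathbf t(\mathbf y)-\mathbf W'\mathbf y\}.$$ $\mathbf Q_{\mathbf W}=\mathbf Q-\mathbf W(\mathbf W'\mathbf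 Q^{-1}\mathbf W)^{-1}\mathbf W'$, and $\mathrm{Ch}_{\max}(\mathbf C)$ denotes the maximum eigenvalue of $\mathbf C$.
   Formalization: The expansion additionally assumes that the largest eigenvalue of Q stays bounded as k→∞; without control of Q it fails: D=I, X=(1,…,1)', Q=I+11', W=e_1−e_2 gives an error of exact order 1/k. *)

(* Defs.v *)
From HB Require Import structures.
From mathcomp Require Import all_boot all_order all_algebra.
From mathcomp Require Import all_classical all_reals all_analysis.
Set Implicit Arguments.
Unset Strict Implicit.
Unset Printing Implicit Defensive.

Import Order.TTheory GRing.Theory Num.Theory.
Import numFieldNormedType.Exports.

Local Open Scope classical_set_scope.
Local Open Scope ring_scope.

Definition qform {R : realType} {n : nat} (M : 'M[R]_n) (x : 'cV[R]_n) : R :=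
  (x^T *m M *m x) 0 0.

Definition posdef {R : realType} {n : nat} (M : 'M[R]_n) : Prop :=
  M^T = M /\ forall x : 'cV[R]_n, x != 0 -> 0 < qform M x.

Definition Ch_max {R : realType} {n : nat} (C : 'M[R]_n) : R :=
  sup [set a : R | eigenvalue C a].

Definition Dmx {R : realType} {k : nat} (d : 'rV[R]_k) : 'M[R]_k := diag_mx d.

Definition Vmx {R : realType} {k : nat} (d : 'rV[R]_k) (lam : R) : 'M[R]_k :=
  Dmx d + lam%:M.

Definition Amx {R : realType} {k p : nat} (d : 'rV[R]_k) (X : 'M[R]_(k, p))
    (lam : R) : 'M[R]_k :=
  invmx (Vmx d lam)
  - invmx (Vmx d lam) *m X *m invmx (X^T *m invmx (Vmx d lam) *m X)
      *m X^T *m invmx (Vmx d lam).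

(* For lam > 0 the equation has at most one solution, unless k = p and X is
   square (A = 0), a case in which the estimators do not depend on lam. *)
Definition lambda_hat {R : realType} {k p : nat} (d : 'rV[R]_k)
    (X : 'M[R]_(k, p)) (y : 'cV[R]_k) : R :=
  xget 0 [set lam : R | 0 < lam /\ qform (Amx d X lam) y = k%:R - p%:R].

Definition mu_EB {R : realType} {k p : nat} (d : 'rV[R]_k) (X : 'M[R]_(k, p))
    (lam : R) (y : 'cV[R]_k) : 'cV[R]_k :=
  y - Dmx d *m Amx d X lam *m y.

(* Q^-1 W (W' Q^-1 W)^-1 *)
Definition Gmx {R : realType} {k m : nat} (Q : 'M[R]_k) (W : 'M[R]_(k, m)) :
    'M[R]_(k, m) :=
  invmx Q *m W *m invmx (W^T *m invmx Q *m W).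

Definition PWmx {R : realType} {k m : nat} (Q : 'M[R]_k) (W : 'M[R]_(k, m)) :
    'M[R]_k :=
  Gmx Q W *m W^T.

Definition QWmx {R : realType} {k m : nat} (Q : 'M[R]_k) (W : 'M[R]_(k, m)) :
    'M[R]_k :=
  Q - W *m invmx (W^T *m invmx Q *m W) *m W^T.

Definition mu_CEB {R : realType} {k p m : nat} (d : 'rV[R]_k)
    (X : 'M[R]_(k, p)) (Q : 'M[R]_k) (W : 'M[R]_(k, m))
    (t : 'cV[R]_k -> 'cV[R]_m) (y : 'cV[R]_k) : 'cV[R]_k :=
  (1%:M - PWmx Q W) *m mu_EB d X (lambda_hat d X y) y + Gmx Q W *m t y.

Definition mu_CM {R : realType} {k m : nat} (Q : 'M[R]_k) (W : 'M[R]_(k, m))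
    (t : 'cV[R]_k -> 'cV[R]_m) (y : 'cV[R]_k) : 'cV[R]_k :=
  y + Gmx Q W *m (t y - W^T *m y).

Definition Delta_APR {R : realType} {k p m : nat} (d : 'rV[R]_k)
    (X : 'M[R]_(k, p)) (Q : 'M[R]_k) (W : 'M[R]_(k, m)) (lam : R) : R :=
  let D := Dmx d in
  let QW := QWmx Q W in
  let Vi := invmx (Vmx d lam) in
  - \tr (D *m QW *m D *m Vi)
  + \tr (invmx (X^T *m Vi *m X) *m X^T *m Vi *m D *m QW *m D *m Vi *m X)
  + \tr (D *m QW *m D *m (Vi *m Vi *m Vi)) * ((2 * k%:R) / \tr Vi ^+ 2).

(* Multivariate normal laws with diagonal covariance: the coordinates are
   independent and normal, which is expressed by the value of the law on
   measurable boxes. The vector v holds variances, whereas the second parameter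
   of normal_prob is a standard deviation. *)
Definition random_vector {d : measure_display} {T : measurableType d}
    {R : realType} {k : nat} (Z : T -> 'cV[R]_k) : Prop :=
  forall i, measurable_fun [set: T] (fun w => Z w i 0).

Definition box {d : measure_display} {T : measurableType d} {R : realType}
    {k : nat} (Z : T -> 'cV[R]_k) (A : 'I_k -> set R) : set T :=
  [set w | forall i, A i (Z w i 0)].

Definition normal_box {R : realType} {k : nat} (a : 'cV[R]_k) (v : 'rV[R]_k)
    (A : 'I_k -> set R) : \bar R :=
  (\prod_(i < k) normal_prob (a i 0%R) (Num.sqrt (v 0%R i)) (A i))%E.

Definition normal_vector {d : measure_display} {T : measurableType d}
    {R : realType} (P : probability T R) {k : nat} (Z : T -> 'cV[R]_k)
    (a : 'cV[R]_k) (v : 'rV[R]_k) : Prop :=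
  random_vector Z /\
  forall A : 'I_k -> set R, (forall i, measurable (A i)) ->
    P (box Z A) = normal_box a v A.

(* The conditional law of Y given Z is normal with mean Z and variances v. *)
Definition cond_normal_vector {d : measure_display} {T : measurableType d}
    {R : realType} (P : probability T R) {k : nat} (Y Z : T -> 'cV[R]_k)
    (v : 'rV[R]_k) : Prop :=
  random_vector Y /\
  forall A B : 'I_k -> set R,
    (forall i, measurable (A i)) -> (forall i, measurable (B i)) ->
    P (box Z A `&` box Y B) =
      (\int[P]_(w in box Z A) normal_box (Z w) v B)%E.

Definition risk {d : measure_display} {T : measurableType d} {R : realType}
    (P : probability T R) {k : nat} (Q : 'M[R]_k) (y mu : T -> 'cV[R]_k)
    (muhat : 'cV[R]_k -> 'cV[R]_k) : \bar R :=
  'E_P[fun w => qform Q (muhat (y w) - mu w)].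

Definition Delta_U {d : measure_display} {T : measurableType d} {R : realType}
    (P : probability T R) {k p m : nat} (dv : 'rV[R]_k) (X : 'M[R]_(k, p))
    (Q : 'M[R]_k) (W : 'M[R]_(k, m)) (t : 'cV[R]_k -> 'cV[R]_m)
    (y mu : T -> 'cV[R]_k) : R :=
  fine (risk P Q y mu (mu_CEB dv X Q W t) - risk P Q y mu (mu_CM Q W t))%E.

(* Main.v *)
Require Import Defs.
From HB Require Import structures.
From mathcomp Require Import all_boot all_order all_algebra.
From mathcomp Require Import all_classical all_reals all_analysis.
From mathcomp Require Import measurable_realfun ring lra.
Set Implicit Arguments.
Unset Strict Implicit.
Unset Printing Implicit Defensive.

Import Order.TTheory GRing.Theory Num.Theory.
Import numFieldNormedType.Exports.

Local Open Scope classical_set_scope.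
Local Open Scope ring_scope.

(** The two estimators differ by the shift D A(lambda_hat) y, projected on the
directions that the constraint leaves free. With z = y - X beta, M = D Q_W D and
g = A(lambda_hat) z, the constraint target t drops out of the difference of the
losses (loss_difference), and replacing y - mu by its posterior mean D V^-1 z
gives the exact formula Delta_U = E[g' M g - 2 z' V^-1 M g] (Delta_U_eq).
Posterior means are obtained from the laws on boxes by Tonelli's theorem and
Dynkin's lambda-system argument (posterior_noise, orthogonal_sigma_boxes).

The resolvent identity A(s) - A(t) = (t - s) A(s) A(t) makes the dependence on
the variance algebraic. It shows that lambda_hat is measurable and, with
delta = lambda_hat - lambda, that g = A z - delta A(lambda_hat) A z, so that the
loss has an exact second-order expansion in delta (loss_expansion). The defining
equation of lambda_hat gives delta = xi0 / tau up to second order, where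
xi0 = sum_i (z_i^2 / v_i - 1), v_i = d_i + lambda and tau = tr V^-1 (delta_bound,
newton_step); truncation at 0 is harmless because |delta| = lambda then. For each
large k and each z, the error of the expansion with xi0 / tau for delta is at
most a constant times k^(-1/2) times a power of the scale
G = 1 + (|xi0| + |eta0| + sum_j |u_j|) / sqrt k, where eta0 and the scores
u = X' V^-1 z are, like xi0, sums of k independent centred variables
(growth_error). No exceptional event has to be excluded.

The moments of G are bounded uniformly in k: a function h of a normal variable
that is centred and grows at most quadratically satisfies, after scaling,
E exp (+-h / sqrt k) <= 1 + L / k, and the product of k such factors is at most
exp L (normalized_sum_moment). What remains is an expectation of polynomials,
computed exactly from E[xi0 z' B z] = 2 tr(B V) and
E[xi0^2 z' B z] = (2 k + 8) tr(B V): the zeroth-order term gives - tr(M A), which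
is the sum of the first two terms of Delta_APR, the first-order term vanishes as
A V H = 0 for H = V^-1 - A, and the second-order term is
(2 k + 8) tr(M A^3) / tau^2. Since H has bounded trace, it is the third term of
Delta_APR up to O(k^(-1/2)) (trace_gap).

For the sign conditions M enters through the smallest rho with M <= rho V, which is
the largest eigenvalue of M V^-1 (rayleigh_le_Ch_max). It bounds all the traces,
and the ratio tr(V^-2) / tr(V^-1)^2 is largest at lambda = 0 by Chebyshev's sum
inequality (dispersion_le). The necessary condition is the limit lambda -> 0. *)

(** * Euclidean vectors and positive semidefinite matrices *)

Section dot.
Context {R : realType}.

Definition dot {n} (x y : 'cV[R]_n) : R := (x^T *m y) 0 0.
Definition vn {n} (x : 'cV[R]_n) : R := Num.sqrt (dot x x).

Lemma dotE n (x y : 'cV[R]_n) : dot x y = \sum_i x i 0 * y i 0.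
Proof. by rewrite /dot mxE; apply: eq_bigr => i _; rewrite mxE. Qed.

Lemma dotC n (x y : 'cV[R]_n) : dot x y = dot y x.
Proof. by rewrite !dotE; apply: eq_bigr => i _; rewrite mulrC. Qed.

Lemma dotDl n (x x' y : 'cV[R]_n) : dot (x + x') y = dot x y + dot x' y.
Proof. by rewrite /dot linearD mulmxDl mxE. Qed.

Lemma dotDr n (x y y' : 'cV[R]_n) : dot x (y + y') = dot x y + dot x y'.
Proof. by rewrite /dot mulmxDr mxE. Qed.

Lemma dotZl n a (x y : 'cV[R]_n) : dot (a *: x) y = a * dot x y.
Proof. by rewrite /dot linearZ -scalemxAl mxE. Qed.

Lemma dotZr n a (x y : 'cV[R]_n) : dot x (a *: y) = a * dot x y.
Proof. by rewrite dotC dotZl dotC. Qed.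

Lemma dotNl n (x y : 'cV[R]_n) : dot (- x) y = - dot x y.
Proof. by rewrite -scaleN1r dotZl mulN1r. Qed.

Lemma dotNr n (x y : 'cV[R]_n) : dot x (- y) = - dot x y.
Proof. by rewrite dotC dotNl dotC. Qed.

Lemma dotBl n (x x' y : 'cV[R]_n) : dot (x - x') y = dot x y - dot x' y.
Proof. by rewrite dotDl dotNl. Qed.

Lemma dotBr n (x y y' : 'cV[R]_n) : dot x (y - y') = dot x y - dot x y'.
Proof. by rewrite dotDr dotNr. Qed.

Lemma dot0l n (x : 'cV[R]_n) : dot 0 x = 0.
Proof. by rewrite /dot trmx0 mul0mx mxE. Qed.

Lemma dot0r n (x : 'cV[R]_n) : dot x 0 = 0.
Proof. by rewrite dotC dot0l. Qed.

Lemma dot_mxr m n (M : 'M[R]_(m, n)) x y : dot x (M *m y) = dot (M^T *m x) y.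
Proof. by rewrite /dot trmx_mul trmxK mulmxA. Qed.

Lemma dot_mxl m n (M : 'M[R]_(m, n)) x y : dot (M *m x) y = dot x (M^T *m y).
Proof. by rewrite dot_mxr trmxK. Qed.

Lemma qformE n (M : 'M[R]_n) x : qform M x = dot x (M *m x).
Proof. by rewrite /qform /dot mulmxA. Qed.

Lemma dot_ge0 n (x : 'cV[R]_n) : 0 <= dot x x.
Proof. by rewrite dotE sumr_ge0// => i _; rewrite -expr2 sqr_ge0. Qed.

Lemma dot_eq0 n (x : 'cV[R]_n) : dot x x = 0 -> x = 0.
Proof.
rewrite dotE => /psumr_eq0P => h; apply/matrixP => i j; rewrite (ord1 j) mxE.
apply/eqP; rewrite -[_ == _]orbb -mulf_eq0 h// => a _.
by rewrite -expr2 sqr_ge0.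
Qed.

Definition psd {n} (M : 'M[R]_n) : Prop :=
  M^T = M /\ forall x, 0 <= dot x (M *m x).

Lemma sym_dot n (M : 'M[R]_n) x y : M^T = M -> dot (M *m x) y = dot x (M *m y).
Proof. by move=> h; rewrite dot_mxl h. Qed.

(** Cauchy-Schwarz for a possibly degenerate form: when y is isotropic but not
orthogonal to x, a large multiple of y added to x makes the form negative. *)
Lemma psd_CS n (M : 'M[R]_n) x y : psd M ->
  dot x (M *m y) ^+ 2 <= dot x (M *m x) * dot y (M *m y).
Proof.
move=> [sM pM].
set b := dot x (M *m y); set qx := dot x _; set qy := dot y _.
have bC : dot y (M *m x) = b by rewrite /b -(sym_dot _ _ sM) dotC.
have q a c : 0 <= a ^+ 2 * qx + 2 * a * c * b + c ^+ 2 * qy.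
  have := pM (a *: x + c *: y).
  rewrite mulmxDr -!scalemxAr !(dotDl, dotDr, dotZl, dotZr) bC -/b -/qx -/qy.
  by congr (_ <= _); ring.
have qx0 : 0 <= qx by exact: pM.
have qy0 : 0 <= qy by exact: pM.
have [qy_gt0|] := ltP 0 qy.
  have := q qy (- b).
  have -> : qy ^+ 2 * qx + 2 * qy * - b * b + (- b) ^+ 2 * qy
    = qy * (qx * qy - b ^+ 2) by ring.
  by rewrite pmulr_rge0// subr_ge0.
move=> qyle; have qyE : qy = 0 by apply/eqP; rewrite eq_le qyle qy0.
rewrite qyE mulr0; have [->|b0] := eqVneq b 0; first by rewrite expr0n.
have := q 1 (- (qx + 1) / (2 * b)).
rewrite qyE mulr0 addr0 expr1n !mul1r mulr1.
have -> : qx + 2 * (- (qx + 1) / (2 * b)) * b = - 1 by field.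
by rewrite oppr_ge0 ler10.
Qed.

Lemma psd1 n : psd (1%:M : 'M[R]_n).
Proof. by split=> [|x]; rewrite ?trmx1// mul1mx dot_ge0. Qed.

Lemma vn_ge0 n (x : 'cV[R]_n) : 0 <= vn x.
Proof. exact: sqrtr_ge0. Qed.

Lemma vn_sqr n (x : 'cV[R]_n) : vn x ^+ 2 = dot x x.
Proof. by rewrite sqr_sqrtr// dot_ge0. Qed.

Lemma dot_le_vn n (x y : 'cV[R]_n) : `|dot x y| <= vn x * vn y.
Proof.
rewrite -ler_sqr ?nnegrE ?mulr_ge0 ?vn_ge0// real_normK ?num_real//.
by have := psd_CS x y (psd1 n); rewrite !mul1mx exprMn !vn_sqr.
Qed.

Lemma vn_le n (x : 'cV[R]_n) (a : R) : 0 <= a -> dot x x <= a ^+ 2 -> vn x <= a.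
Proof. by move=> a0 h; rewrite -ler_sqr ?nnegrE ?vn_ge0// vn_sqr. Qed.

Lemma coord_le_vn n (x : 'cV[R]_n) i : `|x i 0| <= vn x.
Proof.
rewrite -ler_sqr ?nnegrE ?vn_ge0// real_normK ?num_real// vn_sqr dotE.
rewrite (bigD1 i)//= -expr2 lerDl sumr_ge0// => j _.
by rewrite -expr2 sqr_ge0.
Qed.

Lemma vn_le_sum n (x : 'cV[R]_n) : vn x <= \sum_i `|x i 0|.
Proof.
apply: vn_le; first by rewrite sumr_ge0.
rewrite dotE expr2 mulr_suml ler_sum// => i _.
apply: le_trans (ler_norm _) _; rewrite normrM ler_wpM2l//.
by rewrite (bigD1 i)//= lerDl sumr_ge0.
Qed.

Definition mxbound {m n} (M : 'M[R]_(m, n)) : R := \sum_i \sum_j `|M i j|.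

Lemma mxbound_ge0 m n (M : 'M[R]_(m, n)) : 0 <= mxbound M.
Proof. by rewrite sumr_ge0// => i _; rewrite sumr_ge0. Qed.

Lemma dot_mxbound m n (M : 'M[R]_(m, n)) x y :
  `|dot x (M *m y)| <= mxbound M * (vn x * vn y).
Proof.
rewrite dotE (le_trans (ler_norm_sum _ _ _))// /mxbound mulr_suml ler_sum// => i _.
rewrite mxE normrM mulr_suml.
rewrite (@le_trans _ _ (`|x i 0| * \sum_j `|M i j| * `|y j 0|))//.
  rewrite ler_wpM2l// (le_trans (ler_norm_sum _ _ _))//.
  by rewrite ler_sum// => j _; rewrite normrM.
rewrite mulr_sumr ler_sum// => j _.
by rewrite mulrCA ler_wpM2l// ler_pM ?coord_le_vn.
Qed.

(** Write |x|^2 = x' M (M^-1 x) and use Cauchy-Schwarz for the form of M. *)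
Lemma psd_unit_coercive n (M : 'M[R]_n) : psd M -> M \in unitmx ->
  exists2 K, 0 < K & forall x, dot x x <= K * dot x (M *m x).
Proof.
move=> pM uM; have [sM M0] := pM.
exists (mxbound (invmx M) + 1) => [|x]; first by rewrite ltr_pwDr// mxbound_ge0.
have := psd_CS x (invmx M *m x) pM; rewrite mulmxA mulmxV// mul1mx.
have := le_trans (ler_norm _) (dot_mxbound (invmx M) x x).
rewrite -(dotC x) -expr2 vn_sqr.
have := M0 x; have := dot_ge0 x; have := mxbound_ge0 (invmx M).
set a := dot x x; set b := dot x (M *m x); set K := mxbound _.
move: (dot x (invmx M *m x)) => c K0 a0 b0 cK h.
have [->|an0] := eqVneq a 0; first by rewrite mulr_ge0// addr_ge0.
have agt0 : 0 < a by rewrite lt0r an0.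
rewrite -(ler_pM2l agt0) -expr2 (le_trans h)//.
rewrite (le_trans (ler_wpM2l b0 cK))//.
by rewrite (_ : b * _ = a * (K * b)) ?ler_pM2l// ?ler_wpM2r ?lerDl//; ring.
Qed.

End dot.

(** * The largest eigenvalue as the maximum of the Rayleigh quotient *)

Section chmax.
Context {R : realType}.

Lemma unit_or_kernel n (M : 'M[R]_n) :
  M \notin unitmx -> exists2 v : 'rV_n, v != 0 & v *m M = 0.
Proof.
rewrite -row_free_unit -kermx_eq0 => /rowV0Pn[v vM v0].
by exists v => //; exact/sub_kermxP.
Qed.

Lemma definite_unit n (M : 'M[R]_n) :
  (forall x, dot x (M *m x) = 0 -> x = 0) -> M \in unitmx.
Proof.
move=> h; apply/negPn/negP => /unit_or_kernel[v v0 vM].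
suff /(congr1 trmx) : v^T = 0 by rewrite trmxK trmx0 => /eqP; rewrite (negPf v0).
by apply: h; rewrite /dot trmxK mulmxA vM mul0mx mxE.
Qed.

Lemma definite_gram_unit n q (S : 'M[R]_n) (X : 'M[R]_(n, q)) :
  (forall x, dot x (S *m x) = 0 -> x = 0) -> \rank X = q ->
  X^T *m S *m X \in unitmx.
Proof.
move=> h rX; apply: definite_unit => x.
rewrite -!mulmxA dot_mxr trmxK => /h Xx0.
have : row_free X^T by rewrite /row_free mxrank_tr rX.
move=> /(@mulmx_free_eq0 _ _ _ _ (trmx x)).
rewrite -trmx_mul Xx0 trmx0 eqxx => /esym/eqP.
by move=> /(congr1 trmx); rewrite trmxK trmx0.
Qed.

Lemma coercive_definite n (V : 'M[R]_n) : psd V -> V \in unitmx ->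
  forall x, dot x (V *m x) = 0 -> x = 0.
Proof.
move=> pV uV x h; apply: dot_eq0; have [K K0 /(_ x)] := psd_unit_coercive pV uV.
by rewrite h mulr0 => xx; apply/eqP; rewrite eq_le xx dot_ge0.
Qed.

(** The least s for which s V - M is positive semidefinite makes that matrix
singular (otherwise the form would be coercive and s could be lowered), so it is
an eigenvalue of M V^-1. This yields the extremal eigenvalue over the reals
without any spectral theorem. *)
Lemma rayleigh_le_Ch_max n (M V : 'M[R]_n) : (0 < n)%N -> M^T = M ->
  psd V -> V \in unitmx ->
  forall x, dot x (M *m x) <= Ch_max (M *m invmx V) * dot x (V *m x).
Proof.
move=> n0 sM pV uV; have [sV V0] := pV.
have [K K0 hK] := psd_unit_coercive pV uV.
have defV := coercive_definite pV uV.
have Vgt0 x : x != 0 -> 0 < dot x (V *m x).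
  by move=> x0; rewrite lt0r V0 andbT; apply: contra_neq x0; exact: defV.
pose S := [set s : R | forall x, dot x (M *m x) <= s * dot x (V *m x)].
have S0 : S !=set0.
  exists (mxbound M * K) => x.
  rewrite (le_trans (le_trans (ler_norm _) (dot_mxbound M x x)))//.
  by rewrite -expr2 vn_sqr -mulrA ler_wpM2l ?mxbound_ge0.
have lbS (x : 'cV_n) : x != 0 -> lbound S (dot x (M *m x) / dot x (V *m x)).
  by move=> x0 s Ss; rewrite ler_pdivrMr ?Vgt0.
pose e : 'cV[R]_n := const_mx 1.
have e0 : e != 0.
  apply/eqP => /matrixP/(_ (Ordinal n0) 0); rewrite !mxE => /eqP.
  by rewrite oner_eq0.
have hinf : has_inf S by split => //; exists (dot e (M *m e) / dot e (V *m e)); exact: lbS.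
pose rho := inf S.
have Srho : S rho.
  move=> x; have [->|x0] := eqVneq x 0; first by rewrite !dot0l mulr0.
  by rewrite -ler_pdivrMr ?Vgt0//; apply: lb_le_inf => //; exact: lbS.
pose B := rho *: V - M.
have BE x : dot x (B *m x) = rho * dot x (V *m x) - dot x (M *m x).
  by rewrite mulmxBl -scalemxAl dotBr dotZr.
have pB : psd B.
  split; first by rewrite linearB linearZ /= sV sM.
  by move=> x; rewrite BE subr_ge0.
have uB : B \notin unitmx.
  apply/negP => uB; have [K' K'0 hK'] := psd_unit_coercive pB uB.
  pose c := mxbound V * K' + 1.
  have c0 : 0 < c by rewrite ltr_pwDr// mulr_ge0 ?mxbound_ge0// ltW.
  suff : S (rho - c^-1).
    move=> /(ge_inf hinf.2); rewrite -/rho lerBrDr gerDl invr_le0 leNgt c0.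
    by [].
  move=> x; rewrite mulrBl lerBrDr -lerBrDl -BE ler_pdivrMl//.
  apply: (@le_trans _ _ (mxbound V * K' * dot x (B *m x))); last first.
    by rewrite ler_wpM2r ?lerDl//; have [_] := pB; exact.
  rewrite (le_trans (le_trans (ler_norm _) (dot_mxbound V x x)))//.
  by rewrite -expr2 vn_sqr -mulrA ler_wpM2l ?mxbound_ge0.
have [v v0 vB] := unit_or_kernel uB.
have vM : v *m M = rho *: (v *m V).
  by move: vB; rewrite mulmxBr -scalemxAr => /eqP; rewrite subr_eq0 => /eqP.
have erho : eigenvalue (M *m invmx V) rho.
  by apply/eigenvalueP; exists v => //; rewrite mulmxA vM -scalemxAl mulmxK.
have ub : ubound [set a : R | eigenvalue (M *m invmx V) a] rho.
  move=> a /= /eigenvalueP[w wa w0].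
  have wM : w *m M = a *: (w *m V) by rewrite -[LHS](mulmxKV uV) -(mulmxA w) wa scalemxAl.
  have := Srho (trmx w).
  rewrite (_ : dot _ (M *m _) = a * dot (trmx w) (V *m trmx w)); last first.
    by rewrite /dot trmxK !mulmxA wM -scalemxAl mxE.
  rewrite ler_pM2r// Vgt0//.
  by apply: contra_neq w0 => /(congr1 trmx); rewrite trmxK trmx0.
move=> x; rewrite (le_trans (Srho x))// ler_wpM2r ?V0//.
by apply: ub_le_sup => //; exists rho.
Qed.

Lemma qform_le_Ch_max n (M : 'M[R]_n) : (0 < n)%N -> M^T = M ->
  forall x, dot x (M *m x) <= Ch_max M * dot x x.
Proof.
move=> n0 sM x.
have := rayleigh_le_Ch_max n0 sM (psd1 n) (unitmx1 _ n) x.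
by rewrite invmx1 mulmx1 mul1mx.
Qed.

End chmax.

(** * The residual projector *)

Section Amatrix.
Context {R : realType} {k p : nat}.
Variables (d : 'rV[R]_k) (X : 'M[R]_(k, p)).
Hypothesis d0 : forall i, 0 < d 0 i.
Hypothesis rX : \rank X = p.

Local Notation V := (Vmx d).
Local Notation A := (Amx d X).
Implicit Types (s t : R) (x : 'cV[R]_k).

Definition precision (s : R) : 'rV[R]_k := \row_i (d 0 i + s)^-1.
Definition hat (s : R) : 'M[R]_k :=
  diag_mx (precision s) *m X *m invmx (X^T *m diag_mx (precision s) *m X) *m X^T
    *m diag_mx (precision s).
(** The part of V^-1 explained by the regressors, so that A = V^-1 - H. It is
locked because unification would otherwise unfold it inside products. *)
Definition Hmx := locked hat.

Lemma HmxE s : Hmx s = hat s.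
Proof. by rewrite /Hmx -lock. Qed.

Lemma v_gt0 i s : 0 <= s -> 0 < d 0 i + s.
Proof. by move=> s0; rewrite ltr_wpDr. Qed.

Lemma VmxE s : V s = diag_mx (d + const_mx s).
Proof. by rewrite /Vmx /Dmx linearD /= diag_const_mx. Qed.

Lemma Vmx0 : V 0 = Dmx d.
Proof. by rewrite /Vmx raddf0 addr0. Qed.

Lemma mulVmx_vi s : 0 <= s -> V s *m diag_mx (precision s) = 1%:M.
Proof.
move=> s0; rewrite VmxE mulmx_diag -diag_const_mx; congr diag_mx.
by apply/rowP => i; rewrite !mxE divff// gt_eqF// v_gt0.
Qed.

Lemma Vmx_unit s : 0 <= s -> V s \in unitmx.
Proof. by move=> /mulVmx_vi /mulmx1_unit[]. Qed.

Lemma invVmx s : 0 <= s -> invmx (V s) = diag_mx (precision s).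
Proof.
move=> s0; rewrite -[LHS]mulmx1 -(mulVmx_vi s0) mulmxA mulVmx ?mul1mx//.
exact: Vmx_unit.
Qed.

Lemma vi_mulVmx s : 0 <= s -> diag_mx (precision s) *m V s = 1%:M.
Proof. by move=> s0; rewrite -invVmx// mulVmx// Vmx_unit. Qed.

Lemma tr_vi s : (diag_mx (precision s))^T = diag_mx (precision s).
Proof. by rewrite tr_diag_mx. Qed.

Lemma tr_Vmx s : (V s)^T = V s.
Proof. by rewrite VmxE tr_diag_mx. Qed.

Lemma dot_diag n (e : 'rV[R]_n) (x y : 'cV[R]_n) :
  dot x (diag_mx e *m y) = \sum_i e 0 i * (x i 0 * y i 0).
Proof. by rewrite dotE; apply: eq_bigr => i _; rewrite mul_diag_mx mxE mulrCA. Qed.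

Lemma Vmx_ge s c : (forall i, c <= d 0 i) ->
  forall x, (c + s) * dot x x <= dot x (V s *m x).
Proof.
move=> hc x; rewrite VmxE dot_diag dotE mulr_sumr ler_sum// => i _.
by rewrite !mxE ler_wpM2r ?lerD2r// -expr2 sqr_ge0.
Qed.

Lemma psd_Vmx s : 0 <= s -> psd (V s).
Proof.
move=> s0; split=> [|x]; first exact: tr_Vmx.
rewrite VmxE dot_diag sumr_ge0// => i _; rewrite !mxE mulr_ge0// -?expr2 ?sqr_ge0//.
by rewrite ltW// v_gt0.
Qed.

Lemma psd_vi s : 0 <= s -> psd (diag_mx (precision s)).
Proof.
move=> s0; split=> [|x]; first exact: tr_vi.
rewrite dot_diag sumr_ge0// => i _; rewrite !mxE mulr_ge0// -?expr2 ?sqr_ge0//.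
by rewrite invr_ge0 ltW// v_gt0.
Qed.

Lemma vi_unit s : 0 <= s -> diag_mx (precision s) \in unitmx.
Proof. by move=> /mulVmx_vi /mulmx1_unit[]. Qed.

Local Notation N s := (X^T *m diag_mx (precision s) *m X).

Lemma gram_unit s : 0 <= s -> N s \in unitmx.
Proof.
move=> s0; apply: definite_gram_unit => //; apply: coercive_definite.
  exact: psd_vi.
exact: vi_unit.
Qed.

Lemma tr_gram s : (N s)^T = N s.
Proof. by rewrite !trmx_mul trmxK tr_vi mulmxA. Qed.

Lemma AmxE s : 0 <= s -> A s = diag_mx (precision s) - Hmx s.
Proof. by move=> s0; rewrite /Amx HmxE /hat invVmx. Qed.

Lemma tr_Hmx s : (Hmx s)^T = Hmx s.
Proof. by rewrite HmxE /hat !trmx_mul trmxK trmx_inv tr_gram !tr_vi !mulmxA. Qed.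

Lemma tr_Amx s : 0 <= s -> (A s)^T = A s.
Proof. by move=> s0; rewrite AmxE// linearB /= tr_Hmx tr_vi. Qed.

Lemma HmxX s : 0 <= s -> Hmx s *m X = diag_mx (precision s) *m X.
Proof.
move=> s0; rewrite HmxE /hat -(mulmxA _ X^T) -(mulmxA _ (X^T *m _) X).
by rewrite -(mulmxA _ (invmx _)) mulVmx ?mulmx1// gram_unit.
Qed.

Lemma XtHmx s : 0 <= s -> X^T *m Hmx s = X^T *m diag_mx (precision s).
Proof.
by move=> s0; apply: trmx_inj; rewrite [LHS]trmx_mul [RHS]trmx_mul tr_Hmx !trmxK tr_vi HmxX.
Qed.

Lemma AmxX s : 0 <= s -> A s *m X = 0.
Proof. by move=> s0; rewrite AmxE// mulmxBl HmxX// subrr. Qed.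

Lemma XtAmx s : 0 <= s -> X^T *m A s = 0.
Proof.
by move=> s0; apply: trmx_inj; rewrite trmx_mul trmxK tr_Amx// AmxX// trmx0.
Qed.

(** Weighted least-squares residuals for different weights: fitting with the
weights of s the residuals of the fit with the weights of t changes nothing. *)
Lemma AVA_l s t : 0 <= s -> 0 <= t -> A s *m V s *m A t = A t.
Proof.
move=> s0 t0; rewrite {1}AmxE// mulmxBl vi_mulVmx// mulmxBl mul1mx.
rewrite HmxE /hat -(mulmxA _ (diag_mx _) (V s)) vi_mulVmx// mulmx1 -(mulmxA _ X^T).
by rewrite XtAmx// mulmx0 subr0.
Qed.

Lemma AVA_r s t : 0 <= s -> 0 <= t -> A s *m V t *m A t = A s.
Proof.
move=> s0 t0; apply: trmx_inj; rewrite !trmx_mul !tr_Amx// tr_Vmx mulmxA.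
exact: AVA_l.
Qed.

(** A(s) V(t) A(t) is both A(s) and, with V(s) for V(t), A(t); the two middle
factors differ by a scalar. All dependence on the variance goes through this
resolvent identity. *)
Lemma Amx_resolvent s t : 0 <= s -> 0 <= t ->
  A s - A t = (t - s) *: (A s *m A t).
Proof.
move=> s0 t0; rewrite -{1}(AVA_r s0 t0) -{2}(AVA_l s0 t0) -mulmxBl -mulmxBr.
rewrite /Vmx opprD addrACA subrr add0r -raddfB /= mul_mx_scalar.
by rewrite -scalemxAl.
Qed.

Lemma HVH s : 0 <= s -> Hmx s *m V s *m Hmx s = Hmx s.
Proof.
move=> s0; rewrite {1}HmxE /hat -(mulmxA _ (diag_mx (precision s)) (V s)) vi_mulVmx// mulmx1.
by rewrite -(mulmxA _ X^T) XtHmx// mulmxA HmxE.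
Qed.

(** The trace counts the regressors, which keeps every trace against H bounded as
the dimension grows. *)
Lemma tr_HV s : 0 <= s -> \tr (Hmx s *m V s) = p%:R.
Proof.
move=> s0; rewrite HmxE /hat -(mulmxA _ (diag_mx (precision s)) (V s)) vi_mulVmx// mulmx1.
by rewrite mxtrace_mulC !mulmxA mulmxV ?gram_unit// mxtrace1.
Qed.

Lemma qA_eq s x : 0 <= s -> dot (A s *m x) (V s *m (A s *m x)) = dot x (A s *m x).
Proof. by move=> s0; rewrite sym_dot ?tr_Amx// !mulmxA AVA_l. Qed.

Lemma qH_eq s x : 0 <= s ->
  dot (Hmx s *m x) (V s *m (Hmx s *m x)) = dot x (Hmx s *m x).
Proof. by move=> s0; rewrite sym_dot ?tr_Hmx// !mulmxA HVH. Qed.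

Lemma psd_Amx s : 0 <= s -> psd (A s).
Proof.
move=> s0; split=> [|x]; first exact: tr_Amx.
by rewrite -qA_eq//; have [_] := psd_Vmx s0; exact.
Qed.

Lemma psd_Hmx s : 0 <= s -> psd (Hmx s).
Proof.
move=> s0; split=> [|x]; first exact: tr_Hmx.
by rewrite -qH_eq//; have [_] := psd_Vmx s0; exact.
Qed.

Section bounds.
Variable c : R.
Hypotheses (c0 : 0 < c) (hc : forall i, c <= d 0 i).

Lemma qA_ge s x : 0 <= s -> (c + s) * dot (A s *m x) (A s *m x) <= dot x (A s *m x).
Proof. by move=> s0; rewrite -qA_eq//; exact: Vmx_ge. Qed.

Lemma qH_ge s x : 0 <= s -> c * dot (Hmx s *m x) (Hmx s *m x) <= dot x (Hmx s *m x).
Proof.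
move=> s0; rewrite -qH_eq//; apply: le_trans (Vmx_ge _ hc _).
by rewrite ler_wpM2r ?dot_ge0// lerDl.
Qed.

(** Cauchy-Schwarz turns a lower bound on the form of B into an operator bound. *)
Lemma contr_of_form (B : 'M[R]_k) (a : R) x : 0 < a ->
  a * dot (B *m x) (B *m x) <= dot x (B *m x) -> vn (B *m x) <= vn x / a.
Proof.
move=> a0 h; rewrite ler_pdivlMr// mulrC.
have := le_trans h (le_trans (ler_norm _) (dot_le_vn x (B *m x))).
rewrite -vn_sqr expr2 mulrA.
have [->|n0] := eqVneq (vn (B *m x)) 0; first by rewrite !mulr0 vn_ge0.
by rewrite ler_pM2r// lt0r n0 vn_ge0.
Qed.

Lemma vn_Amx_le_s s x : 0 <= s -> vn (A s *m x) <= vn x / (c + s).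
Proof.
by move=> s0; apply: contr_of_form (qA_ge _ s0); rewrite ltr_wpDr.
Qed.

Lemma vn_Amx_le s x : 0 <= s -> vn (A s *m x) <= vn x / c.
Proof.
move=> s0; apply: contr_of_form => //; apply: le_trans (qA_ge _ s0).
by rewrite ler_wpM2r ?dot_ge0// lerDl.
Qed.

Lemma vn_vi_le s x : 0 <= s -> vn (diag_mx (precision s) *m x) <= vn x / c.
Proof.
move=> s0; apply: contr_of_form => //.
rewrite dot_diag dotE mulr_sumr ler_sum// => i _.
rewrite mul_diag_mx !mxE; set w := (_ + s)^-1; set y := x i 0.
rewrite (_ : c * _ = c * w * (w * (y * y))); last by ring.
have w0 : 0 < w by rewrite invr_gt0 v_gt0.
rewrite [leRHS]mulrCA ler_piMl//; first by rewrite mulr_ge0 ?(ltW w0)// -expr2 sqr_ge0.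
by rewrite ler_pdivrMr ?v_gt0// mul1r (le_trans (hc i))// lerDl.
Qed.

End bounds.
End Amatrix.

(** * The constraint projector and the loss difference *)

Section constraint.
Context {R : realType} {k m : nat}.
Variables (Q : 'M[R]_k) (W : 'M[R]_(k, m)).
Hypothesis pQ : posdef Q.
Hypothesis rW : \rank W = m.

Lemma posdef_psd : psd Q.
Proof.
have [sQ Q0] := pQ; split => // x.
have [->|/Q0] := eqVneq x 0; first by rewrite dot0l.
by rewrite qformE => /ltW.
Qed.

Lemma posdef_definite x : dot x (Q *m x) = 0 -> x = 0.
Proof.
have [sQ Q0] := pQ; move=> h; apply/eqP; apply: contraTT isT => /Q0.
by rewrite qformE h ltxx.
Qed.

Lemma posdef_unit : Q \in unitmx.
Proof. exact: definite_unit posdef_definite. Qed.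

Let K := W^T *m invmx Q *m W.

Lemma constraint_gram_unit : K \in unitmx.
Proof.
apply: definite_gram_unit => // x h.
suff : invmx Q *m x = 0.
  by move=> /(congr1 (mulmx Q)); rewrite mulmxA mulmxV ?posdef_unit// mul1mx mulmx0.
apply: posdef_definite; rewrite mulmxA mulmxV ?posdef_unit// mul1mx.
by rewrite dotC.
Qed.

Let trK : K^T = K.
Proof.
by have [sQ _] := pQ; rewrite /K !trmx_mul trmxK trmx_inv sQ mulmxA.
Qed.

Lemma tr_QWmx : (QWmx Q W)^T = QWmx Q W.
Proof.
have [sQ _] := pQ.
by rewrite /QWmx linearB /= !trmx_mul trmxK trmx_inv trK sQ mulmxA.
Qed.

Lemma WtGmx : W^T *m Gmx Q W = 1%:M.
Proof. by rewrite /Gmx !mulmxA mulmxV// constraint_gram_unit. Qed.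

Lemma QGmx : Q *m Gmx Q W = W *m invmx K.
Proof. by rewrite /Gmx !mulmxA mulmxV ?posdef_unit// mul1mx. Qed.

Lemma QWGmx : QWmx Q W *m Gmx Q W = 0.
Proof. by rewrite /QWmx mulmxBl QGmx -(mulmxA _ W^T) WtGmx mulmx1 subrr. Qed.

Lemma QWPmx : QWmx Q W *m PWmx Q W = 0.
Proof. by rewrite /PWmx mulmxA QWGmx mul0mx. Qed.

Lemma QPmx : Q *m (1%:M - PWmx Q W) = QWmx Q W.
Proof. by rewrite mulmxBr mulmx1 /PWmx mulmxA QGmx. Qed.

(** P_W is the Q-orthogonal projector onto the span of Q^-1 W, and Q_W is the
loss along the complementary directions. *)
Lemma PQPmx : (1%:M - PWmx Q W)^T *m Q *m (1%:M - PWmx Q W) = QWmx Q W.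
Proof.
rewrite -mulmxA QPmx -[in LHS]tr_QWmx -trmx_mul mulmxBr mulmx1 QWPmx subr0.
exact: tr_QWmx.
Qed.

Lemma psd_QWmx : psd (QWmx Q W).
Proof.
split=> [|x]; first exact: tr_QWmx.
rewrite -PQPmx -!mulmxA dot_mxr trmxK.
by have [_] := posdef_psd; exact.
Qed.

Lemma QWmx_le x : dot x (QWmx Q W *m x) <= dot x (Q *m x).
Proof.
have [sQ _] := pQ; rewrite -subr_ge0 -dotBr -mulmxBl.
have -> : Q - QWmx Q W = (PWmx Q W)^T *m Q *m PWmx Q W.
  have PtQ : (PWmx Q W)^T *m Q = W *m invmx K *m W^T.
    rewrite -{2}sQ -trmx_mul /PWmx mulmxA QGmx trmx_mul trmxK.
    by rewrite trmx_mul trmx_inv trK mulmxA.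
  rewrite PtQ /PWmx mulmxA -(mulmxA _ W^T) WtGmx mulmx1 /QWmx.
  by rewrite opprB addrC subrK.
rewrite -(mulmxA _ _ x) -(mulmxA _ Q) dot_mxr trmxK.
by have [_] := posdef_psd; exact.
Qed.

Lemma quad_sub (B : 'M[R]_k) (a b : 'cV[R]_k) : dot (a - b) (B *m (a - b)) =
  dot a (B *m a) - dot b (B *m a) - dot a (B *m b) + dot b (B *m b).
Proof. by rewrite mulmxBr !(dotBl, dotBr); ring. Qed.

(** Moving the unconstrained estimator along Q-orthogonal directions to the
constraint space: the target t disappears because Q_W annihilates the correction
that enforces the constraint. *)
Lemma loss_difference (D : 'M[R]_k) (t : 'cV[R]_m) (y mu g : 'cV[R]_k) :
  D^T = D ->
  qform Q ((1%:M - PWmx Q W) *m (y - D *m g) + Gmx Q W *m t - mu)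
  - qform Q (y + Gmx Q W *m (t - W^T *m y) - mu)
  = dot g (D *m QWmx Q W *m D *m g) - 2 * dot (y - mu) (QWmx Q W *m D *m g).
Proof.
move=> sD; have [sQ _] := pQ.
set P := 1%:M - _; set a := y + _ - mu.
have -> : P *m (y - D *m g) + Gmx Q W *m t - mu = a - P *m (D *m g).
  rewrite /a !mulmxBr (mulmxA (Gmx Q W)) -/(PWmx Q W).
  have -> : P *m y = y - PWmx Q W *m y by rewrite mulmxBl mul1mx.
  move: (PWmx Q W *m y) (P *m (D *m g)) (Gmx Q W *m t) => u1 u2 u3.
  by apply/matrixP => i j; rewrite !mxE; ring.
have PQa : P^T *m Q *m a = QWmx Q W *m (y - mu).
  have -> : P^T *m Q = QWmx Q W by rewrite -[Q in LHS]sQ -trmx_mul QPmx tr_QWmx.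
  rewrite /a mulmxBr mulmxDr mulmxA QWGmx mul0mx addr0 -mulmxBr.
  by [].
set h := D *m g; rewrite !qformE quad_sub.
have h1 : dot (P *m h) (Q *m a) = dot (y - mu) (QWmx Q W *m h).
  by rewrite dot_mxl mulmxA PQa -(sym_dot _ _ tr_QWmx) dotC.
have h2 : dot a (Q *m (P *m h)) = dot (y - mu) (QWmx Q W *m h).
  by rewrite -(sym_dot _ _ sQ) dotC h1.
have h3 : dot (P *m h) (Q *m (P *m h)) = dot g (D *m QWmx Q W *m D *m g).
  have e : P^T *m (Q *m (P *m h)) = QWmx Q W *m h.
    by rewrite -PQPmx -/P -(mulmxA _ P) -(mulmxA _ Q).
  by rewrite dot_mxl e -(mulmxA _ D g) -(mulmxA D) [RHS]dot_mxr sD.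
rewrite h1 h2 h3 -(mulmxA (QWmx Q W) D g) -/h; ring.
Qed.

End constraint.

(** * Sign conditions on the approximate risk difference *)

Section traces.
Context {R : realType}.

Lemma tr_mul_diag n (M : 'M[R]_n) e : \tr (M *m diag_mx e) = \sum_i M i i * e 0 i.
Proof. by apply: eq_bigr => i _; rewrite mul_mx_diag mxE. Qed.

Lemma dot_delta n (B : 'M[R]_n) i :
  dot (delta_mx i 0) (B *m (delta_mx i 0 : 'cV[R]_n)) = B i i.
Proof.
rewrite dotE (bigD1 i)//= big1 ?addr0 => [|j ji].
  rewrite !mxE !eqxx mul1r (bigD1 i)//= big1 ?addr0 => [|j ji].
    by rewrite mxE !eqxx mulr1.
  by rewrite mxE (negPf ji) mulr0.
by rewrite !mxE (negPf ji) mul0r.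
Qed.

Lemma psd_diag n (B : 'M[R]_n) i : psd B -> 0 <= B i i.
Proof. by move=> [_ h]; rewrite -dot_delta. Qed.

Lemma vn_delta n (i : 'I_n) : vn (delta_mx i 0 : 'cV[R]_n) = 1.
Proof.
by rewrite /vn -[X in dot _ X]mul1mx dot_delta mxE eqxx sqrtr1.
Qed.

Lemma sum2_ge0 n (a : 'I_n -> 'I_n -> R) : (forall i j, 0 <= a i j + a j i) ->
  0 <= \sum_i \sum_j a i j.
Proof.
move=> h; rewrite -(@pmulr_rge0 _ 2)// mulr_natl mulr2n.
rewrite [X in _ + X]exchange_big -big_split sumr_ge0//= => i _.
by rewrite -big_split sumr_ge0//= => j _; exact: h.
Qed.

Lemma sum_mul_sum n (a b : 'I_n -> R) :
  (\sum_i a i) * (\sum_j b j) = \sum_i \sum_j a i * b j.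
Proof. by rewrite mulr_suml; apply: eq_bigr => i _; rewrite mulr_sumr. Qed.

(** Two applications of Chebyshev's sum inequality: as a function of 1/d_i, the
weight 1/(d_i+s) increases and its ratio to 1/d_i decreases. *)
Lemma dispersion_le n (d : 'I_n -> R) (s : R) : (forall i, 0 < d i) -> 0 <= s ->
  (\sum_i (d i + s)^-1 ^+ 2) * (\sum_i (d i)^-1) ^+ 2 <=
  (\sum_i (d i)^-1 ^+ 2) * (\sum_i (d i + s)^-1) ^+ 2.
Proof.
move=> d0 s0; pose f i := (d i + s)^-1; pose x i := (d i)^-1.
suff : (\sum_i f i ^+ 2) * (\sum_i x i) ^+ 2 <= (\sum_i x i ^+ 2) * (\sum_i f i) ^+ 2 by [].
have x0 i : 0 < x i by rewrite invr_gt0.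
have ds0 i : 0 < d i + s by rewrite ltr_wpDr.
have f0 i : 0 < f i by rewrite invr_gt0.
have key1 i j : 0 <= (f j - f i) * (x j * f i - x i * f j).
  have -> : f j - f i = (d i - d j) * (f i * f j).
    by rewrite /f; field; rewrite !gt_eqF.
  have -> : x j * f i - x i * f j = s * (d i - d j) * (f i * f j * x i * x j).
    by rewrite /f /x; field; rewrite !gt_eqF.
  rewrite mulrACA; apply: mulr_ge0.
    by rewrite mulrCA -expr2 mulr_ge0// sqr_ge0.
  by rewrite !mulr_ge0// ltW.
have key2 i j : 0 <= (x j - x i) * (x j * f i - x i * f j).
  have -> : x j - x i = (d i - d j) * (x i * x j).
    by rewrite /x; field; rewrite !gt_eqF.
  have -> : x j * f i - x i * f j = s * (d i - d j) * (f i * f j * x i * x j).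
    by rewrite /f /x; field; rewrite !gt_eqF.
  rewrite mulrACA; apply: mulr_ge0.
    by rewrite mulrCA -expr2 mulr_ge0// sqr_ge0.
  by rewrite !mulr_ge0// ltW.
have step1 : (\sum_i f i ^+ 2) * (\sum_i x i) <= (\sum_i f i) * (\sum_i f i * x i).
  rewrite -subr_ge0 !sum_mul_sum -sumrB; under eq_bigr do rewrite -sumrB.
  apply: sum2_ge0 => i j; apply: le_trans (key1 i j) _.
  by rewrite le_eqVlt; apply/orP; left; apply/eqP; ring.
have step2 : (\sum_i f i * x i) * (\sum_i x i) <= (\sum_i f i) * (\sum_i x i ^+ 2).
  rewrite -subr_ge0 !sum_mul_sum -sumrB; under eq_bigr do rewrite -sumrB.
  apply: sum2_ge0 => i j; apply: le_trans (key2 i j) _.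
  by rewrite le_eqVlt; apply/orP; left; apply/eqP; ring.
have X0 : 0 <= \sum_i x i by rewrite sumr_ge0// => i _; rewrite ltW.
have F0 : 0 <= \sum_i f i by rewrite sumr_ge0// => i _; rewrite ltW.
rewrite expr2 mulrA (le_trans (ler_wpM2r X0 step1))//.
by rewrite -mulrA (le_trans (ler_wpM2l F0 step2))// mulrA -expr2 mulrC.
Qed.

End traces.

Section APR.
Context {R : realType} {k p m : nat}.
Variables (d : 'rV[R]_k) (X : 'M[R]_(k, p)) (Q : 'M[R]_k) (W : 'M[R]_(k, m)).
Hypothesis d0 : forall i, 0 < d 0 i.
Hypothesis rX : \rank X = p.
Hypothesis pQ : posdef Q.
Hypothesis rW : \rank W = m.

(** Moving the estimator by - D g changes the loss by a quadratic form in g with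
this matrix. *)
Definition Mmx : 'M[R]_k := Dmx d *m QWmx Q W *m Dmx d.

Lemma tr_Dmx : (Dmx d)^T = Dmx d.
Proof. exact: tr_diag_mx. Qed.

Lemma psd_Mmx : psd Mmx.
Proof.
split; first by rewrite /Mmx !trmx_mul tr_Dmx (tr_QWmx W pQ) mulmxA.
move=> x; rewrite /Mmx -(mulmxA _ _ x) -(mulmxA (Dmx d)) dot_mxr tr_Dmx.
by have [_] := psd_QWmx pQ rW; exact.
Qed.

Local Notation H := (Hmx d X).

Lemma tr_HmxE s (S : 'M[R]_k) : 0 <= s -> \tr (H s *m S) =
  \sum_i (d 0 i + s) * dot (H s *m delta_mx i 0) (S *m (H s *m delta_mx i 0)).
Proof.
move=> s0; rewrite -{1}(HVH d0 rX s0) -(mulmxA _ (H s) S) mxtrace_mulC mulmxA.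
rewrite VmxE tr_mul_diag.
apply: eq_bigr => i _; rewrite mulrC; congr (_ * _); first by rewrite !mxE.
by rewrite dot_mxl tr_Hmx (mulmxA S) (mulmxA (H s)) dot_delta mulmxA.
Qed.

Lemma tr_Hmx_ge0 s (S : 'M[R]_k) : 0 <= s -> (forall x, 0 <= dot x (S *m x)) ->
  0 <= \tr (H s *m S).
Proof.
move=> s0 S0; rewrite tr_HmxE// sumr_ge0// => i _.
by rewrite mulr_ge0// ltW// v_gt0.
Qed.

Lemma Delta_APRE s : 0 <= s -> Delta_APR d X Q W s =
  - \tr (Mmx *m Amx d X s)
  + (\sum_i Mmx i i * (d 0 i + s)^-1 ^+ 3)
    * ((2 * k%:R) / (\sum_i (d 0 i + s)^-1) ^+ 2).
Proof.
move=> s0; rewrite /Delta_APR -/Mmx invVmx// AmxE// (mulmxBr Mmx).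
rewrite [\tr (Mmx *m _ - _)]raddfB [- (_ - \tr (Mmx *m H s))]opprB.
rewrite addrC [in RHS]addrC; congr (_ * (_ / _ ^+ 2) + _).
- rewrite !mulmx_diag tr_mul_diag; apply: eq_bigr => i _.
  by rewrite !mxE !exprS expr0 mulr1 mulrA.
- by rewrite mxtrace_diag; apply: eq_bigr => i _; rewrite mxE.
- rewrite addrC; congr (_ - _); rewrite HmxE /hat /Mmx.
  generalize (diag_mx (precision d s)) => E; generalize (invmx (X^T *m E *m X)) => N.
  generalize (QWmx Q W) => U; generalize (Dmx d) => D.
  transitivity (\tr ((N *m X^T *m E) *m (D *m U *m D *m E *m X))).
    by rewrite !mulmxA.
  by rewrite mxtrace_mulC !mulmxA.
Qed.

(** ** Sufficiency *)

Lemma tr_invVmx2 s : 0 <= s ->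
  \tr (invmx (Vmx d s) *m invmx (Vmx d s)) = \sum_i (d 0 i + s)^-1 ^+ 2.
Proof.
move=> s0; rewrite invVmx// tr_mul_diag; apply: eq_bigr => i _.
by rewrite !mxE eqxx mulr1n expr2.
Qed.

Lemma tr_invVmx s : 0 <= s -> \tr (invmx (Vmx d s)) = \sum_i (d 0 i + s)^-1.
Proof.
by move=> s0; rewrite invVmx// mxtrace_diag; apply: eq_bigr => i _; rewrite mxE.
Qed.

Lemma sum_inv_gt0 s : (0 < k)%N -> 0 <= s -> 0 < \sum_i (d 0 i + s)^-1.
Proof.
move=> k0 s0; rewrite (bigD1 (Ordinal k0))//= ltr_pwDl ?invr_gt0 ?v_gt0//.
by rewrite sumr_ge0// => i _; rewrite invr_ge0 ltW// v_gt0.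
Qed.

(** The eigenvalue rho dominates all traces against M: the trace with the hat
matrix is at most rho p, since tr(HV) = p, and the trace with V^-3 is at most
rho tr(V^-2). *)
Lemma Delta_APR_le s rho : 0 <= s ->
  (forall x, dot x (Mmx *m x) <= rho * dot x (Vmx d s *m x)) ->
  Delta_APR d X Q W s <= - \tr (Mmx *m invmx (Vmx d s)) + rho * p%:R
   + rho * (\sum_i (d 0 i + s)^-1 ^+ 2)
     * ((2 * k%:R) / (\sum_i (d 0 i + s)^-1) ^+ 2).
Proof.
move=> s0 hrho; rewrite Delta_APRE// AmxE// invVmx// (mulmxBr Mmx).
rewrite [\tr (Mmx *m _ - _)]raddfB [- (_ - \tr (Mmx *m H s))]opprB.
rewrite [\tr (Mmx *m H s) - _]addrC; apply: lerD; first rewrite lerD2l.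
  rewrite -(tr_HV d0 rX s0) -subr_ge0 -mxtraceZ [\tr (Mmx *m _)]mxtrace_mulC.
  rewrite -linearB /= scalemxAr -mulmxBr; apply: tr_Hmx_ge0 => // x.
  by rewrite mulmxBl -scalemxAl dotBr dotZr subr_ge0.
apply: ler_wpM2r.
  by rewrite mulr_ge0 ?mulr_ge0// invr_ge0 sqr_ge0.
rewrite mulr_sumr ler_sum// => i _.
have v0 := v_gt0 d0 i s0.
have := hrho (delta_mx i 0); rewrite !dot_delta VmxE !mxE eqxx mulr1n => h.
rewrite [X in _ <= rho * X](_ : _ = (d 0 i + s) * (d 0 i + s)^-1 ^+ 3).
  by rewrite mulrA ler_wpM2r// exprn_ge0// invr_ge0 ltW.
by field; rewrite gt_eqF.
Qed.

(** Relative to rho = Ch_max(M V^-1), the two positive terms are at most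
p + 2 k tr(V^-2) / tr(V^-1)^2, which is largest at lam = 0 by dispersion_le. *)
Lemma sufficient_condition : (0 < k)%N ->
  inf [set \tr (Dmx d *m QWmx Q W *m Dmx d *m invmx (Vmx d lam))
           / Ch_max (Dmx d *m QWmx Q W *m Dmx d *m invmx (Vmx d lam))
      | lam in [set l : R | 0 < l]]
    >= p%:R + 2 * (k%:R * \tr (invmx (Dmx d) *m invmx (Dmx d))
                    / \tr (invmx (Dmx d)) ^+ 2) ->
  forall lam : R, 0 < lam -> Delta_APR d X Q W lam <= 0.
Proof.
move=> k0; rewrite -/Mmx -Vmx0 tr_invVmx2// tr_invVmx//.
set c0 := (X in X <= inf _); set S := (X in inf X) => hc lam lam0.
have [sM M0] := psd_Mmx.
have hrho l : 0 <= l -> forall x, dot x (Mmx *m x) <=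
    Ch_max (Mmx *m invmx (Vmx d l)) * dot x (Vmx d l *m x).
  move=> l0; apply: rayleigh_le_Ch_max => //; first exact: psd_Vmx.
  exact: Vmx_unit.
have rho_ge0 l : 0 <= l -> 0 <= Ch_max (Mmx *m invmx (Vmx d l)).
  move=> l0; have := le_trans (M0 _) (hrho _ l0 (delta_mx (Ordinal k0) 0)).
  rewrite dot_delta VmxE !mxE eqxx mulr1n pmulr_lge0//.
  by rewrite v_gt0.
have T0 l : 0 <= l -> 0 <= \tr (Mmx *m invmx (Vmx d l)).
  move=> l0; rewrite invVmx// tr_mul_diag sumr_ge0// => i _.
  by rewrite mulr_ge0 ?psd_diag// mxE invr_ge0 ltW// v_gt0.
have lbS : has_lbound S.
  by exists 0 => _ [l /= l0 <-]; rewrite divr_ge0 ?T0 ?rho_ge0// ltW.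
have c0gt0 : 0 < c0.
  rewrite ltr_wpDl// !mulr_gt0 ?ltr0n// ?invr_gt0 ?exprn_gt0 ?sum_inv_gt0//.
  rewrite (bigD1 (Ordinal k0))//= ltr_pwDl ?exprn_gt0 ?invr_gt0 ?v_gt0//.
  by rewrite sumr_ge0// => i _; rewrite sqr_ge0.
set rho := Ch_max (Mmx *m invmx (Vmx d lam)).
set T := \tr (Mmx *m invmx (Vmx d lam)).
have ratio : c0 <= T / rho.
  by apply: le_trans hc _; apply: ge_inf => //; exists lam.
have rho0 : 0 < rho.
  rewrite lt0r rho_ge0 ?(ltW lam0)// andbT; apply: contraTneq ratio => ->.
  by rewrite invr0 mulr0 -ltNge.
move: ratio; rewrite ler_pdivlMr// => ratio.
apply: le_trans (Delta_APR_le (ltW lam0) (hrho _ (ltW lam0))) _.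
rewrite -/rho -/T -addrA addrC subr_le0; apply: le_trans ratio.
set S2 := \sum_i (d 0 i + lam)^-1 ^+ 2; set F := \sum_i (d 0 i + lam)^-1.
have F0 : 0 < F by exact/sum_inv_gt0/ltW.
have D0 : 0 < \sum_i (d 0 i + 0)^-1 by exact: sum_inv_gt0.
have disp : S2 / F ^+ 2 <=
    (\sum_i (d 0 i + 0)^-1 ^+ 2) / (\sum_i (d 0 i + 0)^-1) ^+ 2.
  rewrite ler_pdivrMr ?exprn_gt0// mulrAC ler_pdivlMr ?exprn_gt0//.
  have -> : \sum_i (d 0 i + 0)^-1 ^+ 2 = \sum_i (d 0 i)^-1 ^+ 2.
    by apply: eq_bigr => i _; rewrite addr0.
  have -> : \sum_i (d 0 i + 0)^-1 = \sum_i (d 0 i)^-1.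
    by apply: eq_bigr => i _; rewrite addr0.
  by apply: dispersion_le => //; exact: ltW.
rewrite (_ : _ + _ = rho * (p%:R + 2 * (k%:R * (S2 / F ^+ 2)))); last by ring.
by rewrite [leRHS]mulrC ler_pM2l// lerD2l ler_pM2l// -[leRHS]mulrA ler_wpM2l.
Qed.

(** ** Necessity *)

Lemma cvg_finsum (I : finType) (u : I -> nat -> R) (l : I -> R) :
  (forall i, u i n @[n --> \oo] --> l i) ->
  \sum_i u i n @[n --> \oo] --> \sum_i l i.
Proof. by move=> h; apply: cvg_big => // ; exact: add_continuous. Qed.

(** The only matrix to vary is A, which is Lipschitz in lam by the resolvent
identity. *)
Lemma Delta_APR_cvg : (0 < k)%N ->
  Delta_APR d X Q W (harmonic n) @[n --> \oo] --> Delta_APR d X Q W 0.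
Proof.
move=> k0.
have h0 n : 0 <= @harmonic R n by exact: ltW (harmonic_gt0 _).
have hcv : @harmonic R n @[n --> \oo] --> (0 : R) by exact: cvg_harmonic.
have dcv i : (d 0 i + harmonic n)^-1 @[n --> \oo] --> (d 0 i + 0)^-1.
  apply: cvgV; first by rewrite gt_eqF// v_gt0.
  by apply: cvgD => //; exact: cvg_cst.
rewrite Delta_APRE//.
under eq_cvg do rewrite Delta_APRE//.
apply: cvgD; last first.
  apply: cvgM.
    apply: cvg_finsum => i; apply: cvgM; first exact: cvg_cst.
    by rewrite !exprS expr0 mulr1; under eq_cvg do rewrite !exprS expr0 mulr1;
      apply: cvgM => //; exact: cvgM.
  apply: cvgM; first exact: cvg_cst.
  apply: cvgV; first by rewrite expf_neq0// gt_eqF// sum_inv_gt0.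
  by rewrite expr2; under eq_cvg do rewrite expr2;
    apply: cvgM => //; exact: cvg_finsum.
apply: cvgN.
have AE n : Amx d X (harmonic n) =
    Amx d X 0 - harmonic n *: (Amx d X 0 *m Amx d X (harmonic n)).
  have := Amx_resolvent d0 rX (lexx 0) (h0 n); rewrite subr0 => <-.
  by rewrite opprD opprK addrA subrr add0r.
pose c := (\sum_i (d 0 i)^-1)^-1.
have s0 : 0 < \sum_i (d 0 i)^-1.
  by under eq_bigr do rewrite -[d 0 _]addr0; exact: sum_inv_gt0.
have c0 : 0 < c by rewrite invr_gt0.
have hc i : c <= d 0 i.
  rewrite -[leRHS]invrK lef_pV2 ?posrE ?invr_gt0// (bigD1 i)//= lerDl.
  by rewrite sumr_ge0// => j _; rewrite invr_ge0 ltW.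
pose B := \sum_(i < k) mxbound (Mmx *m Amx d X 0) * c^-1.
have bB n : `|\tr (Mmx *m Amx d X 0 *m Amx d X (harmonic n))| <= B.
  rewrite /mxtrace (le_trans (ler_norm_sum _ _ _))// ler_sum// => i _.
  rewrite -dot_delta -mulmxA (le_trans (dot_mxbound _ _ _))//.
  rewrite ler_wpM2l ?mxbound_ge0// vn_delta mul1r.
  by rewrite (le_trans (vn_Amx_le d0 rX c0 hc _ (h0 n)))// vn_delta mul1r.
have hB : @harmonic R n * B @[n --> \oo] --> (0 * B : R).
  by apply: cvgM => //; exact: cvg_cst.
rewrite mul0r in hB.
apply/cvgrPdist_le => e e0; move/cvgr0Pnorm_le: hB => /(_ e e0); apply: filterS.
move=> n; apply: le_trans.
have -> : \tr (Mmx *m Amx d X (harmonic n)) = \tr (Mmx *m Amx d X 0)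
    - harmonic n * \tr (Mmx *m Amx d X 0 *m Amx d X (harmonic n)).
  rewrite {1}AE (mulmxBr Mmx) [\tr (Mmx *m _ - _)]raddfB /=.
  by rewrite -scalemxAr mxtraceZ mulmxA.
rewrite [- (\tr _ - _)]opprB addrC subrK !normrM ler_wpM2l//.
by rewrite (le_trans (bB n))// ler_norm.
Qed.

(** The limit of the hypothesis as lam tends to 0, where V becomes D. *)
Lemma necessary_condition : (0 < k)%N ->
  (forall lam : R, 0 < lam -> Delta_APR d X Q W lam <= 0) ->
  \tr (Dmx d *m QWmx Q W) >=
    \tr (invmx (X^T *m invmx (Dmx d) *m X) *m X^T *m QWmx Q W *m X)
    + \tr (QWmx Q W *m invmx (Dmx d)) * ((2 * k%:R) / \tr (invmx (Dmx d)) ^+ 2).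
Proof.
move=> k0 hD.
have : Delta_APR d X Q W 0 <= 0.
  apply: (cvgr_to_le (Delta_APR_cvg k0)); apply: nearW => n.
  by apply: hD; exact: harmonic_gt0.
have uD : Dmx d \in unitmx by rewrite -Vmx0 Vmx_unit.
rewrite /Delta_APR Vmx0.
set T1 := \tr (_ *m _ *m _ *m _); set T2 := \tr (_ *m X).
set T3 := \tr (_ *m (_ *m _)).
have -> : T1 = \tr (Dmx d *m QWmx Q W) by rewrite /T1 mulmxK.
have -> : T2 = \tr (invmx (X^T *m invmx (Dmx d) *m X) *m X^T *m QWmx Q W *m X).
  by rewrite /T2 mulmxKV// mulmxK.
have -> : T3 = \tr (QWmx Q W *m invmx (Dmx d)).
  by rewrite /T3 !mulmxA mulmxK// -!mulmxA mxtrace_mulC -!mulmxA mulVmx// mulmx1.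
by rewrite -addrA addrC subr_le0.
Qed.

End APR.

(** * Transfer of integrals *)

Section transfer.
Context {R : realType}.
Local Open Scope ereal_scope.
Import HBNNSimple.

Lemma integral_mul_nnsfun d d' (T : measurableType d) (T' : measurableType d')
    (m : {measure set T -> \bar R}) (w : T -> R) (X : T -> T')
    (h : {nnsfun T' >-> R}) :
  measurable_fun setT w -> (forall x, 0 <= w x)%R -> measurable_fun setT X ->
  \int[m]_x (w x * h (X x))%:E =
  \sum_(r \in range h) r%:E *
    \int[m]_x (w x * \1_(h @^-1` [set r]) (X x))%:E.
Proof.
move=> mw w0 mX.
have mi r : measurable_fun setT (fun x => (w x * \1_(h @^-1` [set r]) (X x))%R).
  by apply: measurable_funM => //; apply: measurableT_comp.
transitivity (\int[m]_x \sum_(r \in range h)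
    (r%:E * (w x * \1_(h @^-1` [set r]) (X x))%:E)).
  apply: eq_integral => x _; rewrite [h (X x)]fimfunE.
  rewrite !fsbig_finite//= mulr_sumr -sumEFin.
  by apply: eq_bigr => r _; rewrite mulrCA EFinM.
rewrite ge0_integral_fsum//; last 2 first.
- by move=> r; apply: measurable_funeM; exact/measurable_EFinP.
- move=> r x _; rewrite -EFinM lee_fin indicE.
  have [|_] := boolP (X x \in _); last by rewrite !mulr0.
  by rewrite inE => /= <-; rewrite mulr1 mulr_ge0.
apply: eq_fsbigr => r; rewrite inE => -[t _ <-].
rewrite ge0_integralZl_EFin//.
  by move=> x _; rewrite lee_fin mulr_ge0.
exact/measurable_EFinP.
Qed.

(** By monotone convergence from simple functions. With weights on both sides the
lemma covers densities, the other factors of a product and conditional laws. *)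
Lemma ge0_integral_transfer d1 d2 d' (T1 : measurableType d1)
    (T2 : measurableType d2) (T' : measurableType d')
    (m1 : {measure set T1 -> \bar R}) (m2 : {measure set T2 -> \bar R})
    (w1 : T1 -> R) (w2 : T2 -> R) (X1 : T1 -> T') (X2 : T2 -> T') (g : T' -> R) :
  measurable_fun setT w1 -> (forall x, 0 <= w1 x)%R -> measurable_fun setT X1 ->
  measurable_fun setT w2 -> (forall x, 0 <= w2 x)%R -> measurable_fun setT X2 ->
  (forall B, measurable B ->
    \int[m1]_x (w1 x * \1_B (X1 x))%:E = \int[m2]_x (w2 x * \1_B (X2 x))%:E) ->
  measurable_fun setT g -> (forall x, 0 <= g x)%R ->
  \int[m1]_x (w1 x * g (X1 x))%:E = \int[m2]_x (w2 x * g (X2 x))%:E.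
Proof.
move=> mw1 w10 mX1 mw2 w20 mX2 h mg g0.
have mEg : measurable_fun setT (EFin \o g) by exact/measurable_EFinP.
pose g_ := nnsfun_approx measurableT mEg.
have lim_ d (T : measurableType d) (m : {measure set T -> \bar R}) (w : T -> R)
    (X : T -> T') : measurable_fun setT w -> (forall x, 0 <= w x)%R ->
    measurable_fun setT X ->
    \int[m]_x (w x * g (X x))%:E = limn (fun n => \int[m]_x (w x * g_ n (X x))%:E).
  move=> mw w0 mX; rewrite -monotone_convergence//; last 3 first.
    move=> n; apply/measurable_EFinP; apply: measurable_funM => //.
    exact: measurableT_comp.
    by move=> n x _; rewrite lee_fin mulr_ge0.
    move=> x _ a b ab; rewrite lee_fin ler_wpM2l//.
    exact/lefP/nd_nnsfun_approx.
  apply: eq_integral => x _; apply/esym/cvg_lim => //.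
  suff : (fun n => (w x)%:E * (g_ n (X x))%:E) @ \oo --> (w x)%:E * (g (X x))%:E.
    by [].
  apply: cvgeZl => //.
  by apply: (cvg_nnsfun_approx measurableT mEg) => // y _; rewrite lee_fin.
rewrite !lim_//; congr (limn _); apply/funext => n.
by rewrite !integral_mul_nnsfun//; apply: eq_fsbigr => r _; rewrite h.
Qed.

End transfer.

(** * Moments of the normal law *)

Section normal_moments.
Context {R : realType}.
Local Notation leb := (@lebesgue_measure R).
Implicit Types (m s x : R).

Lemma integral_normal_prob m s (g : R -> R) : measurable_fun setT g ->
  (forall x, 0 <= g x) ->
  (\int[normal_prob m s]_x (g x)%:E = \int[leb]_x (normal_pdf m s x * g x)%:E)%E.
Proof.
move=> mg g0.
have := @ge0_integral_transfer R _ _ _ _ _ _ (normal_prob m s) leb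
  (cst 1) (normal_pdf m s) id id g.
rewrite /=; under eq_integral do rewrite mul1r.
apply => //.
- exact: measurable_normal_pdf.
- by move=> x; exact: normal_pdf_ge0.
move=> B mB; under eq_integral do rewrite mul1r.
rewrite integral_indic// setIT /normal_prob [LHS]integral_mkcond.
by apply: eq_integral => x _; rewrite patchE indicE; case: ifP => _;
  rewrite ?mulr1 ?mulr0.
Qed.

Lemma normal_pdf_tilt m s x : s != 0 ->
  normal_pdf m s x * expR ((x - m) ^+ 2 / (4 * s ^+ 2)) =
  Num.sqrt 2 * normal_pdf m (Num.sqrt 2 * s) x.
Proof.
move=> s0; have s20 : Num.sqrt 2 * s != 0.
  by rewrite mulf_neq0// gt_eqF// sqrtr_gt0.
have peakE : normal_peak s = Num.sqrt 2 * normal_peak (Num.sqrt 2 * s).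
  rewrite /normal_peak exprMn sqr_sqrtr//.
  rewrite (_ : 2 * _ * pi *+ 2 = 2 * (s ^+ 2 * pi *+ 2)); last by ring.
  by rewrite [in RHS]sqrtrM// invfM mulrA divff ?mul1r//.
rewrite !normal_pdfE// peakE /normal_fun exprMn sqr_sqrtr// -!mulrA -expRD.
by congr (_ * (_ * expR _)); field.
Qed.

(** The weight exp ((x - m)^2 / (4 s^2)), which dominates all polynomials, merely
doubles the variance. *)
Lemma normal_prob_tilt m s (g : R -> R) : s != 0 -> measurable_fun setT g ->
  (forall x, 0 <= g x) ->
  (\int[normal_prob m s]_x (g x * expR ((x - m) ^+ 2 / (4 * s ^+ 2)))%:E =
   (Num.sqrt 2)%:E * \int[normal_prob m (Num.sqrt 2 * s)]_x (g x)%:E)%E.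
Proof.
move=> s0 mg g0.
have mt : measurable_fun setT (fun x => expR ((x - m) ^+ 2 / (4 * s ^+ 2))).
  apply: measurableT_comp => //; apply: measurable_funM => //.
  by apply: measurable_funX => //; exact: measurable_funB.
rewrite !integral_normal_prob//; last 2 first.
- exact: measurable_funM.
- by move=> x; rewrite mulr_ge0// expR_ge0.
rewrite -ge0_integralZl_EFin//; last 2 first.
- by move=> x _; rewrite lee_fin mulr_ge0// normal_pdf_ge0.
- apply/measurable_EFinP; apply: measurable_funM => //.
  exact: measurable_normal_pdf.
apply: eq_integral => x _; rewrite -EFinM; congr EFin.
by rewrite [in LHS]mulrCA normal_pdf_tilt// mulrCA [g x * _]mulrC.
Qed.

Lemma expr_le_expR (n : nat) (a z : R) : 0 < a ->
  `|z| ^+ n <= (1 + a ^+ n.+1 * n.+1`!%:R) * expR (z ^+ 2 / a).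
Proof.
move=> a0; set y := z ^+ 2 / a.
have y0 : 0 <= y by rewrite divr_ge0 ?sqr_ge0// ltW.
have e1 : 1 <= expR y by rewrite -expR0 ler_expR.
have c0 : 0 <= a ^+ n.+1 * n.+1`!%:R :> R by rewrite mulr_ge0// exprn_ge0// ltW.
have [z1|z1] := leP `|z| 1.
  rewrite (@le_trans _ _ 1) ?exprn_ile1//.
  by rewrite (le_trans e1)// ler_peMl ?expR_ge0// lerDl.
have := expR_ge1Dxn n y0; set w := _ / _ => h.
apply: (@le_trans _ _ (a ^+ n.+1 * n.+1`!%:R * expR y)); last first.
  by rewrite ler_wpM2r ?expR_ge0// lerDr.
apply: (@le_trans _ _ (a ^+ n.+1 * n.+1`!%:R * w)); last first.
  by rewrite ler_wpM2l// (le_trans _ h)// lerDr.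
rewrite /w -mulrA [_%:R * _]mulrC divfK ?pnatr_eq0 -?lt0n ?fact_gt0//.
rewrite -exprMn /y mulrCA divff ?gt_eqF// mulr1 -normrX -real_normK ?num_real//.
rewrite -exprM normrX ler_weXn2l//; last first.
  by rewrite mul2n -addnn (leq_trans (leqnSn n))// leq_addr.
exact: ltW.
Qed.

Lemma measurable_centered_pow m n :
  measurable_fun setT (fun x : R => (x - m) ^+ n).
Proof. by apply: measurable_funX => //; exact: measurable_funB. Qed.

Lemma integrable_normal_pow m s n : s != 0 ->
  (normal_prob m s).-integrable setT (fun x => ((x - m) ^+ n)%:E).
Proof.
move=> s0; apply/integrableP; split.
  by apply/measurable_EFinP; exact: measurable_centered_pow.
have a0 : 0 < 4 * s ^+ 2 by rewrite mulr_gt0// exprn_even_gt0.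
pose C := 1 + (4 * s ^+ 2) ^+ n.+1 * n.+1`!%:R.
have C0 : 0 <= C by rewrite addr_ge0// mulr_ge0// exprn_ge0// ltW.
apply: (@le_lt_trans _ _ (\int[normal_prob m s]_x
    (C * expR ((x - m) ^+ 2 / (4 * s ^+ 2)))%:E)%E).
  apply: ge0_le_integral => //.
  - by apply: measurableT_comp => //; apply/measurable_EFinP; exact: measurable_centered_pow.
  - apply/measurable_EFinP; apply: measurable_funM => //.
    apply: measurableT_comp => //; apply: measurable_funM => //.
    exact: measurable_centered_pow.
  - by move=> x _; rewrite /= lee_fin normrX expr_le_expR.
rewrite normal_prob_tilt// integral_cst// [X in (_ * (_ * X))%E](_ : _ = 1%E) ?mule1 -?EFinM ?ltry//.
exact: (@probability_setT _ _ _ (normal_prob m (Num.sqrt 2 * s))).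
Qed.

End normal_moments.

Section stein.
Context {R : realType}.
Local Notation leb := (@lebesgue_measure R).
Implicit Types (m s x : R).

Lemma is_derive_normal_pdf m s x : s != 0 ->
  is_derive x 1 (normal_pdf m s) (- (x - m) / s ^+ 2 * normal_pdf m s x).
Proof.
move=> s0; pose q : {poly R} := - (s ^+ 2 *+ 2)^-1 *: ('X - m%:P) ^+ 2.
have qE y : q.[y] = - (y - m) ^+ 2 / (s ^+ 2 *+ 2).
  rewrite /q hornerZ horner_exp hornerXsubC; ring.
have -> : normal_pdf m s = (fun y => normal_peak s * expR q.[y]).
  by rewrite normal_pdfE//; apply/funext => y; rewrite /normal_fun qE.
have dq : is_derive x 1 (horner q) (- (x - m) / s ^+ 2).
  apply: is_derive_eq; rewrite /q derivZ deriv_exp derivXsubC mul1r hornerZ hornerMn.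
  rewrite horner_exp hornerXsubC /=.
  by field.
have de : is_derive x 1 (expR \o horner q) (expR q.[x] * (- (x - m) / s ^+ 2)).
  exact: is_derive1_comp.
have -> : (fun y => normal_peak s * expR q.[y]) = normal_peak s *: (expR \o horner q).
  by apply/funext => y.
apply: is_derive_eq; rewrite /= /GRing.scale /=; ring.
Qed.

Lemma is_derive_pow_pdf m s j x : s != 0 ->
  is_derive x 1 (fun y => (y - m) ^+ j * normal_pdf m s y)
    ((j%:R * (x - m) ^+ j.-1 - (x - m) ^+ j.+1 / s ^+ 2) * normal_pdf m s x).
Proof.
move=> s0; pose q : {poly R} := ('X - m%:P) ^+ j.
have -> : (fun y => (y - m) ^+ j * normal_pdf m s y) = horner q * normal_pdf m s.
  by apply/funext => y; rewrite /q /= fctE horner_exp hornerXsubC.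
have dp := is_derive_normal_pdf m x s0.
apply: is_derive_eq; rewrite /q deriv_exp derivXsubC mul1r hornerMn !horner_exp hornerXsubC.
by rewrite /GRing.scale /= [(x - m) ^+ j.+1]exprS -mulr_natl; ring.
Qed.

(** By the fundamental theorem of calculus on the intervals [m - n, m + n] and
dominated convergence. *)
Lemma integral_total_derivative (F f : R -> R) (m : R) :
  (forall x, is_derive x 1 F (f x)) -> continuous f ->
  leb.-integrable setT (EFin \o f) ->
  (F (m + n.+1%:R) - F (m - n.+1%:R)) @[n --> \oo] --> 0 ->
  (\int[leb]_x (f x)%:E = 0)%E.
Proof.
move=> dF cf intf F0.
have dFx x : derivable F x 1 by have := dF x => -[].
have cF : continuous F.
  by move=> x; apply: differentiable_continuous; apply/derivable1_diffP.
pose I n := `[m - n.+1%:R, m + n.+1%:R]%classic : set R.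
pose f_ n x := (f x * \1_(I n) x)%:E.
have mI n : measurable (I n) by exact: measurable_itv.
have If n : (\int[leb]_x f_ n x = (F (m + n.+1%:R) - F (m - n.+1%:R))%:E)%E.
  transitivity (\int[leb]_(x in I n) (f x)%:E)%E.
    rewrite [RHS]integral_mkcond; apply: eq_integral => x _.
    by rewrite /f_ patchE indicE; case: ifP => _; rewrite ?mulr1 ?mulr0.
  rewrite (@continuous_FTC2 R f F)//.
  - by rewrite ltrD2l gtrN.
  - exact: continuous_subspaceT.
  - split=> [x _| |]; first exact: dFx.
    + by apply: cvg_at_right_filter; exact: cF.
    + by apply: cvg_at_left_filter; exact: cF.
  - by move=> x _; rewrite derive1E; have := dF x => -[_].
have cv1 : (\int[leb]_x f_ n x)%E @[n --> \oo] --> (\int[leb]_x (f x)%:E)%E.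
  have mf : measurable_fun setT (EFin \o f).
    by case/integrableP: intf.
  have mf_ n : measurable_fun setT (f_ n).
    apply/measurable_EFinP; apply: measurable_funM; first exact/measurable_EFinP.
    exact: measurable_indic.
  apply: (@dominated_cvg _ _ _ leb setT measurableT f_ (EFin \o f)
           (fun x => `|(f x)%:E|%E)) => //.
  - move=> x _; apply: cvg_near_cst.
    have [N hN] : exists N, `|x - m| <= N%:R.
      by exists (Num.bound `|x - m|); rewrite ltW// archi_boundP.
    near=> n; rewrite /f_ indicE mem_set ?mulr1// /I /= in_itv /=.
    have : `|x - m| <= n.+1%:R.
      rewrite (le_trans hN)// ler_nat; apply: leqW; near: n.
      exact: nbhs_infty_ge.
    rewrite ler_norml => /andP[h1 h2].
    by apply/andP; split; lra.
  - exact: integrable_abse.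
  - move=> n x _; rewrite lee_fin normrM ler_piMr// indicE.
    by case: (_ \in _); rewrite ?normr1 ?normr0.
have cv2 : (\int[leb]_x f_ n x)%E @[n --> \oo] --> 0%E.
  by under eq_cvg do rewrite If; apply: cvg_EFin => //; exact: nearW.
exact: cvg_unique cv1 cv2.
Unshelve. all: by end_near. Qed.

Lemma measurable_pdfM m s (g : R -> R) : measurable_fun setT g ->
  measurable_fun setT (fun x => (normal_pdf m s x * g x)%:E).
Proof.
move=> mg; apply/measurable_EFinP; apply: measurable_funM => //.
exact: measurable_normal_pdf.
Qed.

Lemma integral_normal_prob_signed m s (g : R -> R) : measurable_fun setT g ->
  (\int[normal_prob m s]_x (g x)%:E = \int[leb]_x (normal_pdf m s x * g x)%:E)%E.
Proof.
move=> mg; rewrite integralE [RHS]integralE; congr (_ - _)%E.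
- rewrite (_ : (fun x => (g x)%:E)^\+%E = EFin \o g^\+).
    rewrite integral_normal_prob//; last exact: measurable_funrpos.
    apply: eq_integral => x _; rewrite funeposE /funrpos -EFin_max; congr EFin.
    by rewrite maxr_pMr ?normal_pdf_ge0// mulr0.
  by apply/funext => x; rewrite funeposE /funrpos /= EFin_max.
- rewrite (_ : (fun x => (g x)%:E)^\-%E = EFin \o g^\-).
    rewrite integral_normal_prob//; last exact: measurable_funrneg.
    apply: eq_integral => x _; rewrite funenegE /funrneg -EFinN -EFin_max; congr EFin.
    by rewrite maxr_pMr ?normal_pdf_ge0// mulr0 mulrN.
  by apply/funext => x; rewrite funenegE /funrneg /= EFin_max.
Qed.

Lemma integrable_normal_pdfM m s (g : R -> R) :
  (normal_prob m s).-integrable setT (EFin \o g) ->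
  leb.-integrable setT (fun x => (normal_pdf m s x * g x)%:E).
Proof.
case/integrableP => /measurable_EFinP mg; rewrite /= => h; apply/integrableP; split.
  exact: measurable_pdfM.
under eq_integral do rewrite /= normrM (ger0_norm (normal_pdf_ge0 _ _ _)).
rewrite -(@integral_normal_prob _ _ _ (fun x => `|g x|))//.
exact: measurableT_comp.
Qed.

Lemma pdf_tail m s j (z : R) : s != 0 -> z != 0 -> `|z ^+ j * normal_pdf m s (m + z)| <=
  (1 + (2 * s ^+ 2) ^+ j.+2 * j.+2`!%:R) * normal_peak s / `|z|.
Proof.
move=> s0 z0; rewrite ler_pdivlMr ?normr_gt0// -normrM mulrAC -exprSr normrM normrX.
rewrite (ger0_norm (normal_pdf_ge0 _ _ _)) normal_pdfE// /normal_fun.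
have a0 : 0 < 2 * s ^+ 2 by rewrite mulr_gt0// exprn_even_gt0.
rewrite mulrCA [leRHS]mulrC ler_wpM2l ?normal_peak_ge0//.
rewrite (_ : - _ / _ = - (z ^+ 2 / (2 * s ^+ 2))); last by field.
by rewrite expRN ler_pdivrMr ?expR_gt0// expr_le_expR.
Qed.

(** Stein's identity: the density times (x - m)^j vanishes at infinity, so its
derivative integrates to zero. *)
Lemma normal_stein m s j : s != 0 ->
  \int[normal_prob m s]_x ((x - m) ^+ j.+1) =
  s ^+ 2 * (j%:R * \int[normal_prob m s]_x ((x - m) ^+ j.-1)).
Proof.
move=> s0.
pose g x := j%:R * (x - m) ^+ j.-1 - (x - m) ^+ j.+1 / s ^+ 2.
pose f x := g x * normal_pdf m s x.
have iN i : (normal_prob m s).-integrable setT (EFin \o (fun x => (x - m) ^+ i)).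
  exact: integrable_normal_pow.
have ig1 : (normal_prob m s).-integrable setT
    (EFin \o (fun x => j%:R * (x - m) ^+ j.-1)).
  by apply: (integrableZl _ j%:R (iN j.-1)).
have ig2 : (normal_prob m s).-integrable setT
    (EFin \o (fun x => (x - m) ^+ j.+1 / s ^+ 2)).
  apply: eq_integrable (integrableZl _ (s ^+ 2)^-1 (iN j.+1)) => //= x _.
  by rewrite -EFinM mulrC.
have ig : (normal_prob m s).-integrable setT (EFin \o g) by exact: (integrableB measurableT ig1 ig2).
have mg : measurable_fun setT g by case/integrableP: ig => /measurable_EFinP.
have : (\int[leb]_x (f x)%:E = 0)%E.
  apply: (@integral_total_derivative (fun y => (y - m) ^+ j * normal_pdf m s y) _ m).
  - by move=> x; exact: is_derive_pow_pdf.
  - move=> x; apply: cvgM; last exact: continuous_normal_pdf.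
    pose q : {poly R} := j%:R *: ('X - m%:P) ^+ j.-1 - (s ^+ 2)^-1 *: ('X - m%:P) ^+ j.+1.
    have -> : g = horner q.
      apply/funext => y; rewrite /q /g hornerD hornerN !hornerZ !horner_exp.
      by rewrite hornerXsubC [_^-1 * _]mulrC.
    exact: continuous_horner.
  - apply: eq_integrable (integrable_normal_pdfM ig) => //= x _.
    by rewrite mulrC.
  - pose C := (1 + (2 * s ^+ 2) ^+ j.+2 * j.+2`!%:R) * normal_peak s.
    have hC : (C + C) * harmonic n @[n --> \oo] --> ((C + C) * 0 : R).
      by apply: cvgM; [exact: cvg_cst|exact: cvg_harmonic].
    rewrite mulr0 in hC.
    apply/cvgr0Pnorm_le => e e0; move/cvgr0Pnorm_le: hC => /(_ e e0).
    apply: filterS => n; apply: le_trans; apply: le_trans (ler_norm _).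
    apply: le_trans (ler_normB _ _) _; rewrite mulrDl.
    have n0 : n.+1%:R != 0 :> R by rewrite pnatr_eq0.
    have cE (z : R) : m + z - m = z by rewrite addrAC subrr add0r.
    have n1 : - n.+1%:R != 0 :> R by rewrite oppr_eq0.
    rewrite (cE n.+1%:R) (cE (- n.+1%:R)); apply: lerD.
      by have := pdf_tail m j s0 n0; rewrite -/C normr_nat.
    by have := pdf_tail m j s0 n1; rewrite -/C normrN normr_nat.
under eq_integral do rewrite /f mulrC.
rewrite -integral_normal_prob_signed// => h0.
have : \int[normal_prob m s]_x g x = 0 by rewrite /Rintegral h0.
rewrite RintegralB// RintegralZl// RintegralZr//.
move=> /eqP; rewrite subr_eq0 => /eqP ->.
by field.
Qed.

End stein.

Section Rintegral_sum.
Context {R : realType} {disp : measure_display} {T : measurableType disp}.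
Variable P : {measure set T -> \bar R}.

Lemma integrable_sumR (I : Type) (s : seq I) (Q : pred I) (f : I -> T -> R) :
  (forall i, Q i -> P.-integrable setT (EFin \o f i)) ->
  P.-integrable setT (EFin \o (fun w => \sum_(i <- s | Q i) f i w)).
Proof.
move=> fi; have := @integrable_sum _ _ _ P setT measurableT _ s Q (fun i => EFin \o f i) fi.
by apply: eq_integrable => //= w _; rewrite sumEFin.
Qed.

Lemma Rintegral_sum (I : Type) (s : seq I) (Q : pred I) (f : I -> T -> R) :
  (forall i, Q i -> P.-integrable setT (EFin \o f i)) ->
  \int[P]_w (\sum_(i <- s | Q i) f i w) = \sum_(i <- s | Q i) \int[P]_w f i w.
Proof.
move=> fi; elim: s => [|i s IH].
  rewrite big_nil; under eq_Rintegral do rewrite big_nil.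
  by rewrite /Rintegral integral0.
rewrite big_cons; under eq_Rintegral do rewrite big_cons.
case: ifPn => // Qi; rewrite -IH RintegralD//; first exact: fi.
exact: integrable_sumR.
Qed.

End Rintegral_sum.

(** * Vectors with independent coordinates *)

Lemma indic_box {R : realType} {disp : measure_display} {T : measurableType disp}
    {k : nat} (Z : T -> 'cV[R]_k) (B : 'I_k -> set R) w :
  \1_(box Z B) w = \prod_j \1_(B j) (Z w j 0) :> R.
Proof.
rewrite indicE; have [|/negP nbw] := boolP (w \in box Z B).
  by rewrite inE => bw; rewrite big1// => i _; rewrite indicE mem_set//; exact: bw.
apply/esym/eqP/prodf_eq0.
have [i nBi] : exists i, ~ B i (Z w i 0).
  by apply/existsNP => bw; apply: nbw; rewrite inE.
by exists i => //; rewrite indicE memNset.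
Qed.

Lemma box_measurable {R : realType} {disp : measure_display}
    {T : measurableType disp} {k : nat} (Z : T -> 'cV[R]_k) (A : 'I_k -> set R) :
  random_vector Z -> (forall i, measurable (A i)) -> measurable (box Z A).
Proof.
move=> rZ mA.
rewrite (_ : box Z A = \bigcap_(i in setT) ((fun w => Z w i 0) @^-1` (A i))).
  apply: fin_bigcap_measurable => // i _; rewrite -[X in measurable X]setTI.
  exact: rZ.
by apply/seteqP; split=> [w hw i _|w hw i]; [exact: hw|exact: hw].
Qed.

Lemma box_setT {R : realType} {disp : measure_display} {T : measurableType disp}
    {k : nat} (Z : T -> 'cV[R]_k) : box Z (fun=> setT) = setT.
Proof. by apply/seteqP; split. Qed.

Section independent_coordinates.
Context {R : realType} {disp : measure_display} {T : measurableType disp}.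
Context (P : probability T R) {k : nat} (Z : T -> 'cV[R]_k).
Variable nu : 'I_k -> probability (measurableTypeR R) R.
Hypothesis rZ : random_vector Z.
Hypothesis lawZ : forall A : 'I_k -> set R, (forall i, measurable (A i)) ->
  P (box Z A) = (\prod_(i < k) nu i (A i))%E.

Lemma measurable_fun_coord (h : R -> R) i : measurable_fun setT h ->
  measurable_fun setT (fun w => h (Z w i 0)).
Proof. by move=> mh; apply: (measurableT_comp mh (rZ i)). Qed.

Lemma measurable_prod_coord (Q : pred 'I_k) (h : 'I_k -> R -> R) :
  (forall i, measurable_fun setT (h i)) ->
  measurable_fun setT (fun w => \prod_(i | Q i) h i (Z w i 0)).
Proof.
move=> mh; under eq_fun do rewrite big_mkcond.
apply: measurable_prod => i _; case: (Q i); last exact: measurable_cst.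
exact: measurable_fun_coord.
Qed.

(** Induction over the coordinates whose factor is not an indicator function. With
indicators only this is the law on boxes; otherwise the integral in one more
coordinate is transferred to its own law. *)
Let ge0_prod_aux (s : seq 'I_k) (h : 'I_k -> R -> R) :
  (forall i, measurable_fun setT (h i)) -> (forall i x, 0 <= h i x) ->
  (forall i, (nu i).-integrable setT (EFin \o h i)) ->
  (forall i, i \notin s -> exists2 B, measurable B & h i = \1_B) ->
  (\int[P]_w (\prod_i h i (Z w i 0))%:E)%E = (\prod_i \int[nu i]_x h i x)%:E.
Proof.
elim: s h => [|i s IH] h mh h0 ih hs.
  have /choice[B hB] : forall i, exists B, measurable B /\ h i = \1_B.
    by move=> i; have [//|B mB ->] := hs i; exists B.
  transitivity (P (box Z B)).
    rewrite -[in RHS](setIT (box Z B)) -integral_indic//; last first.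
      by apply: box_measurable => // i; have [] := hB i.
    apply: eq_integral => w _; congr EFin; rewrite indic_box.
    by apply: eq_bigr => i _; have [_ ->] := hB i.
  rewrite lawZ; last by move=> i; have [] := hB i.
  rewrite -prodEFin; apply: eq_bigr => i _.
  have [mB ->] := hB i.
  rewrite /Rintegral integral_indic// setIT fineK//.
  exact: fin_num_measure.
pose c := \prod_(j | j != i) \int[nu j]_x h j x.
have c0 : 0 <= c by rewrite prodr_ge0// => j _; exact: Rintegral_ge0.
transitivity (\int[P]_w (\prod_(j | j != i) h j (Z w j 0) * h i (Z w i 0))%:E)%E.
  by apply: eq_integral => w _; rewrite [in LHS](bigD1 i)//= mulrC.
rewrite (@ge0_integral_transfer _ _ _ _ _ _ _ P (nu i)
  (fun w => \prod_(j | j != i) h j (Z w j 0)) (cst c) (fun w => Z w i 0) id)//.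
- rewrite (bigD1 i)//= mulrC -/c /=.
  under eq_integral do rewrite EFinM.
  rewrite ge0_integralZl_EFin//; last 2 first.
  - by move=> x _; rewrite lee_fin.
  - exact: (measurable_EFinP _ _).2 (mh i).
  rewrite EFinM /Rintegral fineK//.
  exact: (integrable_fin_num measurableT (ih i)).
- exact: measurable_prod_coord.
- by move=> w; rewrite prodr_ge0.
move=> B mB; pose h' j := if j == i then \1_B else h j.
transitivity (\int[P]_w (\prod_j h' j (Z w j 0))%:E)%E.
  apply: eq_integral => w _; rewrite [in RHS](bigD1 i)//= mulrC /h' eqxx.
  by congr ((_ * _)%:E); apply: eq_bigr => j /negPf ->.
rewrite IH.
- rewrite (bigD1 i)//= mulrC {2}/h' eqxx.
  under [in RHS]eq_integral do rewrite EFinM.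
  rewrite ge0_integralZl_EFin//; last exact/measurable_EFinP/measurable_indic.
  rewrite EFinM; congr (_ * _)%E.
    by congr EFin; apply: eq_bigr => j /negPf ji; rewrite /h' ji.
  rewrite /Rintegral fineK// integral_indic// setIT.
  exact: fin_num_measure.
- by move=> j; rewrite /h'; case: eqP => // _; exact: measurable_indic.
- by move=> j x; rewrite /h'; case: eqP.
- move=> j; rewrite /h'; case: eqP => // _.
  exact: integrable_indic.
- move=> j js; rewrite /h'; case: eqP => [_|/eqP ji]; first by exists B.
  by apply: hs; rewrite inE negb_or ji.
Qed.

Lemma ge0_integral_prod_coord (h : 'I_k -> R -> R) :
  (forall i, measurable_fun setT (h i)) -> (forall i x, 0 <= h i x) ->
  (forall i, (nu i).-integrable setT (EFin \o h i)) ->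
  (\int[P]_w (\prod_i h i (Z w i 0))%:E)%E = (\prod_i \int[nu i]_x h i x)%:E.
Proof.
move=> mh h0 ih; apply: (@ge0_prod_aux (enum 'I_k)) => // i.
by rewrite mem_enum.
Qed.

Let part (h : R -> R) (b : bool) : R -> R := if b then h^\+ else h^\-.
Let sg (b : bool) : R := if b then 1 else -1.

Let part_sum (h : R -> R) x : h x = \sum_(b : bool) sg b * part h b x.
Proof.
rewrite big_bool /= mul1r mulN1r.
have /(congr1 (fun f => f x)) := funrposBneg h.
by move=> <-.
Qed.

Let part_ge0 h b x : 0 <= part h b x.
Proof. by case: b; [exact: funrpos_ge0|exact: funrneg_ge0]. Qed.

Let part_measurable (h : R -> R) b : measurable_fun setT h -> measurable_fun setT (part h b).
Proof. by move=> mh; case: b; [exact: measurable_funrpos|exact: measurable_funrneg]. Qed.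

Let part_integrable i (h : R -> R) b : (nu i).-integrable setT (EFin \o h) ->
  (nu i).-integrable setT (EFin \o part h b).
Proof. by move=> ih; case: b; [exact: integrable_funrpos|exact: integrable_funrneg]. Qed.

Let prod_parts (h : 'I_k -> R -> R) w :
  \prod_i h i (Z w i 0) = \sum_(s : {ffun 'I_k -> bool})
    (\prod_i sg (s i)) * \prod_i part (h i) (s i) (Z w i 0).
Proof.
under eq_bigr do rewrite part_sum.
rewrite bigA_distr_bigA /=; apply: eq_bigr => s _.
by rewrite big_split.
Qed.

Let integral_part_prod (h : 'I_k -> R -> R) (s : {ffun 'I_k -> bool}) :
  (forall i, measurable_fun setT (h i)) ->
  (forall i, (nu i).-integrable setT (EFin \o h i)) ->
  (\int[P]_w (\prod_i part (h i) (s i) (Z w i 0))%:E)%E =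
  (\prod_i \int[nu i]_x part (h i) (s i) x)%:E.
Proof.
move=> mh ih; apply: (ge0_integral_prod_coord (h := fun i => part (h i) (s i))) => [i|i x|i].
- exact: part_measurable.
- exact: part_ge0.
- exact: part_integrable.
Qed.

Let integrable_part_prod (h : 'I_k -> R -> R) (s : {ffun 'I_k -> bool}) :
  (forall i, measurable_fun setT (h i)) ->
  (forall i, (nu i).-integrable setT (EFin \o h i)) ->
  P.-integrable setT (EFin \o (fun w => \prod_i part (h i) (s i) (Z w i 0))).
Proof.
move=> mh ih; apply/integrableP; split.
  apply/measurable_EFinP.
  have mp i := part_measurable (s i) (mh i).
  exact: (measurable_prod_coord predT mp).
rewrite (eq_integral (fun w => (\prod_i part (h i) (s i) (Z w i 0))%:E)); last first.
  by move=> w _; rewrite /= ger0_norm// prodr_ge0.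
by rewrite integral_part_prod// ltry.
Qed.

Lemma integrable_prod_coord (h : 'I_k -> R -> R) :
  (forall i, measurable_fun setT (h i)) ->
  (forall i, (nu i).-integrable setT (EFin \o h i)) ->
  P.-integrable setT (EFin \o (fun w => \prod_i h i (Z w i 0))).
Proof.
move=> mh ih.
rewrite (_ : (fun w => \prod_i h i (Z w i 0)) = (fun w =>
  \sum_(s : {ffun 'I_k -> bool})
    (\prod_i sg (s i)) * \prod_i part (h i) (s i) (Z w i 0))); last first.
  by apply/funext => w; rewrite prod_parts.
apply: integrable_sumR => s _.
by have := integrableZl measurableT (\prod_i sg (s i)) (integrable_part_prod s mh ih).
Qed.

(** By expansion of the product over the positive and negative parts of its
factors. *)
Lemma Rintegral_prod_coord (h : 'I_k -> R -> R) :
  (forall i, measurable_fun setT (h i)) ->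
  (forall i, (nu i).-integrable setT (EFin \o h i)) ->
  \int[P]_w (\prod_i h i (Z w i 0)) = \prod_i \int[nu i]_x h i x.
Proof.
move=> mh ih; under eq_Rintegral => w _ do rewrite prod_parts.
rewrite Rintegral_sum; last first.
  move=> s _.
  by have := integrableZl measurableT (\prod_i sg (s i)) (integrable_part_prod s mh ih).
transitivity (\prod_i \sum_(b : bool) sg b * \int[nu i]_x part (h i) b x).
  rewrite bigA_distr_bigA /=; apply: eq_bigr => s _; rewrite big_split /=.
  rewrite RintegralZl//; last exact: integrable_part_prod.
  by congr (_ * _); rewrite /Rintegral integral_part_prod.
apply: eq_bigr => i _; rewrite big_bool /= mul1r mulN1r.
rewrite -RintegralB//; last 2 first.
- by have := part_integrable true (ih i).
- by have := part_integrable false (ih i).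
apply: eq_Rintegral => x _.
by have /(congr1 (fun f => f x)) := funrposBneg (h i).
Qed.

Let at_coord i (f : R -> R) (j : 'I_k) : R -> R := if j == i then f else cst 1.

Let prod_at_coord i f w : \prod_j at_coord i f j (Z w j 0) = f (Z w i 0).
Proof.
rewrite (bigD1 i)//= /at_coord eqxx big1 ?mulr1// => j /negPf ji.
by rewrite ji.
Qed.

Lemma integrable_coord i (f : R -> R) : (nu i).-integrable setT (EFin \o f) ->
  P.-integrable setT (EFin \o (fun w => f (Z w i 0))).
Proof.
move=> jf; have mf : measurable_fun setT f by case/integrableP: jf => /measurable_EFinP.
have -> : (fun w => f (Z w i 0)) = (fun w => \prod_j at_coord i f j (Z w j 0)).
  by apply/funext => w; rewrite prod_at_coord.
apply: integrable_prod_coord => j; rewrite /at_coord; first by case: (j == i).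
by case: eqVneq => [->|_] //; exact: finite_measure_integrable_cst.
Qed.

End independent_coordinates.

(** ** Square-integrable variables *)

Section square_integrable.
Context {R : realType} {disp : measure_display} {T : measurableType disp}.
Variable P : probability T R.
Implicit Types f g : T -> R.

Definition sqint f : Prop :=
  measurable_fun setT f /\ P.-integrable setT (EFin \o (fun x => f x ^+ 2)).

Lemma integrable_le f g : measurable_fun setT f -> (forall x, `|f x| <= g x) ->
  P.-integrable setT (EFin \o g) -> P.-integrable setT (EFin \o f).
Proof.
move=> mf fg ig; apply: (le_integrable measurableT _ _ ig).
  exact/measurable_EFinP.
by move=> x _; rewrite lee_fin (le_trans (fg x))// ler_norm.
Qed.

Lemma integrable_measurable f : P.-integrable setT (EFin \o f) -> measurable_fun setT f.
Proof. by case/integrableP => /measurable_EFinP. Qed.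

Lemma integrableDR f g : P.-integrable setT (EFin \o f) ->
  P.-integrable setT (EFin \o g) -> P.-integrable setT (EFin \o (fun x => f x + g x)).
Proof. by move=> jf jg; have := integrableD measurableT jf jg. Qed.

Lemma integrableZR (c : R) f : P.-integrable setT (EFin \o f) ->
  P.-integrable setT (EFin \o (fun x => c * f x)).
Proof. by move=> jf; have := integrableZl measurableT c jf. Qed.

Lemma integrableBR f g : P.-integrable setT (EFin \o f) ->
  P.-integrable setT (EFin \o g) -> P.-integrable setT (EFin \o (fun x => f x - g x)).
Proof. by move=> jf jg; have := integrableB measurableT jf jg. Qed.

Lemma integrable_cst (c : R) : P.-integrable setT (EFin \o (fun=> c)).
Proof. exact: finite_measure_integrable_cst. Qed.

Lemma sqint_mul f g : sqint f -> sqint g ->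
  P.-integrable setT (EFin \o (fun x => f x * g x)).
Proof.
move=> [mf jf] [mg jg]; apply: (integrable_le _ _ (integrableDR jf jg)).
  exact: measurable_funM.
move=> x; rewrite normrM -[f x ^+ 2]real_normK ?num_real//.
rewrite -[g x ^+ 2]real_normK ?num_real//.
have := normr_ge0 (f x); have := normr_ge0 (g x).
by move: `|f x| `|g x| => u v; nra.
Qed.

Lemma sqint_cst (c : R) : sqint (fun=> c).
Proof. by split; [exact: measurable_cst|exact: (integrable_cst (c ^+ 2))]. Qed.

Lemma sqint_integrable f : sqint f -> P.-integrable setT (EFin \o f).
Proof.
move=> hf; have := sqint_mul hf (sqint_cst 1).
by apply: eq_integrable => //= x _; rewrite mulr1.
Qed.

Lemma sqintD f g : sqint f -> sqint g -> sqint (fun x => f x + g x).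
Proof.
move=> hf hg; have [mf jf] := hf; have [mg jg] := hg.
split; first exact: measurable_funD.
have := integrableDR (integrableDR jf jg) (integrableZR 2 (sqint_mul hf hg)).
by apply: eq_integrable => //= x _; congr EFin; ring.
Qed.

Lemma sqintZ (c : R) f : sqint f -> sqint (fun x => c * f x).
Proof.
move=> [mf jf]; split; first exact: measurable_funM.
have := integrableZR (c ^+ 2) jf.
by apply: eq_integrable => //= x _; rewrite exprMn.
Qed.

Lemma sqintB f g : sqint f -> sqint g -> sqint (fun x => f x - g x).
Proof.
move=> hf hg; have := sqintD hf (sqintZ (-1) hg).
by under eq_fun do rewrite mulN1r.
Qed.

Lemma sqint_sum (I : finType) (F : I -> T -> R) : (forall i, sqint (F i)) ->
  sqint (fun x => \sum_i F i x).
Proof.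
move=> h; elim: (index_enum I) => [|i s IH].
  by under eq_fun do rewrite big_nil; exact: sqint_cst.
by under eq_fun do rewrite big_cons; exact: sqintD.
Qed.

Lemma sqint_le f g : measurable_fun setT f -> (forall x, `|f x| <= `|g x|) ->
  sqint g -> sqint f.
Proof.
move=> mf fg [mg jg]; split => //; apply: (integrable_le _ _ jg).
  exact: measurable_funX.
move=> x; rewrite ger0_norm ?sqr_ge0// -[f x ^+ 2]real_normK ?num_real//.
by rewrite -[g x ^+ 2]real_normK ?num_real// lerXn2r// nnegrE.
Qed.

End square_integrable.

(** ** Orthogonality to the functions of a random vector *)

Section orthogonality.
Context {R : realType} {disp : measure_display} {T : measurableType disp}.
Context (P : probability T R) {k : nat} (y : T -> 'cV[R]_k).
Hypothesis ry : random_vector y.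

Definition boxes : set (set T) :=
  [set S | exists2 B : 'I_k -> set R, (forall i, measurable (B i)) & S = box y B].

Lemma boxes_setI : setI_closed boxes.
Proof.
move=> _ _ [B mB ->] [C mC ->]; exists (fun i => B i `&` C i).
  by move=> i; exact: measurableI.
by apply/seteqP; split=> [w [h1 h2] i|w h]; [split|split=> i; have [] := h i].
Qed.

Lemma sigma_boxes_measurable : <<s boxes >> `<=` measurable.
Proof.
apply: smallest_sub; first exact: sigma_algebra_measurable.
by move=> _ [B mB ->]; exact: box_measurable.
Qed.

Lemma coord_sigma_boxes i (U : set R) : measurable U ->
  boxes ((fun w => y w i 0) @^-1` U).
Proof.
move=> mU; exists (fun j => if j == i then U else setT).
  by move=> j; case: (j == i).
apply/seteqP; split=> [w /= Uw j|w /(_ i)]; last by rewrite eqxx.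
by case: eqVneq => // ->.
Qed.

Variable w : T -> R.
Hypothesis iw : P.-integrable setT (EFin \o w).
Hypothesis w_box : forall B : 'I_k -> set R, (forall i, measurable (B i)) ->
  \int[P]_x (\1_(box y B) x * w x) = 0.

Let mw : measurable_fun setT w.
Proof. by case/integrableP: iw => /measurable_EFinP. Qed.

Let iSw S : measurable S -> P.-integrable setT (EFin \o (fun x => \1_S x * w x)).
Proof.
move=> mS; apply: (le_integrable measurableT _ _ iw).
  by apply/measurable_EFinP; apply: measurable_funM => //; exact: measurable_indic.
move=> x _; rewrite lee_fin normrM ler_piMl// indicE.
by case: (_ \in _); rewrite ?normr1 ?normr0.
Qed.

Let null : set (set T) := [set S | measurable S /\ \int[P]_x (\1_S x * w x) = 0].

(** Dynkin's argument: the events on which w integrates to zero form a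
lambda-system, and the boxes are stable under intersection. *)
Let null_lambda : lambda_system setT null.
Proof.
split.
- by [].
- split => //; have := @w_box (fun=> setT) (fun=> measurableT).
  by rewrite box_setT.
- move=> A B BA [mA A0] [mB B0]; split; first exact: measurableD.
  transitivity (\int[P]_x (\1_A x * w x) - \int[P]_x (\1_B x * w x)).
    2: by rewrite A0 B0 subrr.
  rewrite -RintegralB//; last 2 first.
  + exact: iSw.
  + exact: iSw.
  apply: eq_Rintegral => x _; rewrite -mulrBl; congr (_ * _).
  rewrite !indicE !in_setD; have [Bx|nBx] := boolP (x \in B); rewrite ?andbF ?andbT ?subr0//=.
  by rewrite mem_set ?subrr//; apply: BA; rewrite inE in Bx.
- move=> F ndF F0; have mF n : measurable (F n) by have [] := F0 n.
  have mU : measurable (\bigcup_n F n) by exact: bigcup_measurable.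
  split => //.
  have cv1 : (\int[P]_x (\1_(F n) x * w x)%:E)%E @[n --> \oo] -->
      (\int[P]_x (\1_(\bigcup_n F n) x * w x)%:E)%E.
    apply: (@dominated_cvg _ _ _ P setT measurableT
      (fun n x => (\1_(F n) x * w x)%:E) _ (fun x => `|(w x)%:E|%E)) => //.
    + by move=> n; have := iSw (mF n); case/integrableP.
    + move=> x _; apply: cvg_near_cst.
      have [[N _ FNx]|nFx] := pselect ((\bigcup_n F n) x).
        near=> n; congr (_ * _)%:E; rewrite !indicE.
        rewrite (mem_set (_ : (\bigcup_n F n) x)); last by exists N.
        rewrite mem_set//.
        have /subsetPset : (F N <= F n)%O by apply: ndF; near: n; exact: nbhs_infty_ge.
        exact.
      apply: nearW => n; congr (_ * _)%:E; rewrite !indicE !memNset//.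
      by move=> Fx; apply: nFx; exists n.
    + exact: integrable_abse.
    + move=> n x _; rewrite lee_fin normrM ler_piMl// indicE.
      by case: (_ \in _); rewrite ?normr1 ?normr0.
  have cv2 : (\int[P]_x (\1_(F n) x * w x)%:E)%E @[n --> \oo] --> 0%E.
    apply: cvg_near_cst; apply: nearW => n; have [_] := F0 n.
    rewrite /Rintegral => h.
    by rewrite -[LHS]fineK ?h//; exact: (integrable_fin_num measurableT (iSw (mF n))).
  by rewrite /Rintegral (cvg_unique _ cv1 cv2).
Unshelve. all: by end_near. Qed.

Lemma null_sigma_boxes S : <<s boxes >> S -> \int[P]_x (\1_S x * w x) = 0.
Proof.
have h := lambda_system_subset boxes_setI null_lambda.
move=> sS; have [] // : null S.
apply: h => // _ [B mB ->]; split; first exact: box_measurable.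
exact: w_box.
Qed.

(** Orthogonality passes from events to nonnegative functions of y by monotone
convergence, once w and h are split into their positive and negative parts. *)
Lemma orthogonal_sigma_boxes (h : T -> R) :
  (forall U, measurable U -> <<s boxes >> (h @^-1` U)) ->
  P.-integrable setT (EFin \o (fun x => w x * h x)) ->
  \int[P]_x (w x * h x) = 0.
Proof.
move=> sh iwh.
have mh : measurable_fun setT h.
  by move=> _ U mU; rewrite setTI; apply: sigma_boxes_measurable; exact: sh.
have mp : measurable_fun setT w^\+ by exact: measurable_funrpos.
have mn : measurable_fun setT w^\- by exact: measurable_funrneg.
have p0 x : 0 <= w^\+ x by exact: funrpos_ge0.
have n0 x : 0 <= w^\- x by exact: funrneg_ge0.
have wE x : w x = w^\+ x - w^\- x.
  by have /(congr1 (fun f => f x)) := funrposBneg w => <-.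
have ip : P.-integrable setT (EFin \o w^\+) by exact: (integrable_funrpos measurableT iw).
have in_ : P.-integrable setT (EFin \o w^\-) by exact: (integrable_funrneg measurableT iw).
have indi (f : T -> R) S : measurable S -> P.-integrable setT (EFin \o f) ->
    P.-integrable setT (EFin \o (fun x => f x * \1_S x)).
  move=> mS jf; apply: (le_integrable measurableT _ _ jf).
    apply/measurable_EFinP; apply: measurable_funM; last exact: measurable_indic.
    by case/integrableP: jf => /measurable_EFinP.
  move=> x _; rewrite lee_fin normrM ler_piMr// indicE.
  by case: (_ \in _); rewrite ?normr1 ?normr0.
have tr (g : R -> R) : measurable_fun setT g -> (forall x, 0 <= g x) ->
    (\int[P]_x (w^\+ x * g (h x))%:E = \int[P]_x (w^\- x * g (h x))%:E)%E.
  move=> mg g0; apply: ge0_integral_transfer => // U mU.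
  have mS : measurable (h @^-1` U) by apply: sigma_boxes_measurable; exact: sh.
  have := null_sigma_boxes (sh _ mU).
  have -> : \int[P]_x (\1_(h @^-1` U) x * w x) =
     \int[P]_x (w^\+ x * \1_(h @^-1` U) x) - \int[P]_x (w^\- x * \1_(h @^-1` U) x).
    rewrite -RintegralB//; [|exact: indi|exact: indi].
    by apply: eq_Rintegral => x _; rewrite -mulrBl -wE mulrC.
  move=> /eqP; rewrite subr_eq0 => /eqP e.
  have e1 := integrable_fin_num measurableT (indi _ _ mS ip).
  have e2 := integrable_fin_num measurableT (indi _ _ mS in_).
  by rewrite -[LHS](fineK e1) -[RHS](fineK e2); congr EFin.
have parts (f1 : T -> R) (f2 : R -> R) : measurable_fun setT f1 -> measurable_fun setT f2 ->
   (forall x, `|f1 x| <= `|w x|) -> (forall x, `|f2 x| <= `|x|) ->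
   P.-integrable setT (EFin \o (fun x => f1 x * f2 (h x))).
  move=> m1 m2 l1 l2; apply: (le_integrable measurableT _ _ iwh).
    apply/measurable_EFinP; apply: measurable_funM => //.
    exact: measurableT_comp.
  by move=> x _; rewrite lee_fin !normrM ler_pM.
pose gp (x : R) := Num.max x 0; pose gn (x : R) := Num.max (- x) 0.
have mgp : measurable_fun setT gp by exact: measurable_maxr.
have mgn : measurable_fun setT gn by apply: measurable_maxr => //; exact: measurable_funN.
have gp0 x : 0 <= gp x by rewrite /gp le_max lexx orbT.
have gn0 x : 0 <= gn x by rewrite /gn le_max lexx orbT.
have gE x : x = gp x - gn x by rewrite /gp /gn; case: (leP x 0); case: (leP (- x) 0); lra.
have lgp x : `|gp x| <= `|x| by rewrite ger0_norm// /gp ge_max ler_norm normr_ge0.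
have lgn x : `|gn x| <= `|x| by rewrite ger0_norm// /gn ge_max -normrN ler_norm normr_ge0.
have lp x : `|w^\+ x| <= `|w x| by exact: lgp.
have ln x : `|w^\- x| <= `|w x| by exact: lgn.
have e (f : R -> R) : measurable_fun setT f -> (forall x, 0 <= f x) ->
    (forall x, `|f x| <= `|x|) -> \int[P]_x (w x * f (h x)) = 0.
  move=> mf f0 lf; under eq_Rintegral do rewrite wE mulrBl.
  rewrite RintegralB//; [|exact: parts|exact: parts].
  by rewrite /Rintegral tr// subrr.
under eq_Rintegral => x _ do rewrite [h x]gE mulrBr.
rewrite RintegralB//; [|exact: parts|exact: parts].
by rewrite !e// subrr.
Qed.

End orthogonality.

(** * The normal-normal model in one coordinate *)

Section normal_normal.
Context {R : realType}.
Local Notation leb := (@lebesgue_measure R).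
Variables (a lam d : R).
Hypotheses (lam0 : 0 < lam) (d0 : 0 < d).

Definition post_mean (s : R) : R := a + lam / (d + lam) * (s - a).
Definition post_var : R := lam * d / (d + lam).

Let v0 : 0 < d + lam. Proof. exact: addr_gt0. Qed.
Let t0 : 0 < post_var. Proof. by rewrite divr_gt0// mulr_gt0. Qed.

Let sq0 (x : R) : 0 < x -> Num.sqrt x != 0.
Proof. by move=> x0; rewrite gt_eqF// sqrtr_gt0. Qed.

(** Completing the square in the joint density. *)
Lemma normal_pdf_joint x s :
  normal_pdf a (Num.sqrt lam) x * normal_pdf x (Num.sqrt d) s =
  normal_pdf a (Num.sqrt (d + lam)) s * normal_pdf (post_mean s) (Num.sqrt post_var) x.
Proof.
rewrite !normal_pdfE ?sq0// /normal_fun /normal_peak !sqr_sqrtr ?ltW//.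
rewrite mulrACA [RHS]mulrACA -!expRD -!invfM.
have pi0 := pi_gt0 R.
congr (_^-1 * expR _); last first.
  by rewrite /post_mean /post_var; field; rewrite !gt_eqF.
rewrite -!sqrtrM ?mulrn_wge0 ?mulr_ge0 ?ltW//; congr Num.sqrt.
by rewrite /post_var; field; rewrite gt_eqF.
Qed.

Lemma measurable_pdf2 e : e != 0 ->
  measurable_fun setT (fun z : R * R => normal_pdf z.1 e z.2).
Proof.
move=> e0; under eq_fun do rewrite normal_pdfE// /normal_fun.
apply: measurable_funM => //; apply: measurableT_comp => //.
apply: measurable_funM => //; apply: measurableT_comp => //.
by apply: measurable_funX; apply: measurable_funB;
  [exact: measurable_snd|exact: measurable_fst].
Qed.

Definition trans (B : set R) (x : R) : R := fine (normal_prob x (Num.sqrt d) B).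

Lemma trans_prob B x : measurable B ->
  (trans B x)%:E = normal_prob x (Num.sqrt d) B.
Proof. by move=> mB; rewrite fineK// fin_num_measure. Qed.

Lemma trans_ge0 B x : 0 <= trans B x.
Proof. by rewrite fine_ge0. Qed.

Lemma trans_le1 B x : measurable B -> trans B x <= 1.
Proof. by move=> mB; rewrite -lee_fin trans_prob// probability_le1. Qed.

Let F (B : set R) (z : R * R) : \bar R := (normal_pdf z.1 (Num.sqrt d) z.2 * \1_B z.2)%:E.

Let mF B : measurable B -> measurable_fun setT (F B).
Proof.
move=> mB; apply/measurable_EFinP; apply: measurable_funM.
  by apply: measurable_pdf2; exact: sq0.
by apply: measurableT_comp => //; exact: measurable_snd.
Qed.

Let transE B x : measurable B ->
  (trans B x)%:E = (\int[leb]_s F B (x, s))%E.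
Proof.
move=> mB; rewrite trans_prob// /normal_prob [LHS]integral_mkcond.
by apply: eq_integral => s _; rewrite patchE /F /= indicE; case: ifP => _;
  rewrite ?mulr1 ?mulr0.
Qed.

Lemma measurable_trans B : measurable B -> measurable_fun setT (trans B).
Proof.
move=> mB; apply/measurable_EFinP.
rewrite (_ : EFin \o trans B = (fun x => (\int[leb]_s F B (x, s))%E)).
  apply: measurable_fun_fubini_tonelli_F; first exact: (mF mB).
  by move=> z; rewrite lee_fin mulr_ge0// normal_pdf_ge0.
by apply/funext => x; rewrite /= transE.
Qed.

(** Tonelli's theorem with the two factorizations of the joint density. *)
Lemma normal_normal_swap (B : set R) (g : R -> R) : measurable B ->
  measurable_fun setT g -> (forall x, 0 <= g x) ->
  (\int[normal_prob a (Num.sqrt lam)]_x (g x * trans B x)%:E =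
   \int[leb]_s ((normal_pdf a (Num.sqrt (d + lam)) s * \1_B s)%:E *
     \int[normal_prob (post_mean s) (Num.sqrt post_var)]_x (g x)%:E))%E.
Proof.
move=> mB mg g0.
have mgt : measurable_fun setT (fun x => g x * trans B x).
  by apply: measurable_funM => //; exact: measurable_trans.
have gt0 x : 0 <= g x * trans B x by rewrite mulr_ge0// trans_ge0.
transitivity (\int[leb]_x
    (normal_pdf a (Num.sqrt lam) x * (g x * trans B x))%:E)%E.
  exact: integral_normal_prob mgt gt0.
pose G (z : R * R) := ((normal_pdf a (Num.sqrt lam) z.1 * g z.1)%:E * F B z)%E.
have mG : measurable_fun setT G.
  apply: emeasurable_funM; last exact: (mF mB).
  apply/measurable_EFinP; apply: measurable_funM.
    exact: (measurableT_comp (measurable_normal_pdf _ _) measurable_fst).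
  by apply: measurableT_comp => //; exact: measurable_fst.
have F0 z : (0 <= F B z)%E by rewrite lee_fin mulr_ge0// normal_pdf_ge0.
have G0 z : (0 <= G z)%E.
  by rewrite mule_ge0// lee_fin mulr_ge0// normal_pdf_ge0.
transitivity (\int[leb]_x \int[leb]_s G (x, s))%E.
  apply: eq_integral => x _; rewrite /G /=.
  rewrite ge0_integralZl_EFin//; last 2 first.
  - by apply: measurableT_comp (mF mB) _; exact: measurable_pair1.
  - by rewrite mulr_ge0// normal_pdf_ge0.
  by rewrite -transE// -EFinM mulrA.
rewrite fubini_tonelli//; apply: eq_integral => s _.
rewrite integral_normal_prob//.
rewrite -ge0_integralZl_EFin//; last 3 first.
- by move=> x _; rewrite lee_fin mulr_ge0// normal_pdf_ge0.
- exact: measurable_pdfM.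
- by rewrite mulr_ge0// normal_pdf_ge0.
apply: eq_integral => x _; rewrite /G /F -!EFinM /=; congr EFin.
by rewrite mulrACA [RHS]mulrACA normal_pdf_joint [g x * _]mulrC.
Qed.

End normal_normal.

Section normal_values.
Context {R : realType}.
Implicit Types (m s c : R).

Lemma integral_prob_cst d (T : measurableType d) (P : probability T R) (c : R) :
  (\int[P]_x c%:E = c%:E)%E.
Proof.
rewrite integral_cst// [X in (_ * X)%E](_ : _ = 1%E) ?mule1//.
exact: (@probability_setT _ _ _ P).
Qed.

Lemma Rintegral_prob_cst d (T : measurableType d) (P : probability T R) (c : R) :
  \int[P]_x c = c.
Proof. by rewrite /Rintegral integral_prob_cst. Qed.

Lemma normal_moment0 m s : \int[normal_prob m s]_x ((x - m) ^+ 0) = 1.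
Proof. by under eq_Rintegral do rewrite expr0; rewrite Rintegral_prob_cst. Qed.

Lemma normal_moment1 m s : s != 0 -> \int[normal_prob m s]_x ((x - m) ^+ 1) = 0.
Proof. by move=> s0; rewrite (normal_stein m 0 s0) mul0r mulr0. Qed.

Lemma normal_moment2 m s : s != 0 -> \int[normal_prob m s]_x ((x - m) ^+ 2) = s ^+ 2.
Proof. by move=> s0; rewrite (normal_stein m 1 s0) normal_moment0 !mulr1. Qed.

Lemma normal_moment3 m s : s != 0 -> \int[normal_prob m s]_x ((x - m) ^+ 3) = 0.
Proof. by move=> s0; rewrite (normal_stein m 2 s0) normal_moment1// !mulr0. Qed.

Lemma normal_moment4 m s : s != 0 ->
  \int[normal_prob m s]_x ((x - m) ^+ 4) = 3 * s ^+ 4.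
Proof. by move=> s0; rewrite (normal_stein m 3 s0) normal_moment2//; ring. Qed.

Lemma normal_moment5 m s : s != 0 -> \int[normal_prob m s]_x ((x - m) ^+ 5) = 0.
Proof. by move=> s0; rewrite (normal_stein m 4 s0) normal_moment3// !mulr0. Qed.

Lemma normal_moment6 m s : s != 0 ->
  \int[normal_prob m s]_x ((x - m) ^+ 6) = 15 * s ^+ 6.
Proof. by move=> s0; rewrite (normal_stein m 5 s0) normal_moment4//; ring. Qed.

Lemma integrable_normal_powZ m s n c : s != 0 ->
  (normal_prob m s).-integrable setT (EFin \o (fun x => c * (x - m) ^+ n)).
Proof.
move=> s0; have h := @integrable_normal_pow _ m s n s0.
by have := integrableZl measurableT c h.
Qed.

Lemma normal_poly_integrable m s (p : {poly R}) : s != 0 ->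
  (normal_prob m s).-integrable setT (EFin \o (fun x => p.[x - m])).
Proof.
move=> s0.
have -> : (fun x => p.[x - m]) = (fun x => \sum_(i < size p) p`_i * (x - m) ^+ i).
  by apply/funext => x; rewrite horner_coef.
by apply: integrable_sumR => i _; exact: integrable_normal_powZ.
Qed.

Lemma integrable_normal_affine_sqr m s (b c : R) : s != 0 ->
  (normal_prob m s).-integrable setT (EFin \o (fun x => (b + c * (x - m)) ^+ 2)).
Proof.
move=> s0.
have -> : (fun x => (b + c * (x - m)) ^+ 2) = (fun x => ((b%:P + c *: 'X) ^+ 2).[x - m]).
  by apply/funext => x; rewrite horner_exp hornerD hornerC hornerZ hornerX.
exact: normal_poly_integrable.
Qed.

Lemma normal_quadratic m s c : s != 0 ->
  (\int[normal_prob m s]_x ((x - c) ^+ 2)%:E = ((m - c) ^+ 2 + s ^+ 2)%:E)%E.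
Proof.
move=> s0.
have e x : (x - c) ^+ 2 = (x - m) ^+ 2 + (2 * (m - c) * (x - m) ^+ 1 + (m - c) ^+ 2).
  by ring.
have i1 := @integrable_normal_powZ m s 1 (2 * (m - c)) s0.
have i2 := @integrable_normal_pow _ m s 2 s0.
have i3 := integrable_cst (normal_prob m s) ((m - c) ^+ 2).
have i4 := integrableD measurableT i1 i3.
have i5 := integrableD measurableT i2 i4.
under eq_integral do rewrite e.
rewrite -[LHS]fineK; last exact: (integrable_fin_num measurableT i5).
congr EFin; transitivity (\int[normal_prob m s]_x ((x - m) ^+ 2 +
    (2 * (m - c) * (x - m) ^+ 1 + (m - c) ^+ 2))); first by [].
rewrite RintegralD// RintegralD// RintegralZl; last 2 first.
- exact: measurableT.
- exact: integrable_normal_pow.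
by rewrite normal_moment1// normal_moment2// Rintegral_prob_cst; ring.
Qed.

End normal_values.

(** * The marginal law and the posterior moments *)

Lemma Rintegral_prob_indic {R : realType} d (T : measurableType d)
    (P : probability T R) (B : set T) : measurable B ->
  \int[P]_x (\1_B x : R) = fine (P B).
Proof. by move=> mB; rewrite /Rintegral integral_indic// setIT. Qed.

Lemma integrable_prob_indic {R : realType} d (T : measurableType d)
    (P : probability T R) (B : set T) : measurable B ->
  P.-integrable setT (EFin \o (\1_B : T -> R)).
Proof. exact: integrable_indic. Qed.

Lemma prod_mulr_at (R : comPzRingType) (I : finType) (i : I) (c : R) (f : I -> R) :
  (\prod_j f j) * c = \prod_j (if j == i then c * f i else f j).
Proof.
rewrite (bigD1 i)//= [RHS](bigD1 i)//= eqxx mulrC mulrA; congr (_ * _).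
by apply: eq_bigr => j /negPf ->.
Qed.

Section model.
Context {R : realType} {disp : measure_display} {T : measurableType disp}.
Context (P : probability T R) {k : nat} (y mu : T -> 'cV[R]_k).
Variables (a : 'cV[R]_k) (lam : R) (d : 'rV[R]_k).
Hypotheses (lam0 : 0 < lam) (d0 : forall i, 0 < d 0 i).
Hypothesis mu_law : normal_vector P mu a (const_mx lam).
Hypothesis y_cond : cond_normal_vector P y mu d.

Let sq0 (x : R) : 0 < x -> Num.sqrt x != 0.
Proof. by move=> x0; rewrite gt_eqF// sqrtr_gt0. Qed.

Let v0 i : 0 < d 0 i + lam. Proof. exact: addr_gt0. Qed.

Let ry : random_vector y := y_cond.1.
Let rmu : random_vector mu := mu_law.1.

Definition obs_law (i : 'I_k) : probability (measurableTypeR R) R :=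
  normal_prob (a i 0) (Num.sqrt (d 0 i + lam)).
Let latent_law (i : 'I_k) : probability (measurableTypeR R) R := normal_prob (a i 0) (Num.sqrt lam).

Let mu_box (A : 'I_k -> set R) : (forall i, measurable (A i)) ->
  P (box mu A) = (\prod_(i < k) latent_law i (A i))%E.
Proof.
move=> mA; rewrite (mu_law.2 A mA); apply: eq_bigr => i _.
by rewrite (_ : const_mx lam 0 i = lam)//; exact: mxE.
Qed.

Let trans_box (w : T) (B : 'I_k -> set R) : (forall i, measurable (B i)) ->
  normal_box (mu w) d B = (\prod_(i < k) trans (d 0 i) (B i) (mu w i 0))%:E.
Proof.
by move=> mB; rewrite -prodEFin; apply: eq_bigr => i _; rewrite trans_prob.
Qed.

Let integrable_trans (nu : probability (measurableTypeR R) R) i (B : set R) : measurable B ->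
  nu.-integrable setT (EFin \o trans (d 0 i) B).
Proof.
move=> mB; apply: le_integrable (integrable_cst nu 1) => //.
  by apply/measurable_EFinP; exact: measurable_trans.
move=> x _ /=; rewrite lee_fin normr1 ger0_norm ?trans_ge0//.
exact: trans_le1.
Qed.

Let trans_mean i (B : set R) : measurable B ->
  \int[latent_law i]_x trans (d 0 i) B x = fine (obs_law i B).
Proof.
move=> mB; rewrite /Rintegral; congr fine.
transitivity (\int[normal_prob (a i 0%R) (Num.sqrt lam)]_x
    (cst 1 x * trans (d 0%R i) B x)%R%:E)%E.
  by apply: eq_integral => x _; rewrite mul1r.
rewrite (normal_normal_swap (a i 0) lam0 (d0 i) mB) => //.
transitivity (\int[lebesgue_measure]_(s in B)
  (normal_pdf (a i 0%R) (Num.sqrt (d 0%R i + lam)%R) s)%:E)%E; last by [].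
rewrite [RHS]integral_mkcond; apply: eq_integral => s _.
rewrite (_ : (\int[_]_x _)%E = 1%E); last exact: integral_prob_cst.
by rewrite mule1 patchE indicE; case: ifP => _; rewrite ?mulr1 ?mulr0.
Qed.

Lemma marginal_law (B : 'I_k -> set R) : (forall i, measurable (B i)) ->
  P (box y B) = (\prod_(i < k) obs_law i (B i))%E.
Proof.
move=> mB; have := y_cond.2 (fun=> setT) B (fun=> measurableT) mB.
rewrite box_setT setTI => ->.
under eq_integral do rewrite trans_box//.
rewrite (ge0_integral_prod_coord rmu mu_box (h := fun i => trans (d 0 i) (B i))).
- rewrite -prodEFin; apply: eq_bigr => i _; rewrite trans_mean// fineK//.
  exact: (@fin_num_measure _ _ _ (obs_law i) _ (mB i)).
- by move=> i; exact: measurable_trans.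
- by move=> i x; exact: trans_ge0.
- by move=> i; exact: integrable_trans.
Qed.

Let tau (i : 'I_k) : R := post_var lam (d 0 i).
Let pm (i : 'I_k) : R -> R := post_mean (a i 0) lam (d 0 i).

Let tau0 i : 0 < tau i.
Proof. by rewrite divr_gt0// mulr_gt0. Qed.

Lemma measurable_quad i c : measurable_fun setT (fun s => (pm i s - c) ^+ 2 + tau i).
Proof.
apply: measurable_funD => //; apply: measurable_funX; apply: measurable_funB => //.
apply: measurable_funD => //; apply: measurable_funM => //.
exact: measurable_funB.
Qed.

(** Given y, the coordinate mu_i is normal with mean pm and variance tau. The
identity is stated for squares because they are nonnegative, as Tonelli's
theorem requires; the values c = 0 and c = 1 together determine the mean. *)
Lemma posterior_box i c (B : 'I_k -> set R) : (forall i, measurable (B i)) ->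
  (\int[P]_w (\1_(box y B) w * (mu w i 0 - c) ^+ 2)%:E =
   \int[P]_w (\1_(box y B) w * ((pm i (y w i 0) - c) ^+ 2 + tau i))%:E)%E.
Proof.
move=> mB.
have mbox : measurable (box y B) by exact: box_measurable.
have mtr j : measurable_fun setT (trans (d 0 j) (B j)) by exact: measurable_trans.
have msq : measurable_fun setT (fun x : R => (x - c) ^+ 2).
  by apply: measurable_funX; exact: measurable_funB.
transitivity (\int[P]_w
    (\prod_j trans (d 0 j) (B j) (mu w j 0) * (mu w i 0 - c) ^+ 2)%:E)%E.
  apply: (@ge0_integral_transfer _ _ _ _ _ _ _ P P (\1_(box y B))
    (fun w => \prod_j trans (d 0 j) (B j) (mu w j 0))
    (fun w => mu w i 0) (fun w => mu w i 0) (fun x => (x - c) ^+ 2)) => //.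
  - exact: (measurable_prod_coord rmu predT mtr).
  - by move=> w; rewrite prodr_ge0// => j _; exact: trans_ge0.
  - move=> A mA.
    pose A' j := if j == i then A else setT.
    have mA' j : measurable (A' j) by rewrite /A'; case: eqP.
    have iA w : \1_A (mu w i 0) = \1_(box mu A') w :> R.
      rewrite !indicE; congr (_%:R); congr nat_of_bool; apply/idP/idP; rewrite !inE.
        by move=> h j; rewrite /A'; case: eqP => // ->.
      by move=> /(_ i); rewrite /A' eqxx.
    transitivity (P (box mu A' `&` box y B)).
      rewrite -[in RHS](setIT (_ `&` _)) -integral_indic//; last first.
        by apply: measurableI => //; exact: box_measurable.
      by apply: eq_integral => w _; rewrite iA indicI /= mulrC.
    rewrite y_cond.2// [LHS]integral_mkcond; apply: eq_integral => w _.
    rewrite patchE iA indicE; case: ifP => _; last by rewrite mulr0.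
    by rewrite mulr1 trans_box.
  - by move=> x; exact: sqr_ge0.
pose q s := (pm i s - c) ^+ 2 + tau i.
have q0 s : 0 <= q s by rewrite addr_ge0 ?sqr_ge0// ltW.
have mq : measurable_fun setT q by exact: measurable_quad.
have key : (\int[latent_law i]_x ((x - c) ^+ 2 * trans (d 0 i) (B i) x)%:E =
            \int[obs_law i]_s (\1_(B i) s * q s)%:E)%E.
  have sw := normal_normal_swap (a i 0) lam0 (d0 i) (mB i) msq (fun x => sqr_ge0 _).
  apply: (etrans sw).
  have mBq : measurable_fun setT (fun s => \1_(B i) s * q s) by exact: measurable_funM.
  have Bq0 s : 0 <= \1_(B i) s * q s by rewrite mulr_ge0.
  apply: (etrans _ (esym (integral_normal_prob _ _ mBq Bq0))).
  apply: eq_integral => s _.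
  rewrite (normal_quadratic _ _ (sq0 (tau0 i))) (sqr_sqrtr (ltW (tau0 i))).
  by rewrite -EFinM mulrA.
pose hm j x := if j == i then (x - c) ^+ 2 * trans (d 0 i) (B i) x
               else trans (d 0 j) (B j) x.
pose hy j s := if j == i then \1_(B i) s * q s else \1_(B j) s : R.
transitivity (\int[P]_w (\prod_j hm j (mu w j 0))%:E)%E.
  apply: eq_integral => w _; congr EFin.
  rewrite (prod_mulr_at i); apply: eq_bigr => j _; rewrite /hm.
  by case: eqVneq => [->|_].
transitivity (\int[P]_w (\prod_j hy j (y w j 0))%:E)%E; last first.
  apply: eq_integral => w _; congr EFin.
  have -> : \prod_j hy j (y w j 0) =
      \prod_j \1_(B j) (y w j 0) * q (y w i 0).
    rewrite (prod_mulr_at i); apply: eq_bigr => j _; rewrite /hy.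
    by case: eqVneq => [->|_]; [exact: mulrC|].
  congr (_ * _).
  exact: esym (indic_box y B w).
have hm_m j : measurable_fun setT (hm j).
  by rewrite /hm; case: (j == i); [exact: measurable_funM msq (mtr i)|exact: mtr].
have hm0 j x : 0 <= hm j x.
  rewrite /hm; case: (j == i); last exact: trans_ge0.
  by apply: mulr_ge0; [exact: sqr_ge0|exact: trans_ge0].
have hy_m j : measurable_fun setT (hy j).
  rewrite /hy; case: (j == i); last exact: measurable_indic.
  exact: measurable_funM (measurable_indic (mB i)) mq.
have ind0 (U : set R) x : 0 <= \1_U x :> R by rewrite indicE ler0n.
have hy0 j x : 0 <= hy j x.
  rewrite /hy; case: (j == i); last exact: ind0.
  by apply: mulr_ge0; [exact: ind0|exact: q0].
have isq : (latent_law i).-integrable setT (EFin \o (fun x => (x - c) ^+ 2)).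
  have h := integrable_normal_affine_sqr (a i 0) (a i 0 - c) 1 (sq0 lam0).
  suff <- : (fun x : R => (a i 0 - c + 1 * (x - a i 0)) ^+ 2) = (fun x => (x - c) ^+ 2).
    exact: h.
  by apply/funext => x; congr (_ ^+ 2); ring.
have ihm j : (latent_law j).-integrable setT (EFin \o hm j).
  rewrite /hm; case: eqVneq => [->|_]; last exact: integrable_trans.
  apply: (le_integrable measurableT _ _ isq).
    exact: (measurable_EFinP _ _).2 (measurable_funM msq (mtr i)).
  move=> x _; rewrite lee_fin normrM; apply: ler_piMr; first exact: normr_ge0.
  by rewrite ger0_norm; [exact: trans_le1|exact: trans_ge0].
have meanE j : \int[latent_law j]_x hm j x = \int[obs_law j]_x hy j x.
  rewrite /hm /hy; case: eqVneq => [->|_].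
    exact: (congr1 fine key).
  exact: etrans (trans_mean j (mB j)) (esym (Rintegral_prob_indic (obs_law j) (mB j))).
have ihy j : (obs_law j).-integrable setT (EFin \o hy j).
  rewrite /hy; case: eqVneq => [->|_]; last exact: (integrable_prob_indic (obs_law j) (mB j)).
  have h := integrable_normal_affine_sqr (a i 0) (a i 0 - c)
    (lam / (d 0 i + lam)) (sq0 (v0 i)).
  have h2 := integrableD measurableT h (integrable_cst (obs_law i) (tau i)).
  apply: (le_integrable measurableT _ _ h2).
    exact: (measurable_EFinP _ _).2 (measurable_funM (measurable_indic (mB i)) mq).
  move=> x _; rewrite lee_fin normrM.
  have -> : a i 0 - c + lam / (d 0 i + lam) * (x - a i 0) = pm i x - c.
    by rewrite /pm /post_mean; ring.
  apply: ler_piMl; first exact: normr_ge0.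
  rewrite indicE.
  by case: (_ \in _); rewrite ?normr1 ?normr0.
rewrite (ge0_integral_prod_coord rmu mu_box hm_m hm0 ihm).
rewrite (ge0_integral_prod_coord ry marginal_law hy_m hy0 ihy).
exact: (congr1 EFin (eq_bigr _ (fun j _ => meanE j))).
Qed.

Lemma sqint_obs i : sqint P (fun w => y w i 0).
Proof.
split; first exact: ry.
apply: (integrable_coord ry marginal_law (i := i) (f := fun x => x ^+ 2)).
have h := integrable_normal_affine_sqr (a i 0) (a i 0) 1 (sq0 (v0 i)).
suff <- : (fun x : R => (a i 0 + 1 * (x - a i 0)) ^+ 2) = (fun x => x ^+ 2).
  exact: h.
by apply/funext => x; congr (_ ^+ 2); ring.
Qed.

Lemma sqint_latent i : sqint P (fun w => mu w i 0).
Proof.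
split; first exact: rmu.
apply: (integrable_coord rmu mu_box (i := i) (f := fun x => x ^+ 2)).
have h := integrable_normal_affine_sqr (a i 0) (a i 0) 1 (sq0 lam0).
suff <- : (fun x : R => (a i 0 + 1 * (x - a i 0)) ^+ 2) = (fun x => x ^+ 2).
  exact: h.
by apply/funext => x; congr (_ ^+ 2); ring.
Qed.

Let resid i (w : T) : R := mu w i 0 - pm i (y w i 0).

Let sqint_pm i : sqint P (fun w => pm i (y w i 0)).
Proof.
apply: sqintD; first exact: sqint_cst.
by apply: sqintZ; apply: sqintB; [exact: sqint_obs|exact: sqint_cst].
Qed.

Let sqint_resid i : sqint P (resid i).
Proof. by apply: sqintB; [exact: sqint_latent|exact: sqint_pm]. Qed.

Let resid_box i (B : 'I_k -> set R) : (forall i, measurable (B i)) ->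
  \int[P]_w (\1_(box y B) w * resid i w) = 0.
Proof.
move=> mB.
have mS : measurable (box y B) by exact: box_measurable.
have iS (f : T -> R) : P.-integrable setT (EFin \o f) ->
    P.-integrable setT (EFin \o (fun w => \1_(box y B) w * f w)).
  move=> jf; apply: (integrable_le _ _ (integrable_abse jf)).
    apply: measurable_funM; first exact: measurable_indic.
    exact: integrable_measurable jf.
  move=> w; rewrite normrM ler_piMl// indicE.
  by case: (_ \in _); rewrite ?normr1 ?normr0.
have e c := congr1 fine (posterior_box i c mB).
have im c : P.-integrable setT (EFin \o (fun w => (mu w i 0 - c) ^+ 2)).
  by have [_] := sqintB (sqint_latent i) (sqint_cst P c).
have iq c : P.-integrable setT (EFin \o (fun w => (pm i (y w i 0) - c) ^+ 2 + tau i)).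
  apply: integrableDR; last exact: integrable_cst.
  by have [_] := sqintB (sqint_pm i) (sqint_cst P c).
have e1 : \int[P]_w (\1_(box y B) w * (2 * resid i w)) =
   \int[P]_w (\1_(box y B) w * (mu w i 0 - 0) ^+ 2 - \1_(box y B) w * (mu w i 0 - 1) ^+ 2)
 - \int[P]_w (\1_(box y B) w * ((pm i (y w i 0) - 0) ^+ 2 + tau i)
              - \1_(box y B) w * ((pm i (y w i 0) - 1) ^+ 2 + tau i)).
  rewrite -RintegralB//; last 2 first.
  - by apply: integrableBR; apply: iS; exact: im.
  - by apply: integrableBR; apply: iS; exact: iq.
  by apply: eq_Rintegral => w _; rewrite /resid; ring.
have e2 : \int[P]_w (\1_(box y B) w * (2 * resid i w)) = 0.
  rewrite e1 !RintegralB//; do ?[by apply: iS; exact: im|by apply: iS; exact: iq].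
  have := e 0; have := e 1; rewrite /Rintegral => -> ->.
  exact: subrr.
have : 2 * \int[P]_w (\1_(box y B) w * resid i w) = 0.
  rewrite -RintegralZl//; last by apply: iS; exact: sqint_integrable.
  by rewrite -[RHS]e2; apply: eq_Rintegral => w _; rewrite mulrCA.
by move/eqP; rewrite mulf_eq0 pnatr_eq0 /= => /eqP.
Qed.

(** The deviation of mu_i from its posterior mean integrates to zero on the boxes
of y, so it is orthogonal to every square-integrable function of y. *)
Lemma posterior_noise i (h : T -> R) :
  (forall U, measurable U -> <<s boxes y >> (h @^-1` U)) -> sqint P h ->
  \int[P]_w ((y w i 0 - mu w i 0) * h w) =
  \int[P]_w (d 0 i / (d 0 i + lam) * (y w i 0 - a i 0) * h w).
Proof.
move=> sh qh; have o := orthogonal_sigma_boxes ry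
  (sqint_integrable (sqint_resid i)) (resid_box i) sh (sqint_mul (sqint_resid i) qh).
have q1 : sqint P (fun w => d 0 i / (d 0 i + lam) * (y w i 0 - a i 0)).
  by apply: sqintZ; apply: sqintB; [exact: sqint_obs|exact: sqint_cst].
rewrite -[RHS]subr0 -o -RintegralB//; [|exact: sqint_mul|exact: sqint_mul].
apply: eq_Rintegral => w _; rewrite -mulrBl /resid /pm /post_mean; congr (_ * _).
by field; rewrite gt_eqF.
Qed.

End model.

(** * The variance estimator *)

Section lambda_hat.
Context {R : realType} {k p : nat}.
Variables (d : 'rV[R]_k) (X : 'M[R]_(k, p)) (c : R).
Hypothesis d0 : forall i, 0 < d 0 i.
Hypothesis rX : \rank X = p.
Hypotheses (c0 : 0 < c) (hc : forall i, c <= d 0 i).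

Local Notation A := (Amx d X).
Local Notation kappa := (lambda_hat d X).
Implicit Types (s t : R) (y : 'cV[R]_k).

Definition rss s y : R := dot y (A s *m y).

Lemma rssB s t y : 0 <= s -> 0 <= t ->
  rss s y - rss t y = (t - s) * dot (A s *m y) (A t *m y).
Proof.
move=> s0 t0; rewrite /rss -dotBr -(mulmxBl (A s) (A t)) (Amx_resolvent d0 rX)//.
by rewrite -scalemxAl dotZr sym_dot ?tr_Amx// mulmxA.
Qed.

(** By the resolvent identity A(s) - A(t) is a nonnegative multiple of A(s) A(t). *)
Lemma dot_AA_lower s t y : 0 <= s -> s <= t ->
  dot (A t *m y) (A t *m y) <= dot (A s *m y) (A t *m y).
Proof.
move=> s0 st; have t0 := le_trans s0 st.
have e : A s *m y = A t *m y + (t - s) *: (A s *m (A t *m y)).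
  rewrite mulmxA scalemxAl -(Amx_resolvent d0 rX)// (mulmxBl (A s) (A t)).
  by rewrite addrC subrK.
rewrite e dotDl dotZl lerDl mulr_ge0 ?subr_ge0// dotC.
by have [_] := psd_Amx d0 rX s0; exact.
Qed.

Lemma rss_le s y : 0 <= s -> rss s y <= dot y y / (c + s).
Proof.
move=> s0; rewrite (le_trans (ler_norm _))// (le_trans (dot_le_vn _ _))//.
rewrite -vn_sqr expr2 -mulrA ler_wpM2l ?vn_ge0//.
exact: vn_Amx_le_s.
Qed.

Lemma dot_AA_le s t y x : 0 <= s -> 0 <= t ->
  `|dot (A s *m y) (A t *m x)| <= vn y * vn x / c ^+ 2.
Proof.
move=> s0 t0; rewrite (le_trans (dot_le_vn _ _))//.
rewrite expr2 invfM mulrACA ler_pM ?vn_ge0//; exact: vn_Amx_le.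
Qed.

Lemma lipschitz_continuous (f : R -> R) (L : R) :
  (forall s t, `|f s - f t| <= L * `|s - t|) -> continuous f.
Proof.
move=> hL x; apply/cvgrPdist_le => e e0.
have L0 : 0 <= `|L| + 1 by rewrite addr_ge0.
have L1 : 0 < `|L| + 1 by rewrite ltr_wpDl.
near=> z; rewrite (le_trans (hL x z))//.
rewrite (@le_trans _ _ ((`|L| + 1) * `|x - z|))//.
  by rewrite ler_wpM2r// (le_trans (ler_norm _))// lerDl.
rewrite -ler_pdivlMl// mulrC; near: z.
apply: cvgr_dist_le; first exact: cvg_id.
by rewrite divr_gt0.
Unshelve. all: by end_near. Qed.

Lemma max0_lip s t : `|Num.max s 0 - Num.max t 0| <= `|s - t|.
Proof.
by case: (leP s 0); case: (leP t 0) => ? ?; rewrite ler_norml; apply/andP; split;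
  have := ler_norm (s - t); have := ler_norm (- (s - t)); rewrite normrN; lra.
Qed.

Let mx0 s : 0 <= Num.max s 0. Proof. by rewrite le_max lexx orbT. Qed.

(** Extending the parametrization by a constant to the negative half-line makes
the entries Lipschitz on the whole line, hence continuous and measurable. *)
Lemma continuous_form x y : continuous (fun s => dot x (A (Num.max s 0) *m y)).
Proof.
apply: (@lipschitz_continuous _ (vn x * vn y / c ^+ 2)) => s t.
rewrite -dotBr -(mulmxBl (A _) (A _)) (Amx_resolvent d0 rX)// -scalemxAl dotZr normrM mulrC.
rewrite -mulmxA -(sym_dot _ _ (tr_Amx X d0 (mx0 s))).
apply: ler_pM => //; first exact: dot_AA_le.
by rewrite (le_trans (max0_lip t s))// distrC.
Qed.

(** The residual form is continuous and tends to 0 as the variance grows. *)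
Lemma rss_above_root (N s : R) y : 0 < N -> 0 <= s -> N < rss s y ->
  exists2 t, s < t & rss t y = N.
Proof.
move=> N0 s0 Ns; pose b := dot y y / N.
have b0 : 0 <= b by rewrite divr_ge0 ?dot_ge0// ltW.
have fb t : b <= t -> rss t y < N.
  move=> bt; have t0 := le_trans b0 bt.
  rewrite (le_lt_trans (rss_le y t0))// ltr_pdivrMr ?ltr_wpDr//.
  rewrite mulrDr ltr_pwDl ?mulr_gt0//.
  by rewrite mulrC -ler_pdivrMr.
have sb : s <= b.
  by rewrite leNgt; apply/negP => /ltW /fb; rewrite ltNge ltW.
pose g t := dot y (A (Num.max t 0) *m y).
have gE t : 0 <= t -> g t = rss t y by move=> t0; rewrite /g max_l.
have [||t] := @IVT R g s b N sb.
- by apply: continuous_subspaceT; exact: continuous_form.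
- rewrite !gE// ge_min le_max (ltW Ns) orTb andbT (ltW (fb b _))// orbT.
  by [].
rewrite in_itv /= => /andP[st tb]; rewrite gE ?(le_trans s0)// => tN.
exists t => //; rewrite lt_neqAle st andbT; apply: contraTneq Ns => ->.
by rewrite tN ltxx.
Qed.

Lemma lambda_hat_ge0 y : 0 <= kappa y.
Proof. by rewrite /lambda_hat; case: xgetP => // x _ [/ltW]. Qed.

Hypothesis pk : (p < k)%N.
Local Notation N := (k%:R - p%:R).

Lemma df_gt0 : 0 < N :> R.
Proof. by rewrite subr_gt0 ltr_nat. Qed.

Lemma lambda_hat_pos y : 0 < kappa y -> rss (kappa y) y = N.
Proof.
rewrite /lambda_hat; case: xgetP => [x _ [x0]|]; last by rewrite ltxx.
by rewrite qformE.
Qed.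

Lemma lambda_hat_eq0 y s : kappa y = 0 -> 0 <= s -> rss s y <= N.
Proof.
move=> k0 s0; rewrite leNgt; apply/negP => Ns.
have [t st tN] := rss_above_root df_gt0 s0 Ns.
have t0 : 0 < t by exact: le_lt_trans st.
have : 0 < kappa y.
  rewrite /lambda_hat; set S := [set _ | _].
  by have [] : S (xget 0 S) by apply: xgetPex; exists t; split => //; rewrite qformE.
by rewrite k0 ltxx.
Qed.

Lemma dot_AA_pos s t y : 0 <= s -> 0 <= t -> rss t y = N ->
  s <= t -> 0 < dot (A s *m y) (A t *m y).
Proof.
move=> s0 t0 tN st.
apply: lt_le_trans (dot_AA_lower _ s0 st).
rewrite lt0r dot_ge0 andbT; apply/eqP => /dot_eq0 At0.
by have := df_gt0; rewrite -tN /rss At0 dot0r ltxx.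
Qed.

(** The residual form decreases strictly wherever it takes the value k - p, so
that events about the estimator are events about the residual form. *)
Lemma lambda_hat_gt r y : 0 <= r -> (r < kappa y) = (N < rss r y).
Proof.
move=> r0; apply/idP/idP => [rk|Nr].
  have kp : 0 < kappa y by exact: le_lt_trans rk.
  have kN := lambda_hat_pos kp.
  rewrite -kN -subr_gt0 rssB ?lambda_hat_ge0// mulr_gt0 ?subr_gt0//.
  by apply: dot_AA_pos => //; [exact: ltW|exact: ltW].
rewrite ltNge; apply/negP => kr.
have [k0|kn0] := eqVneq (kappa y) 0.
  by have := lambda_hat_eq0 k0 r0; rewrite leNgt Nr.
have kp : 0 < kappa y by rewrite lt0r kn0 lambda_hat_ge0.
have kN := lambda_hat_pos kp.
have : rss r y <= N.
  rewrite -kN -subr_ge0 rssB ?lambda_hat_ge0// mulr_ge0 ?subr_ge0//.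
  apply: le_trans (dot_AA_lower _ (lambda_hat_ge0 y) kr).
  exact: dot_ge0.
by rewrite leNgt Nr.
Qed.

End lambda_hat.

Section lambda_hat_measurable.
Context {R : realType} {k p : nat}.
Variables (d : 'rV[R]_k) (X : 'M[R]_(k, p)) (c : R).
Hypothesis d0 : forall i, 0 < d 0 i.
Hypothesis rX : \rank X = p.
Hypotheses (c0 : 0 < c) (hc : forall i, c <= d 0 i).
Hypothesis pk : (p <= k)%N.
Context {disp : measure_display} {T : measurableType disp} (y : T -> 'cV[R]_k).
Hypothesis ry : random_vector y.

Local Notation A := (Amx d X).
Local Notation kappa := (lambda_hat d X).

Lemma measurable_mxv n (B : 'M[R]_(n, k)) i :
  measurable_fun setT (fun w => (B *m y w) i 0).
Proof.
under eq_fun do rewrite mxE; apply: measurable_sum => j.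
by apply: measurable_funM.
Qed.

Lemma measurable_lambda_hat : (p < k)%N -> measurable_fun setT (fun w => kappa (y w)).
Proof.
move=> pk'; apply: (measurability _ (RGenOInfty.measurableE R)) => //.
move=> _ [_ [r ->] <-]; rewrite setTI.
rewrite (_ : _ @^-1` _ = [set w | r < kappa (y w)]); last first.
  by apply/seteqP; split=> w /=; rewrite in_itv /= andbT.
have [r0|r0] := leP 0 r; last first.
  rewrite (_ : [set w | _] = setT)//; apply/seteqP; split => // w _ /=.
  by rewrite (lt_le_trans r0)// lambda_hat_ge0.
rewrite (_ : [set w | _] = (fun w => rss d X r (y w)) @^-1` `]k%:R - p%:R, +oo[); last first.
  by apply/seteqP; split=> w /=; rewrite in_itv /= andbT (lambda_hat_gt d0 rX c0 hc pk').
have mr : measurable_fun setT (fun w => rss d X r (y w)).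
  rewrite /rss; under eq_fun do rewrite dotE.
  apply: measurable_sum => i; apply: measurable_funM; first exact: ry.
  exact: measurable_mxv.
by rewrite -[X in measurable X]setTI; exact: mr.
Qed.

Lemma measurable_EB_direction i :
  measurable_fun setT (fun w => (A (kappa (y w)) *m y w) i 0).
Proof.
(* A square design of full rank leaves no residuals: A = 0. *)
have [pk'|kp] := ltnP p k; last first.
  have A0 s : 0 <= s -> A s = 0.
    move=> s0; apply/eqP.
    have rf : row_free X by rewrite /row_free rX eqn_leq pk kp.
    by rewrite -(mulmx_free_eq0 _ rf) AmxX.
  under eq_fun do rewrite A0 ?lambda_hat_ge0// mul0mx mxE.
  exact: measurable_cst.
under eq_fun do rewrite mxE; apply: measurable_sum => j.
apply: measurable_funM; last exact: ry.
have e w : A (kappa (y w)) i j =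
    dot (delta_mx i 0) (A (Num.max (kappa (y w)) 0) *m delta_mx j 0).
  rewrite max_l ?lambda_hat_ge0// -colE dotE (bigD1 i)//= big1 => [|l li].
    by rewrite !mxE !eqxx mul1r addr0.
  by rewrite mxE (negPf li) mul0r.
under eq_fun do rewrite e.
have h := continuous_measurable_fun 
  (@continuous_form _ _ _ d X c d0 rX c0 hc (delta_mx i 0) (delta_mx j 0)).
exact: (measurableT_comp h (measurable_lambda_hat pk')).
Qed.

End lambda_hat_measurable.

(** * The exact risk difference *)

Section vsqint.
Context {R : realType} {disp : measure_display} {T : measurableType disp}.
Variable P : probability T R.

Definition vsqint n (f : T -> 'cV[R]_n) : Prop := forall i, sqint P (fun w => f w i 0).

Lemma vsqintD n (f g : T -> 'cV[R]_n) : vsqint f -> vsqint g ->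
  vsqint (fun w => f w + g w).
Proof. by move=> hf hg i; under eq_fun do rewrite mxE; exact: sqintD. Qed.

Lemma vsqintB n (f g : T -> 'cV[R]_n) : vsqint f -> vsqint g ->
  vsqint (fun w => f w - g w).
Proof. by move=> hf hg i; under eq_fun do rewrite !mxE; exact: sqintB. Qed.

Lemma vsqint_cst n (a : 'cV[R]_n) : vsqint (fun=> a).
Proof. by move=> i; exact: sqint_cst. Qed.

Lemma vsqint_mul n q (B : 'M[R]_(q, n)) (f : T -> 'cV[R]_n) : vsqint f ->
  vsqint (fun w => B *m f w).
Proof.
move=> hf i; under eq_fun do rewrite mxE; apply: sqint_sum => j.
exact: sqintZ.
Qed.

Lemma integrable_dot n (f g : T -> 'cV[R]_n) : vsqint f -> vsqint g ->
  P.-integrable setT (EFin \o (fun w => dot (f w) (g w))).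
Proof.
move=> hf hg.
rewrite (_ : (fun w => dot (f w) (g w)) = (fun w => \sum_i f w i 0 * g w i 0)).
  by apply: integrable_sumR => i _; exact: sqint_mul.
by apply/funext => w; rewrite dotE.
Qed.

Lemma Rintegral_dot n (f g : T -> 'cV[R]_n) : vsqint f -> vsqint g ->
  \int[P]_w dot (f w) (g w) = \sum_i \int[P]_w (f w i 0 * g w i 0).
Proof.
move=> hf hg; under eq_Rintegral do rewrite dotE.
by apply: Rintegral_sum => i _; exact: sqint_mul.
Qed.

Lemma Lfun2_sqint (f : T -> R) : f \in Lfun P 2%:E -> sqint P f.
Proof.
move=> h; split; last exact: Lfun2_integrable_sqr.
by move: h => /sub_Lfun_mfun; rewrite inE.
Qed.

End vsqint.

Section risk.
Context {R : realType} {disp : measure_display} {T : measurableType disp}.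
Context (P : probability T R) {k p m : nat} (y mu : T -> 'cV[R]_k).
Variables (d : 'rV[R]_k) (X : 'M[R]_(k, p)) (Q : 'M[R]_k) (W : 'M[R]_(k, m)).
Variables (t : 'cV[R]_k -> 'cV[R]_m) (a : 'cV[R]_k) (lam c : R).
Hypotheses (lam0 : 0 < lam) (c0 : 0 < c) (hc : forall i, c <= d 0 i).
Hypotheses (rX : \rank X = p) (rW : \rank W = m) (pQ : posdef Q) (pk : (p <= k)%N).
Hypothesis mu_law : normal_vector P mu a (const_mx lam).
Hypothesis y_cond : cond_normal_vector P y mu d.
Hypothesis t_L2 : forall j : 'I_m, (fun w => t (y w) j 0) \in Lfun P 2%:E.

Let d0 i : 0 < d 0 i. Proof. exact: lt_le_trans (hc i). Qed.

(** The empirical Bayes estimator is y - D g for this g. *)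
Definition direction (v : 'cV[R]_k) : 'cV[R]_k := Amx d X (lambda_hat d X v) *m v.

Let vy : vsqint P y. Proof. by move=> i; exact: sqint_obs lam0 d0 mu_law y_cond i. Qed.
Let vmu : vsqint P mu. Proof. by move=> i; exact: sqint_latent lam0 mu_law i. Qed.
Let vt : vsqint P (fun w => t (y w)). Proof. by move=> j; exact: Lfun2_sqint. Qed.

Let vg : vsqint P (fun w => direction (y w)).
Proof.
move=> i.
have vs : sqint P (fun w => c^-1 * \sum_j `|y w j 0|).
  apply: sqintZ; apply: sqint_sum => j.
  apply: sqint_le (vy j); last by move=> w; rewrite normr_id.
  by apply: measurableT_comp => //; exact: y_cond.1.
apply: sqint_le vs; first exact: (measurable_EB_direction d0 rX c0 hc pk y_cond.1).
move=> w; rewrite [leRHS]ger0_norm; last first.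
  by rewrite mulr_ge0 ?invr_ge0 ?(ltW c0)// sumr_ge0.
rewrite (le_trans (coord_le_vn _ _))// (le_trans (vn_Amx_le d0 rX c0 hc _ _))//.
  exact: lambda_hat_ge0.
by rewrite mulrC ler_wpM2l ?invr_ge0 ?(ltW c0)// vn_le_sum.
Qed.

Let errCM w : 'cV[R]_k := mu_CM Q W t (y w) - mu w.
Let errCEB w : 'cV[R]_k := mu_CEB d X Q W t (y w) - mu w.

Let vCM : vsqint P errCM.
Proof.
apply: vsqintB vmu; apply: vsqintD vy _; apply: vsqint_mul.
by apply: vsqintB vt _; exact: vsqint_mul.
Qed.

Let CEB_E w : mu_CEB d X Q W t (y w) =
  (1%:M - PWmx Q W) *m (y w - Dmx d *m direction (y w)) + Gmx Q W *m t (y w).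
Proof. by rewrite /mu_CEB /mu_EB /direction mulmxA. Qed.

Let vCEB : vsqint P errCEB.
Proof.
rewrite /errCEB; under eq_fun do rewrite CEB_E.
apply: vsqintB vmu; apply: vsqintD; last exact: vsqint_mul.
by apply: vsqint_mul; apply: vsqintB vy _; exact: vsqint_mul.
Qed.

Let iq (f : T -> 'cV[R]_k) : vsqint P f ->
  P.-integrable setT (EFin \o (fun w => qform Q (f w))).
Proof.
move=> vf; under eq_fun do rewrite qformE.
by apply: integrable_dot => //; exact: vsqint_mul.
Qed.

Lemma risk_CM_fin_num : risk P Q y mu (mu_CM Q W t) \is a fin_num.
Proof.
rewrite /risk unlock; exact: (integrable_fin_num measurableT (iq vCM)).
Qed.

Lemma risk_CEB_fin_num : risk P Q y mu (mu_CEB d X Q W t) \is a fin_num.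
Proof.
rewrite /risk unlock; exact: (integrable_fin_num measurableT (iq vCEB)).
Qed.

Let direction_sigma i (U : set R) : measurable U ->
  <<s boxes y >> ((fun w => (QWmx Q W *m Dmx d *m direction (y w)) i 0) @^-1` U).
Proof.
move=> mU.
pose T' := g_sigma_algebraType (boxes y).
have ry' : @random_vector _ T' R k y.
  move=> j _ V mV; rewrite setTI; apply: sub_sigma_algebra.
  exact: coord_sigma_boxes.
have mdir : @random_vector _ T' R k (fun w => direction (y w)).
  by move=> j; exact: (measurable_EB_direction d0 rX c0 hc pk ry').
have := @measurable_mxv R k _ T' (fun w => direction (y w)) mdir _ (QWmx Q W *m Dmx d) i.
by move=> /(_ measurableT U mU); rewrite setTI.
Qed.

Lemma loss_integrable : P.-integrable setT (EFin \o (fun w =>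
  dot (direction (y w)) (Mmx d Q W *m direction (y w))
  - 2 * dot (diag_mx (precision d lam) *m (y w - a)) (Mmx d Q W *m direction (y w)))).
Proof.
have vMg : vsqint P (fun w => Mmx d Q W *m direction (y w)) by exact: vsqint_mul.
have vz : vsqint P (fun w => y w - a) by apply: vsqintB vy _; exact: vsqint_cst.
have vVz : vsqint P (fun w => diag_mx (precision d lam) *m (y w - a)) by exact: vsqint_mul.
have i1 := integrable_dot vg vMg; have i2 := integrable_dot vVz vMg.
exact: (integrableBR i1 (integrableZR 2 i2)).
Qed.

(** Averaging the loss difference over the posterior law replaces y - mu by its
posterior mean, a shrunken multiple of y - E y. *)
Lemma Delta_U_eq : Delta_U P d X Q W t y mu =
  \int[P]_w (dot (direction (y w)) (Mmx d Q W *m direction (y w))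
    - 2 * dot (diag_mx (precision d lam) *m (y w - a)) (Mmx d Q W *m direction (y w))).
Proof.
pose h w := QWmx Q W *m Dmx d *m direction (y w).
have vh : vsqint P h by exact: vsqint_mul.
have vr : vsqint P (fun w => y w - mu w) by exact: vsqintB.
have vz : vsqint P (fun w => y w - a) by apply: vsqintB vy _; exact: vsqint_cst.
have iMg : P.-integrable setT (EFin \o (fun w =>
    dot (direction (y w)) (Mmx d Q W *m direction (y w)))).
  by apply: integrable_dot => //; exact: vsqint_mul.
have vMg : vsqint P (fun w => Mmx d Q W *m direction (y w)) by exact: vsqint_mul.
have vVz : vsqint P (fun w => diag_mx (precision d lam) *m (y w - a)) by exact: vsqint_mul.
have cross : \int[P]_w dot (y w - mu w) (h w) =
    \int[P]_w dot (diag_mx (precision d lam) *m (y w - a)) (Mmx d Q W *m direction (y w)).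
  transitivity (\int[P]_w dot (diag_mx (\row_i (d 0 i / (d 0 i + lam))) *m (y w - a)) (h w)).
    rewrite !Rintegral_dot//; last exact: vsqint_mul.
    apply: eq_bigr => i _.
    have e := @posterior_noise _ _ _ P k y mu a lam d lam0 d0 mu_law y_cond i _
      (direction_sigma i) (vh i).
    transitivity (\int[P]_w ((y w i 0 - mu w i 0) * h w i 0)).
      by apply: eq_Rintegral => w _; rewrite [(y w - mu w) i 0]mxE [(- mu w) i 0]mxE.
    apply: (etrans e); apply: eq_Rintegral => w _; congr (_ * _).
    by rewrite mul_diag_mx !mxE.
  apply: eq_Rintegral => w _.
  have -> : Mmx d Q W *m direction (y w) = Dmx d *m h w by rewrite /Mmx /h !mulmxA.
  rewrite [in RHS]dot_mxr tr_diag_mx mulmxA mulmx_diag; congr (dot (diag_mx _ *m _) _).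
  by apply/rowP => i; rewrite !mxE.
rewrite /Delta_U /risk unlock.
rewrite fineB; last 2 first.
- exact: (integrable_fin_num measurableT (iq vCEB)).
- exact: (integrable_fin_num measurableT (iq vCM)).
transitivity (\int[P]_w qform Q (errCEB w) - \int[P]_w qform Q (errCM w)); first by [].
rewrite -RintegralB//; [|exact: iq|exact: iq].
rewrite [RHS]RintegralB//; last by apply: integrableZR; exact: integrable_dot.
rewrite RintegralZl//; last exact: integrable_dot.
rewrite -cross -RintegralZl//; last exact: integrable_dot.
rewrite -RintegralB//; last by apply: integrableZR; exact: integrable_dot.
apply: eq_Rintegral => w _; rewrite /errCEB /errCM CEB_E.
rewrite [X in X - _](_ : _ = qform Q ((1%:M - PWmx Q W) *m
   (y w - Dmx d *m direction (y w)) + Gmx Q W *m t (y w) - mu w))//.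
by rewrite /mu_CM (loss_difference pQ rW) ?tr_Dmx.
Qed.

End risk.

(** * Deterministic expansion of the loss difference *)

Section expansion.
Context {R : realType} {k p : nat}.
Variables (d : 'rV[R]_k) (X : 'M[R]_(k, p)) (c lam : R).
Hypotheses (c0 : 0 < c) (hc : forall i, c <= d 0 i).
Hypotheses (rX : \rank X = p) (lam0 : 0 < lam).

Let d0 i : 0 < d 0 i. Proof. exact: lt_le_trans (hc i). Qed.
Let l0 : 0 <= lam. Proof. exact: ltW. Qed.

Local Notation A := (Amx d X).
Local Notation kappa := (lambda_hat d X).
Local Notation H := (Hmx d X lam).
Local Notation Vi := (diag_mx (precision d lam)).

Lemma Amx_shift s (z : 'cV[R]_k) (b : 'cV[R]_p) : 0 <= s -> A s *m (z + X *m b) = A s *m z.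
Proof. by move=> s0; rewrite mulmxDr mulmxA AmxX// mul0mx addr0. Qed.

Lemma qform_shift s (z : 'cV[R]_k) (b : 'cV[R]_p) : 0 <= s ->
  qform (A s) (z + X *m b) = qform (A s) z.
Proof.
move=> s0; rewrite !qformE Amx_shift// dotDl -(sym_dot (X *m b) z (tr_Amx X d0 s0)).
by rewrite mulmxA AmxX// mul0mx dot0l addr0.
Qed.

Lemma lambda_hat_shift (z : 'cV[R]_k) (b : 'cV[R]_p) : kappa (z + X *m b) = kappa z.
Proof.
rewrite /lambda_hat; congr (xget 0 _); apply/seteqP.
by split=> s /= [s0 <-]; split=> //; rewrite qform_shift// ltW.
Qed.

Lemma direction_shift (z : 'cV[R]_k) (b : 'cV[R]_p) :
  direction d X (z + X *m b) = direction d X z.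
Proof. by rewrite /direction lambda_hat_shift Amx_shift// lambda_hat_ge0. Qed.

Variable z : 'cV[R]_k.
Local Notation kz := (kappa z).
Local Notation N := (k%:R - p%:R : R).
Let delta : R := kz - lam.
Let xi : R := rss d X lam z - N.
Let kz0 : 0 <= kz. Proof. exact: lambda_hat_ge0. Qed.

Let cross : R := dot (A lam *m z) (A kz *m z).

Let rss_cross : rss d X lam z - rss d X kz z = delta * cross.
Proof. exact: rssB. Qed.

Let rss_CS s : 0 <= s -> rss d X s z ^+ 2 <= dot z z * dot (A s *m z) (A s *m z).
Proof.
move=> s0; have := psd_CS z (A s *m z) (psd1 k); by rewrite !mul1mx.
Qed.

Hypothesis pk : (p < k)%N.
Let N0 : 0 < N. Proof. exact: df_gt0. Qed.

Let xi_cross : 0 < kz -> xi = delta * cross.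
Proof. by move=> h; rewrite -rss_cross (lambda_hat_pos h). Qed.

(** By Cauchy-Schwarz the form of A(s)^2 is at least the square of the residual
form at s divided by |z|^2, and it bounds cross from below when s is the larger
of lam and kappa. At kappa > 0 the residual form is N; at lam it is at least
N / 2 unless |xi| > N / 2, in which case |delta| <= lam is enough. *)
Lemma delta_bound :
  `|delta| <= `|xi| * (4 * dot z z / N ^+ 2 + 2 * lam / N).
Proof.
have zz := dot_ge0 z.
have t1 : 0 <= 4 * dot z z / N ^+ 2 by apply: divr_ge0; [exact: mulr_ge0|exact: exprn_ge0 (ltW N0)].
have t2 : 0 <= 2 * lam / N by apply: divr_ge0; [apply: mulr_ge0|]; rewrite ?ltW.
have N2 : 0 < N ^+ 2 by rewrite exprn_gt0.
have [lk|kl] := leP lam kz.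
  have kpos : 0 < kz by exact: lt_le_trans lk.
  have del0 : 0 <= delta by rewrite subr_ge0.
  have h1 : N ^+ 2 <= dot z z * cross.
    rewrite -(lambda_hat_pos kpos) (le_trans (rss_CS kz0))// ler_wpM2l//.
    exact: dot_AA_lower.
  have h2 : delta * N ^+ 2 <= xi * dot z z.
    by rewrite (xi_cross kpos) -mulrA (mulrC cross) ler_wpM2l.
  have xi0 : 0 <= xi * dot z z by apply: le_trans h2; rewrite mulr_ge0// ltW.
  rewrite ger0_norm// (@le_trans _ _ (`|xi| * (4 * dot z z / N ^+ 2)))//; last first.
    by rewrite ler_wpM2l// lerDl.
  rewrite mulrA ler_pdivlMr// (le_trans h2)// mulrCA.
  rewrite (@le_trans _ _ (`|xi| * dot z z))//; first by rewrite ler_wpM2r// ler_norm.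
  by rewrite ler_peMl ?mulr_ge0// ler1n.
have del0 : delta <= 0 by rewrite subr_le0 ltW.
have dl : `|delta| <= lam by rewrite ler0_norm// opprB gerBl.
have w0 : dot (A lam *m z) (A lam *m z) <= cross.
  by rewrite /cross dotC; apply: dot_AA_lower => //; exact: ltW.
have cr0 : 0 <= cross by apply: le_trans w0; exact: dot_ge0.
have h1 : `|delta| * cross <= `|xi|.
  have [kp|] := ltP 0 kz; first by rewrite (xi_cross kp) normrM (ger0_norm cr0).
  move=> k0; have kE : kz = 0 by apply/eqP; rewrite eq_le k0 kz0.
  have r0 := lambda_hat_eq0 d0 rX c0 hc pk kE (lexx 0).
  have h : xi <= delta * cross.
    by rewrite -rss_cross /xi lerD2l lerN2 kE.
  have dc : delta * cross <= 0 by rewrite mulr_le0_ge0.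
  rewrite ler0_norm// mulNr -(lerN2 `|xi|) opprK.
  by rewrite (le_trans _ h)// ler0_norm ?opprK// (le_trans h).
have [xs|xl] := leP `|xi| (N / 2).
  have h2 : N / 2 <= rss d X lam z.
    move: xs; rewrite ler_norml => /andP[xs _]; rewrite /xi in xs.
    by move: xs; move: (rss _ _ _ _) N0 => r; lra.
  have h3 : N ^+ 2 / 4 <= dot z z * cross.
    apply: le_trans (ler_wpM2l zz w0); apply: le_trans (rss_CS l0).
    have -> : N ^+ 2 / 4 = (N / 2) ^+ 2 by field.
    by apply: lerXn2r; rewrite ?nnegrE ?(le_trans _ h2)//; apply: divr_ge0 => //; exact: ltW.
  rewrite (@le_trans _ _ (`|xi| * (4 * dot z z / N ^+ 2)))//; last first.
    by rewrite ler_wpM2l// lerDl.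
  rewrite mulrA ler_pdivlMr//.
  have h4 : `|delta| * (N ^+ 2 / 4) <= dot z z * `|xi|.
    rewrite (le_trans (ler_wpM2l (normr_ge0 _) h3))// mulrCA.
    by rewrite ler_wpM2l.
  by move: h4; move: `|delta| (N ^+ 2) (dot z z) `|xi| => x1 x2 x3 x4; lra.
rewrite (le_trans dl)// (@le_trans _ _ (`|xi| * (2 * lam / N)))//; last first.
  by rewrite ler_wpM2l// lerDr.
have -> : `|xi| * (2 * lam / N) = lam * (2 * `|xi| / N) by ring.
apply: ler_peMr; first exact: ltW.
rewrite ler_pdivlMr// mul1r.
by move: xl; move: `|xi| N0 => x; lra.
Qed.

Implicit Types (x : 'cV[R]_k) (s t e : R).

Let direction_step x : A kz *m x = A lam *m x - delta *: (A kz *m (A lam *m x)).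
Proof.
rewrite mulmxA scalemxAl -mulNmx -scaleNr opprB -(Amx_resolvent d0 rX)//.
by rewrite (mulmxBl (A kz) (A lam)) addrC subrK.
Qed.

Let vnA s x : 0 <= s -> vn (A s *m x) <= vn x / c.
Proof. by move=> s0; exact: vn_Amx_le. Qed.

Let vnAA s t x : 0 <= s -> 0 <= t -> vn (A s *m (A t *m x)) <= vn x / c ^+ 2.
Proof.
move=> s0 t0; rewrite expr2 invfM mulrA (le_trans (vnA _ s0))//.
by rewrite ler_wpM2r ?invr_ge0 ?(ltW c0)// vnA.
Qed.

(** A Newton step: xi is delta times the derivative of the residual sum of
squares, up to a quadratic error. When the estimate is truncated at zero,
|delta| = lam turns the trivial bound on xi into one of second order. *)
Lemma newton_step (tau : R) : 0 <= tau ->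
  `|xi - delta * tau| <= `|delta| * `|dot (A lam *m z) (A lam *m z) - tau|
    + delta ^+ 2 * (dot z z / c ^+ 3) + (`|xi| * `|delta| + delta ^+ 2 * tau) / lam.
Proof.
move=> tau0; set eta := _ - tau.
have r0 : 0 <= delta ^+ 2 * (dot z z / c ^+ 3).
  by rewrite mulr_ge0 ?sqr_ge0// divr_ge0 ?dot_ge0// exprn_ge0// ltW.
have r1 : 0 <= `|delta| * `|eta| by rewrite mulr_ge0.
have [kp|] := ltP 0 kz.
  have r2 : 0 <= (`|xi| * `|delta| + delta ^+ 2 * tau) / lam.
    by apply: divr_ge0 => //; apply: addr_ge0; apply: mulr_ge0 => //; exact: sqr_ge0.
  have -> : xi - delta * tau = delta * eta
      - delta ^+ 2 * dot (A lam *m z) (A kz *m (A lam *m z)).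
    by rewrite (xi_cross kp) /cross direction_step dotBr dotZr /eta; ring.
  rewrite (le_trans (ler_normB _ _))// -[leLHS]addr0 lerD//; apply: lerD; first by rewrite normrM.
  rewrite normrM (ger0_norm (sqr_ge0 delta)) ler_wpM2l ?sqr_ge0//.
  rewrite (le_trans (dot_le_vn _ _))// -vn_sqr.
  have -> : vn z ^+ 2 / c ^+ 3 = (vn z / c) * (vn z / c ^+ 2).
    by field; rewrite gt_eqF.
  by apply: ler_pM; rewrite ?vn_ge0//; [exact: vnA|exact: vnAA].
move=> k0; have kE : kz = 0 by apply/eqP; rewrite eq_le k0 kz0.
have dE : `|delta| = lam by rewrite /delta kE sub0r normrN gtr0_norm.
have -> : (`|xi| * `|delta| + delta ^+ 2 * tau) / lam = `|xi| + lam * tau.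
  rewrite -[delta ^+ 2]real_normK ?num_real// dE expr2.
  by field; rewrite gt_eqF.
rewrite -[leLHS]add0r lerD ?addr_ge0// (le_trans (ler_normB _ _))//.
by rewrite normrM dE (ger0_norm tau0).
Qed.

Lemma Amx_vi x : A lam *m x = Vi *m x - H *m x.
Proof. by rewrite (AmxE X d0 l0) (mulmxBl Vi H). Qed.

(** The main parts of xi and of z' A^2 z - tau: centred sums of independent
variables once z is random. Up to its sign and a bounded trace of H, tau is the
mean slope of the residual form at lam. *)
Definition xi0 : R := \sum_i (z i 0 ^+ 2 / (d 0 i + lam) - 1).
Definition eta0 : R := \sum_i (z i 0 ^+ 2 / (d 0 i + lam) - 1) / (d 0 i + lam).
Definition tau : R := \sum_i (d 0 i + lam)^-1.

Lemma xi_xi0 : xi = xi0 + p%:R - dot z (H *m z).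
Proof.
rewrite /xi /rss Amx_vi dotBr dot_diag /xi0 sumrB sumr_const card_ord.
have -> : \sum_i z i 0 ^+ 2 / (d 0 i + lam) = \sum_i precision d lam 0 i * (z i 0 * z i 0).
  by apply: eq_bigr => i _; rewrite mxE; ring.
by ring.
Qed.

Lemma eta_bound : `|dot (A lam *m z) (A lam *m z) - tau| <=
  `|eta0| + 2 * (vn z * vn (H *m z) / c) + vn (H *m z) ^+ 2.
Proof.
have -> : dot (A lam *m z) (A lam *m z) - tau
    = eta0 - 2 * dot (Vi *m z) (H *m z) + vn (H *m z) ^+ 2.
  rewrite vn_sqr Amx_vi dotBl !dotBr (dotC (H *m z)) -/(Vi) /eta0 /tau.
  have -> : \sum_i (z i 0 ^+ 2 / (d 0 i + lam) - 1) / (d 0 i + lam)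
      = dot (Vi *m z) (Vi *m z) - \sum_i (d 0 i + lam)^-1.
    rewrite dotE -sumrB; apply: eq_bigr => i _.
    by rewrite mul_diag_mx !mxE; ring.
  by ring.
rewrite (le_trans (ler_normD _ _))// lerD//; last by rewrite ger0_norm ?sqr_ge0.
rewrite (le_trans (ler_normB _ _))// lerD// normrM ger0_norm// ler_wpM2l//.
rewrite (le_trans (dot_le_vn _ _))// mulrAC ler_wpM2r ?vn_ge0//.
exact: vn_vi_le.
Qed.

Lemma vn_sqr_xi0 C : (forall i, d 0 i + lam <= C) -> dot z z <= C * (k%:R + xi0).
Proof.
move=> hC; rewrite /xi0 sumrB sumr_const card_ord addrC subrK dotE mulr_sumr.
apply: ler_sum => i _; rewrite mulrA ler_pdivlMr ?v_gt0// mulrC -expr2.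
by rewrite ler_wpM2r// sqr_ge0.
Qed.

Lemma hat_sqr_le : c * vn (H *m z) ^+ 2 <= dot z (H *m z).
Proof. by rewrite vn_sqr; exact: qH_ge. Qed.

Lemma hat_form_ge0 : 0 <= dot z (H *m z).
Proof. by apply: le_trans hat_sqr_le; rewrite mulr_ge0 ?sqr_ge0// ltW. Qed.

(** The hat matrix is the Gram matrix of the scores in the metric of the inverse
information, so a lower bound on the information bounds its quadratic form. *)
Lemma hat_form_le e : 0 < e ->
  (forall x : 'cV[R]_p, e * dot x x <= dot x (X^T *m Vi *m X *m x)) ->
  dot z (H *m z) <= vn (X^T *m (Vi *m z)) ^+ 2 / e.
Proof.
move=> e0 he; pose G := X^T *m Vi *m X; pose u := X^T *m (Vi *m z).
have uG : G \in unitmx by exact: gram_unit.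
pose w := invmx G *m u.
have Gw : G *m w = u by rewrite /w mulmxA mulmxV// mul1mx.
have qE : dot z (H *m z) = dot u w.
  by rewrite HmxE /hat -/G /w /u -!mulmxA dot_mxr (tr_vi d lam) dot_mxr.
have h := he w; rewrite -/G Gw dotC in h.
rewrite qE -/u ler_pdivlMr//.
have hu := le_trans (ler_norm _) (dot_le_vn u w).
have q0 : 0 <= dot u w by apply: le_trans h; rewrite mulr_ge0 ?dot_ge0 ?ltW.
have [w0|wn0] := eqVneq (vn w) 0.
  by rewrite w0 mulr0 in hu; rewrite (_ : dot u w = 0) ?mul0r ?sqr_ge0//; apply/eqP; rewrite eq_le hu.
have wp : 0 < vn w by rewrite lt0r wn0 vn_ge0.
rewrite -vn_sqr in h.
have h1 : e * vn w <= vn u.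
  by rewrite -(ler_pM2r wp) -mulrA -expr2 (le_trans h)// .
rewrite (le_trans (ler_wpM2r (ltW e0) hu))// -mulrA expr2 ler_wpM2l ?vn_ge0//.
by rewrite mulrC.
Qed.

Variables (M : 'M[R]_k) (b : R).
Hypotheses (sM : M^T = M) (b0 : 0 <= b).
Hypothesis hM : forall x y, `|dot x (M *m y)| <= b * (vn x * vn y).

Definition loss : R :=
  dot (direction d X z) (M *m direction d X z) - 2 * dot (Vi *m z) (M *m direction d X z).
Definition loss_main : R :=
  dot (A lam *m z) (M *m (A lam *m z)) - 2 * dot (Vi *m z) (M *m (A lam *m z)).
(** What remains to second order of loss - loss_main when e approximates delta. *)
Definition loss_corr (e : R) : R :=
  2 * e * dot (H *m z) (M *m (A lam *m (A lam *m z)))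
  + e ^+ 2 * dot (A lam *m (A lam *m z)) (M *m (A lam *m (A lam *m z))).

(** By the resolvent identity the estimated direction is a - delta f with a = A z
and f = A(kappa) a, and f itself is A a up to order delta. *)
Lemma loss_expansion (e : R) :
  `|loss - loss_main - loss_corr e| <=
    2 * b * delta ^+ 2 * vn (H *m z) * vn z / c ^+ 3
    + 2 * b * `|delta - e| * vn (H *m z) * vn z / c ^+ 2
    + 2 * b * `|delta| ^+ 3 * vn z ^+ 2 / c ^+ 5
    + b * `|delta - e| * (`|delta| + `|e|) * vn z ^+ 2 / c ^+ 4.
Proof.
pose a := A lam *m z; pose f := A kz *m a; pose a2 := A lam *m a.
pose f3 := A kz *m a2; pose h := H *m z.
have gE : direction d X z = a - delta *: f by exact: direction_step.
have fE : f = a2 - delta *: f3 by exact: direction_step.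
have ViE : Vi *m z = a + h by rewrite /a Amx_vi subrK.
have Msym x y : dot x (M *m y) = dot y (M *m x).
  by rewrite -(sym_dot x y sM) dotC.
have -> : loss - loss_main - loss_corr e =
  (- (2 * delta ^+ 2 * dot h (M *m f3)) + 2 * (delta - e) * dot h (M *m a2))
  + (- (delta ^+ 3 * (dot f3 (M *m f) + dot f3 (M *m a2)))
  + (delta - e) * (delta + e) * dot a2 (M *m a2)).
  rewrite /loss /loss_main /loss_corr -/h -/a -/a2 gE ViE fE.
  rewrite !(mulmxBr, dotDl, dotNl, dotBr, =^~ scalemxAr, dotZl, dotZr).
  rewrite (Msym f3 a) (Msym a2 a) (Msym a2 f3).
  by ring.
have nf : vn f <= vn z / c ^+ 2 by exact: vnAA.
have na2 : vn a2 <= vn z / c ^+ 2 by exact: vnAA.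
have nf3 : vn f3 <= vn z / c ^+ 3.
  have -> : vn z / c ^+ 3 = (vn z / c ^+ 2) / c by field; rewrite gt_eqF.
  by apply: le_trans (vnA _ kz0) _; rewrite ler_wpM2r ?invr_ge0 ?(ltW c0).
have bd (s1 : R) x1 x2 (e1 e2 e3 : R) : vn x1 <= e1 -> vn x2 <= e2 ->
    b * `|s1| * (e1 * e2) = e3 -> `|s1 * dot x1 (M *m x2)| <= e3.
  move=> h1 h2 <-; rewrite normrM (mulrC b) -mulrA ler_wpM2l//.
  by rewrite (le_trans (hM _ _))// ler_wpM2l// ler_pM ?vn_ge0.
have cn : c != 0 by rewrite gt_eqF.
have hh := lexx (vn h).
have d2 : `|delta ^+ 2| = delta ^+ 2 by rewrite ger0_norm ?sqr_ge0.
rewrite -[leRHS]addrA (le_trans (ler_normD _ _))//.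
apply: lerD; rewrite (le_trans (ler_normD _ _))//; apply: lerD.
- rewrite normrN; apply: bd hh nf3 _.
  by rewrite normrM d2 normr_nat; field.
- apply: bd hh na2 _.
  by rewrite normrM normr_nat; field.
- rewrite normrN mulrDr (le_trans (ler_normD _ _))//.
  have -> : 2 * b * `|delta| ^+ 3 * vn z ^+ 2 / c ^+ 5 =
    b * `|delta| ^+ 3 * vn z ^+ 2 / c ^+ 5 + b * `|delta| ^+ 3 * vn z ^+ 2 / c ^+ 5 by ring.
  by apply: lerD; [apply: bd nf3 nf _|apply: bd nf3 na2 _]; rewrite normrX; field.
- rewrite (le_trans (_ : _ <= b * `|(delta - e) * (delta + e)| * (vn z / c ^+ 2 * (vn z / c ^+ 2))))//.
    exact: (bd _ _ _ _ _ _ na2 na2).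
  rewrite normrM.
  have -> : b * `|delta - e| * (`|delta| + `|e|) * vn z ^+ 2 / c ^+ 4 =
    b * (`|delta - e| * (`|delta| + `|e|)) * (vn z / c ^+ 2 * (vn z / c ^+ 2)) by field.
  rewrite ler_wpM2r ?mulr_ge0 ?invr_ge0 ?exprn_ge0 ?vn_ge0 ?(ltW c0)//.
  by rewrite ler_wpM2l// ler_wpM2l// ler_normD.
Qed.

End expansion.

(** * Polynomial growth in a common scale *)

Section growth.
Context {R : realType} {I : Type}.
Variables (dom : I -> Prop) (G : I -> R).
Hypothesis G1 : forall i, dom i -> 1 <= G i.
Implicit Types f g : I -> R.

Definition growth f := exists C n, 0 <= C /\ forall i, dom i -> `|f i| <= C * G i ^+ n.

Let G0 i n : dom i -> 0 <= G i ^+ n.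
Proof. by move=> h; rewrite exprn_ge0// (le_trans _ (G1 h)). Qed.

Let Gmon i m n : dom i -> (m <= n)%N -> G i ^+ m <= G i ^+ n.
Proof. by move=> h mn; rewrite ler_weXn2l// G1. Qed.

Lemma growth_le f g : growth g -> (forall i, dom i -> `|f i| <= `|g i|) -> growth f.
Proof.
move=> [C [n [C0 h]]] fg; exists C, n; split=> // i hi.
exact: le_trans (fg i hi) (h i hi).
Qed.

Lemma growth_cst (a : R) : growth (fun=> a).
Proof. by exists `|a|, 0%N; split=> // i _; rewrite expr0 mulr1. Qed.

Lemma growth_scale : growth G.
Proof.
by exists 1, 1%N; split=> // i h; rewrite expr1 mul1r ger0_norm// (le_trans _ (G1 h)).
Qed.

Lemma growthD f g : growth f -> growth g -> growth (fun i => f i + g i).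
Proof.
move=> [C [m [C0 hf]]] [D [n [D0 hg]]]; exists (C + D), (m + n)%N.
split=> [|i h]; first exact: addr_ge0.
rewrite (le_trans (ler_normD _ _))// mulrDl lerD//.
  by rewrite (le_trans (hf i h))// ler_wpM2l// Gmon// leq_addr.
by rewrite (le_trans (hg i h))// ler_wpM2l// Gmon// leq_addl.
Qed.

Lemma growthM f g : growth f -> growth g -> growth (fun i => f i * g i).
Proof.
move=> [C [m [C0 hf]]] [D [n [D0 hg]]]; exists (C * D), (m + n)%N.
split=> [|i h]; first exact: mulr_ge0.
by rewrite normrM exprD mulrACA ler_pM// ?hf ?hg.
Qed.

Lemma growthN f : growth f -> growth (fun i => - f i).
Proof. by move=> hf; apply: (growth_le hf) => i _; rewrite normrN. Qed.

Lemma growthB f g : growth f -> growth g -> growth (fun i => f i - g i).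
Proof. by move=> hf hg; apply: growthD hf (growthN hg). Qed.

Lemma growth_norm f : growth f -> growth (fun i => `|f i|).
Proof. by move=> hf; apply: (growth_le hf) => i _; rewrite normr_id. Qed.

Lemma growthX f n : growth f -> growth (fun i => f i ^+ n).
Proof.
move=> hf; elim: n => [|n ih]; first exact: growth_cst.
apply: (growth_le (growthM hf ih)) => i _; by rewrite exprS.
Qed.

(** As t <= 1 + t^2. *)
Lemma growth_sqr f : growth (fun i => f i ^+ 2) -> growth f.
Proof.
move=> hf; apply: (growth_le (growthD (growth_cst 1) hf)) => i _.
rewrite [leRHS]ger0_norm ?addr_ge0 ?sqr_ge0//.
rewrite -[f i ^+ 2]real_normK ?num_real//.
by have := sqr_ge0 (`|f i| - 1); move: `|f i| (normr_ge0 (f i)) => x x0; nra.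
Qed.

Variables (c C e lam pp b : R).
Variables (S K N tau xi0 eta0 un zn hn q xi eta delta eps err : I -> R).
Hypotheses (c0 : 0 < c) (C0 : 0 < C) (e0 : 0 < e) (lam0 : 0 < lam).
Hypothesis hS : forall i, dom i -> 1 <= S i.
Hypothesis hK : forall i, dom i -> K i = S i ^+ 2.
Hypothesis hN : forall i, dom i -> K i / 2 <= N i.
Hypothesis tau_ge : forall i, dom i -> K i / C <= tau i.
Hypothesis tau_le : forall i, dom i -> tau i <= K i / c.
Hypothesis hxi0 : forall i, dom i -> `|xi0 i| <= S i * G i.
Hypothesis heta0 : forall i, dom i -> `|eta0 i| <= S i * G i.
Hypothesis hun : forall i, dom i -> `|un i| <= S i * G i.
Hypothesis hq : forall i, dom i -> 0 <= q i <= un i ^+ 2 / (e * K i).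
Hypothesis hhn : forall i, dom i -> c * hn i ^+ 2 <= q i.
Hypothesis hzn : forall i, dom i -> zn i ^+ 2 <= C * (K i + xi0 i).
Hypothesis hxi : forall i, dom i -> xi i = xi0 i + pp - q i.
Hypothesis heta : forall i, dom i ->
  `|eta i| <= `|eta0 i| + 2 * (zn i * hn i / c) + hn i ^+ 2.
Hypothesis hdelta : forall i, dom i ->
  `|delta i| <= `|xi i| * (4 * zn i ^+ 2 / N i ^+ 2 + 2 * lam / N i).
Hypothesis hnewton : forall i, dom i ->
  `|xi i - delta i * tau i| <= `|delta i| * `|eta i| + delta i ^+ 2 * (zn i ^+ 2 / c ^+ 3)
    + (`|xi i| * `|delta i| + delta i ^+ 2 * tau i) / lam.
Hypothesis heps : forall i, dom i -> eps i = xi0 i / tau i.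
Hypothesis herr : forall i, dom i -> `|err i| <=
    2 * b * delta i ^+ 2 * hn i * zn i / c ^+ 3
    + 2 * b * `|delta i - eps i| * hn i * zn i / c ^+ 2
    + 2 * b * `|delta i| ^+ 3 * zn i ^+ 2 / c ^+ 5
    + b * `|delta i - eps i| * (`|delta i| + `|eps i|) * zn i ^+ 2 / c ^+ 4.

Let S0 i : dom i -> 0 < S i. Proof. by move=> /hS; exact: lt_le_trans. Qed.
Let K0 i : dom i -> 0 < K i. Proof. by move=> h; rewrite hK// exprn_gt0// S0. Qed.
Let N0 i : dom i -> 0 < N i.
Proof. by move=> h; apply: lt_le_trans (hN h); rewrite divr_gt0 ?K0. Qed.
Let tau0 i : dom i -> 0 < tau i.
Proof. by move=> h; apply: lt_le_trans (tau_ge h); rewrite divr_gt0 ?K0. Qed.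
Let ratio f g (a : R) : (forall i, dom i -> 0 < f i) -> (forall i, dom i -> 0 < g i) ->
  (forall i, dom i -> f i <= a * g i) -> growth (fun i => f i / g i).
Proof.
move=> f0 g0 fg; apply: (growth_le (growth_cst a)) => i h.
rewrite ger0_norm; last by rewrite divr_ge0// ltW ?f0 ?g0.
by apply: le_trans (ler_norm a); rewrite ler_pdivrMr ?g0// fg.
Qed.

Let scaled f : (forall i, dom i -> `|f i| <= S i * G i) -> growth (fun i => f i / S i).
Proof.
move=> hf; apply: (growth_le growth_scale) => i h.
rewrite normrM normfV (gtr0_norm (S0 h)) ler_pdivrMr ?S0// mulrC.
by rewrite [`|G i|]ger0_norm ?hf// (le_trans _ (G1 h)).
Qed.

Let gq : growth q.
Proof.
apply: (growth_le (growthM (growth_cst e^-1) (growthX 2 (scaled hun)))) => i h.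
have /andP[q0 q1] := hq h; rewrite ger0_norm//; apply: le_trans (ler_norm _).
rewrite (le_trans q1)// hK// le_eqVlt; apply/orP; left; apply/eqP.
by field; rewrite !gt_eqF ?S0.
Qed.

Let ghn : growth hn.
Proof.
apply: growth_sqr; apply: (growth_le (growthM (growth_cst c^-1) gq)) => i h.
have /andP[q0 _] := hq h; rewrite ger0_norm ?sqr_ge0//; apply: le_trans (ler_norm _).
by rewrite mulrC ler_pdivlMr// mulrC hhn.
Qed.

Let gSi : growth (fun i => (S i)^-1).
Proof.
apply: (growth_le (growth_cst 1)) => i h; rewrite normr1 normfV invf_le1 ?normr_gt0 ?gt_eqF ?S0//.
by rewrite (le_trans (hS h))// ler_norm.
Qed.

Let gzn : growth (fun i => zn i / S i).
Proof.
apply: growth_sqr.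
apply: (growth_le (growthM (growth_cst C) (growthD (growth_cst 1)
  (growthM (scaled hxi0) gSi)))) => i h.
rewrite ger0_norm ?sqr_ge0//; apply: le_trans (ler_norm _).
rewrite expr_div_n ler_pdivrMr ?exprn_gt0 ?S0//.
rewrite (le_trans (hzn h))// hK// le_eqVlt; apply/orP; left; apply/eqP.
by field; rewrite gt_eqF ?S0.
Qed.

Let gxi : growth (fun i => xi i / S i).
Proof.
apply: (growth_le (growthD (growthD (scaled hxi0) (growthM (growth_cst pp) gSi))
  (growthN (growthM gq gSi)))) => i h.
by rewrite hxi// !mulrDl mulNr.
Qed.

Let geta : growth (fun i => eta i / S i).
Proof.
apply: (growth_le (growthD (growthD (growth_norm (scaled heta0))
  (growthM (growth_cst (2 / c)) (growthM gzn ghn))) (growthM (growthX 2 ghn) gSi))) => i h.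
apply: le_trans (ler_norm _); rewrite !normrM normfV (gtr0_norm (S0 h)).
rewrite ler_pdivrMr ?S0// (le_trans (heta h))// le_eqVlt; apply/orP; left; apply/eqP.
by field; rewrite !gt_eqF ?S0.
Qed.

Let gKN : growth (fun i => K i / N i).
Proof.
apply: (@ratio _ _ 2) => i h; rewrite ?K0 ?N0//.
by have := hN h; lra.
Qed.

Let gdelta : growth (fun i => S i * delta i).
Proof.
apply: (growth_le (growthM (growth_norm gxi) (growthD
  (growthM (growth_cst 4) (growthM (growthX 2 gzn) (growthX 2 gKN)))
  (growthM (growth_cst (2 * lam)) gKN)))) => i h.
apply: le_trans (ler_norm _); rewrite normrM (gtr0_norm (S0 h)) mulrC -ler_pdivlMr ?S0//.
rewrite (le_trans (hdelta h))// normrM normfV (gtr0_norm (S0 h)) hK//.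
rewrite le_eqVlt; apply/orP; left; apply/eqP.
by field; rewrite !gt_eqF ?S0 ?N0.
Qed.

Let gKtau : growth (fun i => K i / tau i).
Proof.
apply: (@ratio _ _ C) => i h; rewrite ?K0 ?tau0//.
by rewrite mulrC -ler_pdivrMr ?tau_ge.
Qed.

Let gtauK : growth (fun i => tau i / K i).
Proof.
apply: (@ratio _ _ c^-1) => i h; rewrite ?K0 ?tau0//.
by rewrite mulrC tau_le.
Qed.

Let grho : growth (fun i => xi i - delta i * tau i).
Proof.
apply: (growth_le (growthD (growthD (growthM (growth_norm gdelta) (growth_norm geta))
  (growthM (growth_cst (c ^- 3)) (growthM (growthX 2 gdelta) (growthX 2 gzn))))
  (growthM (growth_cst lam^-1) (growthD (growthM (growth_norm gxi) (growth_norm gdelta))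
    (growthM (growthX 2 gdelta) gtauK))))) => i h.
apply: le_trans (ler_norm _); rewrite (le_trans (hnewton h))//.
rewrite !normrM normfV (gtr0_norm (S0 h)) hK//.
rewrite le_eqVlt; apply/orP; left; apply/eqP.
by field; rewrite !gt_eqF ?S0.
Qed.

Let gdiff : growth (fun i => K i * (delta i - eps i)).
Proof.
apply: (growth_le (growthM gKtau (growthB (growthD (growth_cst pp) (growthN gq)) grho))) => i h.
rewrite le_eqVlt; apply/orP; left; apply/eqP; congr (`| _ |).
by rewrite heps// hxi//; field; rewrite !gt_eqF ?tau0.
Qed.

Let geps : growth (fun i => S i * eps i).
Proof.
apply: (growth_le (growthM (scaled hxi0) gKtau)) => i h.
rewrite le_eqVlt; apply/orP; left; apply/eqP; congr (`| _ |).
by rewrite heps// hK//; field; rewrite !gt_eqF ?tau0 ?S0.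
Qed.

(** Every quantity has a natural power of S as its order of magnitude; dividing
it out, each factor of the error bound grows at most polynomially in G and one
factor S^-1 is left over. *)
Lemma growth_error : growth (fun i => S i * err i).
Proof.
apply: (growth_le (growthD (growthD (growthD
  (growthM (growth_cst (2 * b / c ^+ 3)) (growthM (growthX 2 gdelta) (growthM ghn gzn)))
  (growthM (growth_cst (2 * b / c ^+ 2)) (growthM (growth_norm gdiff) (growthM ghn gzn))))
  (growthM (growth_cst (2 * b / c ^+ 5)) (growthM (growthX 3 (growth_norm gdelta)) (growthX 2 gzn))))
  (growthM (growth_cst (b / c ^+ 4)) (growthM (growth_norm gdiff)
    (growthM (growthD (growth_norm gdelta) (growth_norm geps)) (growthX 2 gzn)))))) => i h.
apply: le_trans (ler_norm _); rewrite normrM (gtr0_norm (S0 h)) mulrC -ler_pdivlMr ?S0//.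
rewrite (le_trans (herr h))// !normrM (gtr0_norm (S0 h)) (gtr0_norm (K0 h)) hK//.
rewrite le_eqVlt; apply/orP; left; apply/eqP.
by field; rewrite !gt_eqF ?S0.
Qed.

End growth.

(** * Moments of normalized sums of independent variables *)

Section exponential.
Context {R : realType}.
Implicit Types x s : R.

Lemma expR_sub1_le x : expR x - 1 <= x * expR x.
Proof.
have h : 1 - x <= expR (- x) by exact: expR_ge1Dx.
have := ler_wpM2r (expR_ge0 x) h; rewrite expRN mulVf ?gt_eqF ?expR_gt0//.
by rewrite mulrBl mul1r; lra.
Qed.

Lemma expR_le_quadratic x : expR x <= 1 + x + x ^+ 2 * expR `|x|.
Proof.
have h := expR_sub1_le x; have g := expR_ge1Dx x.
have e1 : 1 <= expR `|x| by rewrite -expR0 ler_expR.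
have [x0|x0] := leP 0 x.
  by rewrite ger0_norm//; have := ler_wpM2l x0 h; lra.
have := ler_wpM2l (sqr_ge0 x) e1.
by move: (expR `|x|) (expR x) h g e1 => u v h g e1; nra.
Qed.

Lemma normr_expr_le_cosh n x : `|x| ^+ n <= n`!%:R * (expR x + expR (- x)).
Proof.
have hy (y : R) : 0 <= y -> y ^+ n <= n`!%:R * expR y.
  move=> y0; case: n => [|n]; first by rewrite expr0 fact0 mul1r -expR0 ler_expR.
  have := expR_ge1Dxn n y0.
  rewrite -[_ ^+ _ / _]mulrC -lerBrDl ler_pdivrMl ?ltr0n ?fact_gt0// => h.
  by rewrite (le_trans h)// ler_wpM2l// lerBlDr lerDl.
have f0 : 0 <= n`!%:R :> R by [].
have [x0|x0] := leP 0 x.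
  by rewrite ger0_norm// (le_trans (hy _ x0))// ler_wpM2l// lerDl expR_ge0.
rewrite ltr0_norm// (le_trans (hy _ _))//; first by rewrite oppr_ge0 ltW.
by rewrite ler_wpM2l// lerDr expR_ge0.
Qed.

End exponential.

Section normalized_sum.
Context {R : realType} {disp : measure_display} {T : measurableType disp}.
Context (P : probability T R) {k : nat} (Z : T -> 'cV[R]_k).
Variable nu : 'I_k -> probability (measurableTypeR R) R.
Hypothesis rZ : random_vector Z.
Hypothesis lawZ : forall A : 'I_k -> set R, (forall i, measurable (A i)) ->
  P (box Z A) = (\prod_(i < k) nu i (A i))%E.
Variables (h : 'I_k -> R -> R) (L : R).
Hypothesis k0 : (0 < k)%N.
Hypothesis mh : forall i, measurable_fun setT (h i).
Hypothesis ih : forall i, (nu i).-integrable setT (EFin \o h i).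
Hypothesis h0 : forall i, \int[nu i]_x h i x = 0.
Hypothesis ihh : forall i,
  (nu i).-integrable setT (EFin \o (fun x => h i x ^+ 2 * expR `|h i x|)).
Hypothesis hL : forall i, \int[nu i]_x (h i x ^+ 2 * expR `|h i x|) <= L.

Let kR : 0 < k%:R :> R. Proof. by rewrite ltr0n. Qed.

Section one_sign.
Variable s : R.
Hypothesis sk : s ^+ 2 = k%:R^-1.
Let bound i x := 1 + s * h i x + s ^+ 2 * (h i x ^+ 2 * expR `|h i x|).

Let s1 : `|s| <= 1.
Proof.
rewrite -(@ler_pXn2r _ 2)// ?nnegrE// expr1n real_normK ?num_real// sk.
by rewrite invf_le1// ler1n.
Qed.

Let exp_le i x : expR (s * h i x) <= bound i x.
Proof.
rewrite (le_trans (expR_le_quadratic _))// lerD2l exprMn -mulrA ler_wpM2l ?sqr_ge0//.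
by rewrite ler_wpM2l ?sqr_ge0// ler_expR normrM ler_piMl.
Qed.

Let ibound i : (nu i).-integrable setT (EFin \o bound i).
Proof.
apply: integrableDR; last exact: integrableZR.
by apply: integrableDR; [exact: integrable_cst|exact: integrableZR].
Qed.

Let iexp i : (nu i).-integrable setT (EFin \o (fun x => expR (s * h i x))).
Proof.
apply: (integrable_le _ _ (ibound i)).
  have m1 : measurable_fun setT (fun x => s * h i x) by exact: measurable_funM.
  exact: (measurableT_comp (@measurable_expR R) m1).
by move=> x; rewrite ger0_norm ?expR_ge0//; exact: exp_le.
Qed.

Let int_le i : \int[nu i]_x expR (s * h i x) <= expR (L / k%:R).
Proof.
apply: (@le_trans _ _ (\int[nu i]_x bound i x)).
  exact: (le_Rintegral measurableT (iexp i) (ibound i) (fun x _ => exp_le i x)).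
have i1 : (nu i).-integrable setT (EFin \o (fun x => 1 + s * h i x)).
  by apply: integrableDR; [exact: integrable_cst|exact: integrableZR].
have i2 : (nu i).-integrable setT (EFin \o (fun x => s * h i x)) by exact: integrableZR.
rewrite /bound RintegralD//; last exact: integrableZR.
rewrite RintegralD//; last exact: integrable_cst.
have e1 : \int[nu i]_x (s * h i x) = 0.
  by rewrite (RintegralZl s measurableT (ih i)) (h0 i) mulr0.
rewrite e1 (Rintegral_prob_cst (nu i)) addr0 (RintegralZl (s ^+ 2) measurableT (ihh i)) sk.
apply: le_trans (expR_ge1Dx _); rewrite lerD2l mulrC ler_wpM2r// invr_ge0 ltW//.
Qed.

Let exp_sumE : (fun w => expR (s * \sum_i h i (Z w i 0))) =
  (fun w => \prod_i expR (s * h i (Z w i 0))).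
Proof. by apply/funext => w; rewrite mulr_sumr expR_sum. Qed.

Let mexp i : measurable_fun setT (fun x => expR (s * h i x)).
Proof. exact: integrable_measurable (iexp i). Qed.

Lemma exp_sum_integrable :
  P.-integrable setT (EFin \o (fun w => expR (s * \sum_i h i (Z w i 0)))).
Proof.
rewrite exp_sumE.
exact: (integrable_prod_coord rZ lawZ (h := fun i x => expR (s * h i x)) mexp iexp).
Qed.

(** The factors have mean at most 1 + L / k, so that the product of all k of
them stays bounded. *)
Lemma exp_sum_le : \int[P]_w expR (s * \sum_i h i (Z w i 0)) <= expR L.
Proof.
rewrite exp_sumE.
rewrite (Rintegral_prod_coord rZ lawZ (h := fun i x => expR (s * h i x)) mexp iexp).
apply: (@le_trans _ _ (\prod_(i < k) expR (L / k%:R))).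
  by apply: ler_prod => i _; rewrite Rintegral_ge0 ?int_le// => x _; exact: expR_ge0.
rewrite -expR_sum sumr_const card_ord -[L / _ *+ k]mulr_natr divfK//.
by rewrite gt_eqF.
Qed.

End one_sign.

Let S := Num.sqrt (k%:R : R).
Let S0 : 0 < S. Proof. by rewrite sqrtr_gt0. Qed.
Let SE : S ^+ 2 = k%:R. Proof. by rewrite sqr_sqrtr// ltW. Qed.

Let sk1 : S^-1 ^+ 2 = k%:R^-1. Proof. by rewrite exprVn SE. Qed.
Let sk2 : (- S^-1) ^+ 2 = k%:R^-1. Proof. by rewrite sqrrN sk1. Qed.

Let sumS w := (\sum_i h i (Z w i 0)) / S.

Let sumS_pow_le n w : `|sumS w| ^+ n <= n`!%:R *
  (expR (S^-1 * \sum_i h i (Z w i 0)) + expR (- S^-1 * \sum_i h i (Z w i 0))).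
Proof. by rewrite (le_trans (normr_expr_le_cosh n _))// /sumS mulrC mulNr mulrC [_ / S]mulrC. Qed.

Let icosh n : P.-integrable setT (EFin \o (fun w => n`!%:R *
  (expR (S^-1 * \sum_i h i (Z w i 0)) + expR (- S^-1 * \sum_i h i (Z w i 0))))).
Proof.
apply: integrableZR; apply: integrableDR; exact: exp_sum_integrable.
Qed.

Lemma normalized_sum_integrable n :
  P.-integrable setT (EFin \o (fun w => `|(\sum_i h i (Z w i 0)) / Num.sqrt k%:R| ^+ n)).
Proof.
apply: (integrable_le _ _ (icosh n)) => [|w].
  apply: measurable_funX; apply: measurableT_comp => //; apply: measurable_funM => //.
  by apply: measurable_sum => i; exact: (measurable_fun_coord rZ).
by rewrite ger0_norm ?exprn_ge0// sumS_pow_le.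
Qed.

(** Powers are dominated by the hyperbolic cosine. *)
Lemma normalized_sum_moment n :
  \int[P]_w `|(\sum_i h i (Z w i 0)) / Num.sqrt k%:R| ^+ n <= n`!%:R * (expR L + expR L).
Proof.
apply: (le_trans (le_Rintegral measurableT (normalized_sum_integrable n) (icosh n)
  (fun w _ => sumS_pow_le n w))).
have i1 := exp_sum_integrable sk1; have i2 := exp_sum_integrable sk2.
rewrite RintegralZl//; last exact: (integrableDR i1 i2).
rewrite ler_wpM2l// RintegralD// lerD//; exact: exp_sum_le.
Qed.

End normalized_sum.

(** Tilting the density by exp ((x - m)^2 / (4 s^2)) only inflates the variance, so
a function of at most quadratic growth with the constant 1/8 has the exponential
moments required above. *)
Section normal_moments.
Context {R : realType}.
Variables (m s : R) (g : R -> R).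
Hypothesis s0 : s != 0.
Hypothesis mg : measurable_fun setT g.
Hypothesis hg : forall x, `|g x| <= (1 + (x - m) ^+ 2 / s ^+ 2) / 8.

Definition tilt_bound : R := 2 * expR (1 / 4) * Num.sqrt 2.
Let cc : R := 2 * expR (1 / 4).
Let cc0 : 0 <= cc. Proof. by rewrite mulr_ge0// expR_ge0. Qed.
Let tilt x := cc * expR ((x - m) ^+ 2 / (4 * s ^+ 2)).

Let tilt_ge0 x : 0 <= tilt x. Proof. by rewrite mulr_ge0// expR_ge0. Qed.

Let mtilt : measurable_fun setT tilt.
Proof.
apply: measurable_funM => //.
have m1 : measurable_fun setT (fun x : R => (x - m) ^+ 2 / (4 * s ^+ 2)).
  by apply: measurable_funM => //; apply: measurable_funX; exact: measurable_funB.
exact: (measurableT_comp (@measurable_expR R) m1).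
Qed.

Let tilt_integral : (\int[normal_prob m s]_x (tilt x)%:E = tilt_bound%:E)%E.
Proof.
have s20 : Num.sqrt 2 * s != 0 by rewrite mulf_neq0// gt_eqF// sqrtr_gt0.
have e := @normal_prob_tilt R m s (cst cc) s0 (@measurable_cst _ _ _ _ _ cc) (fun=> cc0).
apply: (etrans e).
have e2 : (\int[normal_prob m (Num.sqrt 2 * s)]_x (cst cc x)%:E = cc%:E)%E.
  exact: (integral_prob_cst (normal_prob m (Num.sqrt 2 * s))).
by rewrite e2 -EFinM mulrC.
Qed.

Let itilt : (normal_prob m s).-integrable setT (EFin \o tilt).
Proof.
apply/integrableP; split; first exact/measurable_EFinP.
have -> : (\int[normal_prob m s]_x `|(EFin \o tilt) x| = tilt_bound%:E)%E.
  apply: (etrans _ tilt_integral); apply: eq_integral => x _.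
  by rewrite /= ger0_norm.
exact: ltry.
Qed.

Let sqr_exp_le x : g x ^+ 2 * expR `|g x| <= tilt x.
Proof.
have e2 : g x ^+ 2 <= 2 * expR `|g x|.
  have := @expR_ge1Dxn R `|g x| 1 (normr_ge0 _); rewrite real_normK ?num_real// => h.
  by rewrite mulrC -ler_pdivrMr// (le_trans _ h)// lerDr.
rewrite (le_trans (ler_wpM2r (expR_ge0 _) e2))// -mulrA -expRD /tilt /cc -mulrA -expRD.
rewrite ler_wpM2l// ler_expR.
have := hg x; have -> : (x - m) ^+ 2 / (4 * s ^+ 2) = ((x - m) ^+ 2 / s ^+ 2) / 4 by field.
by move: `|g x| (_ ^+ 2 / s ^+ 2) => u v; lra.
Qed.

Let sqr_exp_ge0 x : 0 <= g x ^+ 2 * expR `|g x|.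
Proof. by rewrite mulr_ge0 ?sqr_ge0 ?expR_ge0. Qed.

Let msqr_exp : measurable_fun setT (fun x => g x ^+ 2 * expR `|g x|).
Proof.
apply: measurable_funM; first exact: measurable_funX.
have m1 : measurable_fun setT (fun x => `|g x|).
  exact: (measurableT_comp (@normr_measurable R setT) mg).
exact: (measurableT_comp (@measurable_expR R) m1).
Qed.

Lemma normal_sqr_exp_integrable :
  (normal_prob m s).-integrable setT (EFin \o (fun x => g x ^+ 2 * expR `|g x|)).
Proof.
have h := @integrable_le R _ (measurableTypeR R) (normal_prob m s) _ _ msqr_exp.
apply: h itilt => x.
by rewrite (ger0_norm (sqr_exp_ge0 x)); exact: sqr_exp_le.
Qed.

Lemma normal_sqr_exp_le : \int[normal_prob m s]_x (g x ^+ 2 * expR `|g x|) <= tilt_bound.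
Proof.
have e : \int[normal_prob m s]_x (tilt x) = tilt_bound by rewrite /Rintegral tilt_integral.
rewrite -e.
exact: (le_Rintegral measurableT normal_sqr_exp_integrable itilt (fun x _ => sqr_exp_le x)).
Qed.

Lemma normal_quadratic_growth_integrable : (normal_prob m s).-integrable setT (EFin \o g).
Proof.
have i1 := integrableDR (integrable_cst (normal_prob m s) 1) normal_sqr_exp_integrable.
have h := @integrable_le R _ (measurableTypeR R) (normal_prob m s) _ _ mg.
apply: h i1 => x.
have e1 : 1 <= expR `|g x| by rewrite -expR0 ler_expR.
have e2 : g x ^+ 2 <= g x ^+ 2 * expR `|g x| by rewrite ler_peMr ?sqr_ge0.
apply: (le_trans _ (_ : 1 + g x ^+ 2 <= _)); last by rewrite lerD2l.
rewrite -real_normK ?num_real//.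
by have := sqr_ge0 (`|g x| - 1); move: `|g x| (normr_ge0 (g x)) => u u0; nra.
Qed.

End normal_moments.

(** ** Moments bounded along a sequence of models *)

Section bounded_moments.
Context {R : realType} {disp : nat -> measure_display}.
Context (Om : forall k, measurableType (disp k)) (P : forall k, probability (Om k) R).
Variable dom : nat -> Prop.
Implicit Types f g : forall k, Om k -> R.

Definition bounded_moments f := (forall k, dom k -> measurable_fun setT (f k)) /\
  forall n, exists C : R, forall k, dom k ->
    (P k).-integrable setT (EFin \o (fun w => `|f k w| ^+ n)) /\
    \int[P k]_w (`|f k w| ^+ n) <= C.

Lemma bounded_moments_cst (a : R) : bounded_moments (fun k w => a).
Proof.
split=> [k _|n]; first exact: measurable_cst.
exists (`|a| ^+ n) => k _; split; first exact: integrable_cst.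
by rewrite Rintegral_prob_cst.
Qed.

Lemma bounded_momentsD f g : bounded_moments f -> bounded_moments g ->
  bounded_moments (fun k w => f k w + g k w).
Proof.
move=> [mf hf] [mg hg]; split=> [k dk|n]; first exact: measurable_funD (mf k dk) (mg k dk).
have [C hC] := hf n; have [C' hC'] := hg n.
exists (2 ^+ n * (C + C')) => k dk.
have [i1 b1] := hC k dk; have [i2 b2] := hC' k dk.
have i3 := integrableZR (2 ^+ n) (integrableDR i1 i2).
have le w : `|f k w + g k w| ^+ n <= 2 ^+ n * (`|f k w| ^+ n + `|g k w| ^+ n).
  have : `|f k w + g k w| <= 2 * Num.max `|f k w| `|g k w|.
    rewrite (le_trans (ler_normD _ _))//.
    by case: (leP `|f k w| `|g k w|); move: `|f k w| `|g k w| => u v uv; lra.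
  move=> /(lerXn2r n); rewrite !nnegrE mulr_ge0 ?le_max ?normr_ge0// => h.
  rewrite (le_trans (h isT isT))// exprMn ler_wpM2l ?exprn_ge0//.
  by case: (leP `|f k w| `|g k w|) => _; rewrite ?lerDl ?lerDr exprn_ge0.
have m12 : measurable_fun setT (fun w => `|f k w + g k w| ^+ n).
  apply: measurable_funX; apply: measurableT_comp => //.
  exact: measurable_funD (mf k dk) (mg k dk).
have i4 : (P k).-integrable setT (EFin \o (fun w => `|f k w + g k w| ^+ n)).
  by apply: (integrable_le m12 _ i3) => w; rewrite ger0_norm ?exprn_ge0.
split=> //; apply: (le_trans (le_Rintegral measurableT i4 i3 (fun w _ => le w))).
rewrite (RintegralZl _ measurableT (integrableDR i1 i2)) ler_wpM2l ?exprn_ge0//.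
by rewrite RintegralD// lerD.
Qed.

Lemma bounded_moments_norm f : bounded_moments f -> bounded_moments (fun k w => `|f k w|).
Proof.
move=> [mf hf]; split=> [k dk|n]; first exact: measurableT_comp (mf k dk).
by have [C hC] := hf n; exists C => k dk; under eq_fun do rewrite normr_id; exact: hC.
Qed.

Lemma bounded_moments_sum (I : Type) (s : seq I) (f : I -> forall k, Om k -> R) :
  (forall i, bounded_moments (f i)) ->
  bounded_moments (fun k w => \sum_(i <- s) f i k w).
Proof.
move=> hf; elim: s => [|i s IH].
  rewrite (_ : (fun k w => _) = (fun k w => 0)); first exact: bounded_moments_cst.
  by apply/functional_extensionality_dep => k; apply/funext => w; rewrite big_nil.
rewrite (_ : (fun k w => _) = (fun k w => f i k w + \sum_(i <- s) f i k w)).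
  exact: bounded_momentsD.
by apply/functional_extensionality_dep => k; apply/funext => w; rewrite big_cons.
Qed.

End bounded_moments.

Section normal_centering.
Context {R : realType}.
Variables (m s c : R).
Hypothesis s0 : s != 0.

Lemma normal_mean_lin : \int[normal_prob m s]_x (c * (x - m)) = 0.
Proof.
have i1 := @integrable_normal_powZ R m s 1 1 s0.
have e := RintegralZl c measurableT i1.
have e1 : \int[normal_prob m s]_x (1 * (x - m) ^+ 1) = 0.
  have h := normal_moment1 m s0.
  by apply: (etrans _ h); apply: eq_Rintegral => x _; rewrite mul1r.
apply: (etrans (etrans _ e)); last by rewrite e1 mulr0.
by apply: eq_Rintegral => x _; rewrite mul1r expr1.
Qed.

Lemma normal_mean_sqr : \int[normal_prob m s]_x (((x - m) ^+ 2 / s ^+ 2 - 1) * c) = 0.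
Proof.
have i2 := @integrable_normal_powZ R m s 2 (c / s ^+ 2) s0.
have e2 : \int[normal_prob m s]_x (c / s ^+ 2 * (x - m) ^+ 2) = c.
  have h := RintegralZl (c / s ^+ 2) measurableT (@integrable_normal_powZ R m s 2 1 s0).
  have h2 : \int[normal_prob m s]_x (1 * (x - m) ^+ 2) = s ^+ 2.
    apply: (etrans _ (normal_moment2 m s0)).
    by apply: eq_Rintegral => x _; rewrite mul1r.
  rewrite h2 in h; apply: (etrans (etrans _ h)); last by field.
  by apply: eq_Rintegral => x _; rewrite mul1r.
have e := RintegralB measurableT i2 (integrable_cst (normal_prob m s) c).
rewrite e2 (Rintegral_prob_cst (normal_prob m s)) subrr in e.
apply: (etrans _ e); apply: eq_Rintegral => x _.
by field.
Qed.

End normal_centering.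

Section centred_sums.
Context {R : realType} {disp : measure_display} {T : measurableType disp}.
Context (P : probability T R) {k : nat} (y : T -> 'cV[R]_k).
Variables (a : 'cV[R]_k) (lam : R) (d : 'rV[R]_k).
Hypothesis v0 : forall i, 0 < d 0 i + lam.
Hypothesis ry : random_vector y.
Hypothesis law_y : forall B : 'I_k -> set R, (forall i, measurable (B i)) ->
  P (box y B) = (\prod_(i < k) obs_law a lam d i (B i))%E.
Hypothesis k0 : (0 < k)%N.
Variables (A : R) (h : 'I_k -> R -> R).
Hypothesis A0 : 0 < A.
Hypothesis mh : forall i, measurable_fun setT (h i).
Hypothesis hA : forall i x, `|h i x| <= A * (1 + (x - a i 0) ^+ 2 / (d 0 i + lam)).
Hypothesis h0 : forall i, \int[obs_law a lam d i]_x h i x = 0.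

Let A8 : 0 < 8 * A. Proof. exact: mulr_gt0. Qed.
Let g i x := (8 * A)^-1 * h i x.

Let hg i x : `|g i x| <= (1 + (x - a i 0) ^+ 2 / Num.sqrt (d 0 i + lam) ^+ 2) / 8.
Proof.
rewrite sqr_sqrtr ?(ltW (v0 i))// normrM normfV (gtr0_norm A8) mulrC ler_pdivrMr//.
by have := hA i x; move: `|h i x| (_ ^+ 2 / _) => u v; lra.
Qed.

Let s0 i : Num.sqrt (d 0 i + lam) != 0. Proof. by rewrite gt_eqF// sqrtr_gt0. Qed.
Let mg i : measurable_fun setT (g i). Proof. exact: measurable_funM. Qed.

Let ig i : (obs_law a lam d i).-integrable setT (EFin \o g i).
Proof. exact: (normal_quadratic_growth_integrable (s0 i) (mg i) (hg i)). Qed.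

Let igg i : (obs_law a lam d i).-integrable setT (EFin \o (fun x => g i x ^+ 2 * expR `|g i x|)).
Proof. exact: (normal_sqr_exp_integrable (s0 i) (mg i) (hg i)). Qed.

Let gL i : \int[obs_law a lam d i]_x (g i x ^+ 2 * expR `|g i x|) <= tilt_bound.
Proof. exact: (normal_sqr_exp_le (s0 i) (mg i) (hg i)). Qed.

Let hE i x : h i x = 8 * A * g i x.
Proof. by rewrite /g mulrA mulfV ?mul1r// gt_eqF. Qed.

Let g0 i : \int[obs_law a lam d i]_x g i x = 0.
Proof.
have e := RintegralZl (8 * A) measurableT (ig i).
have : 8 * A * \int[obs_law a lam d i]_x g i x = 0.
  rewrite -e -[RHS](h0 i); apply: eq_Rintegral => x _; exact/esym/hE.
by move/eqP; rewrite mulf_eq0 (gt_eqF A8) => /eqP.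
Qed.

Let sumE w : (\sum_i h i (y w i 0)) / Num.sqrt k%:R =
  8 * A * ((\sum_i g i (y w i 0)) / Num.sqrt k%:R).
Proof. by rewrite mulrA mulr_sumr; congr (_ / _); apply: eq_bigr => i _. Qed.

Let powE n : (fun w => `|(\sum_i h i (y w i 0)) / Num.sqrt k%:R| ^+ n) =
  (fun w => (8 * A) ^+ n * `|(\sum_i g i (y w i 0)) / Num.sqrt k%:R| ^+ n).
Proof. by apply/funext => w; rewrite sumE normrM exprMn (gtr0_norm A8). Qed.

Lemma centred_sum_integrable n :
  P.-integrable setT (EFin \o (fun w => `|(\sum_i h i (y w i 0)) / Num.sqrt k%:R| ^+ n)).
Proof.
rewrite powE.
exact: (integrableZR ((8 * A) ^+ n) (normalized_sum_integrable ry law_y k0 mg ig igg n)).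
Qed.

Lemma centred_sum_moment n :
  \int[P]_w (`|(\sum_i h i (y w i 0)) / Num.sqrt k%:R| ^+ n) <=
  (8 * A) ^+ n * (n`!%:R * (expR tilt_bound + expR tilt_bound)).
Proof.
rewrite powE; have i1 := normalized_sum_integrable ry law_y k0 mg ig igg n.
rewrite (RintegralZl _ measurableT i1) ler_wpM2l ?exprn_ge0 ?(ltW A8)//.
exact: (normalized_sum_moment ry law_y k0 mg ig g0 igg gL n).
Qed.

End centred_sums.

(** * Exact fourth- and sixth-order moments *)

Section normal_mixed_moments.
Context {R : realType}.
Variables (m s : R).
Hypothesis s0 : s != 0.

Definition mixed (v m' : R) (al be : nat) (x : R) : R :=
  (x - m') ^+ al * ((x - m') ^+ 2 / v - 1) ^+ be.

Lemma measurable_mixed v m' al be : measurable_fun setT (mixed v m' al be).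
Proof.
have mc : measurable_fun setT (fun x : R => x - m') by exact: measurable_funB.
apply: measurable_funM; first exact: measurable_funX.
apply: measurable_funX; apply: measurable_funB => //; apply: measurable_funM => //.
exact: measurable_funX.
Qed.

Lemma mixed_integrable al be :
  (normal_prob m s).-integrable setT (EFin \o mixed (s ^+ 2) m al be).
Proof.
have h := @normal_poly_integrable R m s ('X^al * ((s ^+ 2)^-1 *: 'X^2 - 1) ^+ be) s0.
suff <- : (fun x => ('X^al * ((s ^+ 2)^-1 *: 'X^2 - 1) ^+ be).[x - m]) = mixed (s ^+ 2) m al be.
  exact: h.
apply/funext => x; rewrite /mixed !hornerE /=.
by congr (_ * (_ - 1) ^+ be); rewrite -mulrA mulrC expr2.
Qed.

Let trinomial (c1 c2 c3 : R) n1 n2 n3 :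
  \int[normal_prob m s]_x (c1 * (x - m) ^+ n1 + c2 * (x - m) ^+ n2 + c3 * (x - m) ^+ n3) =
  c1 * \int[normal_prob m s]_x ((x - m) ^+ n1) + c2 * \int[normal_prob m s]_x ((x - m) ^+ n2)
  + c3 * \int[normal_prob m s]_x ((x - m) ^+ n3).
Proof.
have iz n c := @integrable_normal_powZ R m s n c s0.
have ez n c : \int[normal_prob m s]_x (c * (x - m) ^+ n) = c * \int[normal_prob m s]_x ((x - m) ^+ n).
  exact: (RintegralZl c measurableT (@integrable_normal_pow R m s n s0)).
have e1 := RintegralD measurableT (integrableDR (iz n1 c1) (iz n2 c2)) (iz n3 c3).
have e2 := RintegralD measurableT (iz n1 c1) (iz n2 c2).
by apply: (etrans e1); rewrite e2 !ez.
Qed.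

Let mono (c1 c2 c3 : R) n1 n2 n3 al be :
  (forall x, mixed (s ^+ 2) m al be x =
    c1 * (x - m) ^+ n1 + c2 * (x - m) ^+ n2 + c3 * (x - m) ^+ n3) ->
  \int[normal_prob m s]_x mixed (s ^+ 2) m al be x =
  c1 * \int[normal_prob m s]_x ((x - m) ^+ n1) + c2 * \int[normal_prob m s]_x ((x - m) ^+ n2)
  + c3 * \int[normal_prob m s]_x ((x - m) ^+ n3).
Proof. by move=> h; apply: (etrans _ (trinomial _ _ _ _ _ _)); apply: eq_Rintegral => x _. Qed.

Lemma mixed00 : \int[normal_prob m s]_x mixed (s ^+ 2) m 0 0 x = 1.
Proof.
rewrite (@mono 1 0 0 0%N 0%N 0%N); last by move=> x; rewrite /mixed; ring.
by rewrite (normal_moment0 m s); ring.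
Qed.

Lemma mixed01 : \int[normal_prob m s]_x mixed (s ^+ 2) m 0 1 x = 0.
Proof.
rewrite (@mono (s ^- 2) (-1) 0 2%N 0%N 0%N); last by move=> x; rewrite /mixed; ring.
by rewrite (normal_moment0 m s) (normal_moment2 m s0); field.
Qed.

Lemma mixed02 : \int[normal_prob m s]_x mixed (s ^+ 2) m 0 2 x = 2.
Proof.
rewrite (@mono (s ^- 2 ^+ 2) (- 2 * s ^- 2) 1 4%N 2%N 0%N); last by move=> x; rewrite /mixed; ring.
by rewrite (normal_moment0 m s) (normal_moment2 m s0) (normal_moment4 m s0); field.
Qed.

Lemma mixed10 : \int[normal_prob m s]_x mixed (s ^+ 2) m 1 0 x = 0.
Proof.
rewrite (@mono 1 0 0 1%N 0%N 0%N); last by move=> x; rewrite /mixed; ring.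
by rewrite (normal_moment0 m s) (normal_moment1 m s0); ring.
Qed.

Lemma mixed11 : \int[normal_prob m s]_x mixed (s ^+ 2) m 1 1 x = 0.
Proof.
rewrite (@mono (s ^- 2) (-1) 0 3%N 1%N 0%N); last by move=> x; rewrite /mixed; ring.
by rewrite (normal_moment0 m s) (normal_moment1 m s0) (normal_moment3 m s0); ring.
Qed.

Lemma mixed12 : \int[normal_prob m s]_x mixed (s ^+ 2) m 1 2 x = 0.
Proof.
rewrite (@mono (s ^- 2 ^+ 2) (- 2 * s ^- 2) 1 5%N 3%N 1%N); last by move=> x; rewrite /mixed; ring.
by rewrite (normal_moment1 m s0) (normal_moment3 m s0) (normal_moment5 m s0); ring.
Qed.

Lemma mixed20 : \int[normal_prob m s]_x mixed (s ^+ 2) m 2 0 x = s ^+ 2.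
Proof.
rewrite (@mono 1 0 0 2%N 0%N 0%N); last by move=> x; rewrite /mixed; ring.
by rewrite (normal_moment0 m s) (normal_moment2 m s0); ring.
Qed.

Lemma mixed21 : \int[normal_prob m s]_x mixed (s ^+ 2) m 2 1 x = 2 * s ^+ 2.
Proof.
rewrite (@mono (s ^- 2) (-1) 0 4%N 2%N 0%N); last by move=> x; rewrite /mixed; ring.
by rewrite (normal_moment0 m s) (normal_moment2 m s0) (normal_moment4 m s0); field.
Qed.

Lemma mixed22 : \int[normal_prob m s]_x mixed (s ^+ 2) m 2 2 x = 10 * s ^+ 2.
Proof.
rewrite (@mono (s ^- 2 ^+ 2) (- 2 * s ^- 2) 1 6%N 4%N 2%N); last by move=> x; rewrite /mixed; ring.
by rewrite (normal_moment2 m s0) (normal_moment4 m s0) (normal_moment6 m s0); field.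
Qed.

End normal_mixed_moments.

Lemma prod_expr_delta (R : comPzRingType) (I : finType) (i : I) (f : I -> R) :
  \prod_c f c ^+ (c == i) = f i.
Proof.
rewrite (bigD1 i)//= eqxx expr1 big1 ?mulr1// => c /negPf ->.
by rewrite expr0.
Qed.

Section quadratic_forms.
Context {R : realType} {disp : measure_display} {T : measurableType disp}.
Context (P : probability T R) {k : nat} (y : T -> 'cV[R]_k).
Variables (a : 'cV[R]_k) (lam : R) (d : 'rV[R]_k).
Hypothesis v0 : forall i, 0 < d 0 i + lam.
Hypothesis ry : random_vector y.
Hypothesis law_y : forall B : 'I_k -> set R, (forall i, measurable (B i)) ->
  P (box y B) = (\prod_(i < k) obs_law a lam d i (B i))%E.

Local Notation v i := (d 0 i + lam).
Let mom (i : 'I_k) al be : R := \int[obs_law a lam d i]_x mixed (v i) (a i 0) al be x.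

Let s0 i : Num.sqrt (v i) != 0. Proof. by rewrite gt_eqF// sqrtr_gt0. Qed.
Let sE i : Num.sqrt (v i) ^+ 2 = v i. Proof. by rewrite sqr_sqrtr// ltW. Qed.

Let imix i al be : (obs_law a lam d i).-integrable setT (EFin \o mixed (v i) (a i 0) al be).
Proof. have := @mixed_integrable R (a i 0) _ (s0 i) al be; rewrite sE; exact. Qed.

Let mom00 i : mom i 0 0 = 1.
Proof. have := @mixed00 R (a i 0) _ (s0 i); rewrite sE; exact. Qed.
Let mom01 i : mom i 0 1 = 0.
Proof. have := @mixed01 R (a i 0) _ (s0 i); rewrite sE; exact. Qed.
Let mom02 i : mom i 0 2 = 2.
Proof. have := @mixed02 R (a i 0) _ (s0 i); rewrite sE; exact. Qed.
Let mom10 i : mom i 1 0 = 0.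
Proof. have := @mixed10 R (a i 0) _ (s0 i); rewrite sE; exact. Qed.
Let mom11 i : mom i 1 1 = 0.
Proof. have := @mixed11 R (a i 0) _ (s0 i); rewrite sE; exact. Qed.
Let mom12 i : mom i 1 2 = 0.
Proof. have := @mixed12 R (a i 0) _ (s0 i); rewrite sE; exact. Qed.
Let mom20 i : mom i 2 0 = v i.
Proof. have := @mixed20 R (a i 0) _ (s0 i); rewrite sE; exact. Qed.
Let mom21 i : mom i 2 1 = 2 * v i.
Proof. have := @mixed21 R (a i 0) _ (s0 i); rewrite sE; exact. Qed.
Let mom22 i : mom i 2 2 = 10 * v i.
Proof. have := @mixed22 R (a i 0) _ (s0 i); rewrite sE; exact. Qed.

Let z w (i : 'I_k) : R := y w i 0 - a i 0.
Let zeta w (i : 'I_k) : R := z w i ^+ 2 / v i - 1.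

Let monomial (al be : 'I_k -> nat) w : R :=
  \prod_c (z w c ^+ al c * zeta w c ^+ be c).

Let monomial_integrable al be : P.-integrable setT (EFin \o monomial al be).
Proof.
exact: (integrable_prod_coord ry law_y (h := fun c => mixed (v c) (a c 0) (al c) (be c))
  (fun c => measurable_mixed _ _ _ _) (fun c => imix c _ _)).
Qed.

Let monomialE al be : \int[P]_w monomial al be w = \prod_c mom c (al c) (be c).
Proof.
exact: (Rintegral_prod_coord ry law_y (h := fun c => mixed (v c) (a c 0) (al c) (be c))
  (fun c => measurable_mixed _ _ _ _) (fun c => imix c _ _)).
Qed.

Let two (i j : 'I_k) (c : 'I_k) : nat := (c == i) + (c == j).

Let mono2 i j w : monomial (two i j) (fun=> 0%N) w = z w i * z w j.
Proof.
rewrite /monomial big_split /= [X in _ * X]big1 ?mulr1//.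
under eq_bigr do rewrite /two exprD.
by rewrite big_split /= !(prod_expr_delta _ (z w)).
Qed.
Let mono3 i j l w : monomial (two i j) (fun c => (c == l) : nat) w = z w i * z w j * zeta w l.
Proof.
rewrite /monomial big_split /= (prod_expr_delta _ (zeta w)).
under eq_bigr do rewrite /two exprD.
by rewrite big_split /= !(prod_expr_delta _ (z w)).
Qed.
Let mono4 i j l n w : monomial (two i j) (two l n) w = z w i * z w j * (zeta w l * zeta w n).
Proof.
rewrite /monomial big_split /=; congr (_ * _);
under eq_bigr do rewrite /two exprD;
by rewrite big_split /= ?(prod_expr_delta _ (z w)) ?(prod_expr_delta _ (zeta w)).
Qed.

Let prod0 (f : 'I_k -> R) c : f c = 0 -> \prod_c f c = 0.
Proof. by move=> h; apply/eqP/prodf_eq0; exists c => //; rewrite h. Qed.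

(** Odd powers of a centred normal coordinate have mean zero. *)
Let off_diag i j be : i != j -> (forall c, (be c <= 2)%N) ->
  \int[P]_w monomial (two i j) be w = 0.
Proof.
move=> ij hb; rewrite monomialE; apply: (prod0 (c := i)).
rewrite /two eqxx (negPf ij) addn0; move: (hb i).
by case: (be i) => [|[|[|]]]// _; rewrite ?mom10 ?mom11 ?mom12.
Qed.

Let two_diag i c : two i i c = if c == i then 2%N else 0%N.
Proof. by rewrite /two; case: (c == i). Qed.

Let int2 i j : \int[P]_w (z w i * z w j) = if i == j then v i else 0.
Proof.
rewrite -(funext (mono2 i j)).
have [<-|ij] := eqVneq i j; last exact: off_diag.
rewrite monomialE (bigD1 i)//= two_diag eqxx mom20 big1 ?mulr1// => c ci.
by rewrite two_diag (negPf ci) mom00.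
Qed.

Let int3 i j l : \int[P]_w (z w i * z w j * zeta w l) =
  if i == j then (if i == l then 2 * v i else 0) else 0.
Proof.
rewrite -(funext (mono3 i j l)).
have [<-|ij] := eqVneq i j; last by apply: off_diag => // c; case: (c == l).
rewrite monomialE; have [<-|il] := eqVneq i l.
  rewrite (bigD1 i)//= two_diag eqxx mom21 big1 ?mulr1// => c ci.
  by rewrite two_diag (negPf ci) mom00.
by apply: (prod0 (c := l)); rewrite two_diag eqxx eq_sym (negPf il) mom01.
Qed.

Let int4 i j l n : \int[P]_w (z w i * z w j * (zeta w l * zeta w n)) =
  if i == j then (if l == n then (if i == l then 10 * v i else 2 * v i) else 0) else 0.
Proof.
rewrite -(funext (mono4 i j l n)).
have [<-|ij] := eqVneq i j; last first.
  by apply: off_diag => // c; rewrite /two; case: (c == l); case: (c == n).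
rewrite monomialE; have [<-|ln] := eqVneq l n.
  have [<-|il] := eqVneq i l.
    rewrite (bigD1 i)//= two_diag eqxx mom22 big1 ?mulr1// => c ci.
    by rewrite two_diag (negPf ci) mom00.
  rewrite (bigD1 i)//= (bigD1 l) 1?eq_sym//= !two_diag !eqxx (negPf il).
  rewrite [l == i]eq_sym (negPf il) mom20 mom02 big1; last first.
    by move=> c /andP[ci cl]; rewrite !two_diag (negPf ci) (negPf cl) mom00.
  by rewrite mulr1 mulrC.
have [li|li] := eqVneq l i.
  apply: (prod0 (c := n)); rewrite two_diag /two eqxx -li [n == l]eq_sym (negPf ln).
  by rewrite mom01.
apply: (prod0 (c := l)); rewrite two_diag /two eqxx (negPf ln) (negPf li).
by rewrite mom01.
Qed.

Let quad (B : 'M[R]_k) w : R := dot (y w - a) (B *m (y w - a)).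

Let quadE B w : quad B w = \sum_i \sum_j B i j * (z w i * z w j).
Proof.
rewrite /quad dotE; apply: eq_bigr => i _; rewrite [(B *m _) i 0]mxE mulr_sumr.
by apply: eq_bigr => j _; rewrite /z !mxE; ring.
Qed.

Let sum_diag (B : 'M[R]_k) (f : 'I_k -> 'I_k -> T -> R) (g : 'I_k -> R) :
  (forall i j, P.-integrable setT (EFin \o f i j)) ->
  (forall i j, \int[P]_w f i j w = if i == j then g i else 0) ->
  P.-integrable setT (EFin \o (fun w => \sum_i \sum_j B i j * f i j w)) /\
  \int[P]_w (\sum_i \sum_j B i j * f i j w) = \sum_i B i i * g i.
Proof.
move=> jf ef; have i1 i j := integrableZR (B i j) (jf i j).
have i2 i : P.-integrable setT (EFin \o (fun w => \sum_j B i j * f i j w)).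
  by apply: integrable_sumR => j _; exact: i1.
split; first by apply: integrable_sumR => i _; exact: i2.
rewrite Rintegral_sum => [|i _]; last exact: i2.
apply: eq_bigr => i _; rewrite Rintegral_sum => [|j _]; last exact: i1.
rewrite (bigD1 i)//= big1 => [|j ji].
  by rewrite (RintegralZl _ measurableT (jf i i)) ef eqxx addr0.
by rewrite (RintegralZl _ measurableT (jf i j)) ef eq_sym (negPf ji) mulr0.
Qed.

Let i2 i j : P.-integrable setT (EFin \o (fun w => z w i * z w j)).
Proof. by rewrite -(funext (mono2 i j)); exact: monomial_integrable. Qed.
Let i3 i j l : P.-integrable setT (EFin \o (fun w => z w i * z w j * zeta w l)).
Proof. by rewrite -(funext (mono3 i j l)); exact: monomial_integrable. Qed.
Let i4 i j l n : P.-integrable setT (EFin \o (fun w => z w i * z w j * (zeta w l * zeta w n))).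
Proof. by rewrite -(funext (mono4 i j l n)); exact: monomial_integrable. Qed.

Let sumz w := \sum_i zeta w i.

Lemma quad_mean (B : 'M[R]_k) : P.-integrable setT (EFin \o quad B) /\
  \int[P]_w quad B w = \sum_i B i i * v i.
Proof. by rewrite (funext (quadE B)); exact: (sum_diag B i2 int2). Qed.

Lemma quad_mean1 (B : 'M[R]_k) : P.-integrable setT (EFin \o (fun w => sumz w * quad B w)) /\
  \int[P]_w (sumz w * quad B w) = 2 * \sum_i B i i * v i.
Proof.
have e w : sumz w * quad B w =
    \sum_i \sum_j B i j * (\sum_l z w i * z w j * zeta w l).
  rewrite quadE mulr_sumr; apply: eq_bigr => i _; rewrite mulr_sumr.
  by apply: eq_bigr => j _; rewrite -mulr_sumr -/(sumz w); ring.
have jf i j : P.-integrable setT (EFin \o (fun w => \sum_l z w i * z w j * zeta w l)).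
  by apply: integrable_sumR => l _; exact: i3.
rewrite (funext e) mulr_sumr; have [] := sum_diag B (g := fun i => 2 * v i) jf.
  move=> i j; rewrite Rintegral_sum => [|l _]; last exact: i3.
  under eq_bigr do rewrite int3.
  case: (i == j); last by rewrite big1.
  by rewrite (bigD1 i)//= eqxx big1 ?addr0// => l li; rewrite eq_sym (negPf li).
move=> h1 h2; split=> //; rewrite h2; apply: eq_bigr => i _; ring.
Qed.

(** The square of the sum of zeta has mean 2 k; its correlation with z_i^2 adds 8
in the single coordinate i. *)
Lemma quad_mean2 (B : 'M[R]_k) :
  P.-integrable setT (EFin \o (fun w => sumz w ^+ 2 * quad B w)) /\
  \int[P]_w (sumz w ^+ 2 * quad B w) = (2 * k%:R + 8) * \sum_i B i i * v i.
Proof.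
have e w : sumz w ^+ 2 * quad B w =
    \sum_i \sum_j B i j * (\sum_l \sum_n z w i * z w j * (zeta w l * zeta w n)).
  rewrite quadE mulr_sumr; apply: eq_bigr => i _; rewrite mulr_sumr.
  apply: eq_bigr => j _; under [in RHS]eq_bigr do rewrite -mulr_sumr -mulr_sumr.
  by rewrite -mulr_sumr -mulr_suml -/(sumz w); ring.
have jn i j l : P.-integrable setT (EFin \o (fun w => \sum_n z w i * z w j * (zeta w l * zeta w n))).
  by apply: integrable_sumR => n _; exact: i4.
have jf i j : P.-integrable setT (EFin \o (fun w =>
    \sum_l \sum_n z w i * z w j * (zeta w l * zeta w n))).
  by apply: integrable_sumR => l _; exact: jn.
rewrite (funext e) mulr_sumr.
have [] := sum_diag B (g := fun i => (2 * k%:R + 8) * v i) jf.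
  move=> i j; rewrite Rintegral_sum => [|l _]; last exact: jn.
  have jl l : \int[P]_w (\sum_n z w i * z w j * (zeta w l * zeta w n)) =
      if i == j then (if i == l then 10 * v i else 2 * v i) else 0.
    rewrite Rintegral_sum => [|n _]; last exact: i4.
    under eq_bigr do rewrite int4.
    case: (i == j); last by rewrite big1.
    by rewrite (bigD1 l)//= eqxx big1 ?addr0// => n nl; rewrite eq_sym (negPf nl).
  under eq_bigr do rewrite jl.
  case: (i == j); last by rewrite big1.
  transitivity (\sum_(l < k) (2 * v i + (l == i)%:R * (8 * v i))).
    by apply: eq_bigr => l _; rewrite [l == i]eq_sym; case: (i == l); rewrite /=; ring.
  rewrite big_split /= sumr_const card_ord -mulr_suml (bigD1 i)//= eqxx big1.
    by rewrite addr0 /= -[2 * v i *+ k]mulr_natr; ring.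
  by move=> l /negPf ->.
move=> h1 h2; split=> //; rewrite h2; apply: eq_bigr => i _; ring.
Qed.

End quadratic_forms.

(** * Expectation of the expansion *)

Section trace_gap.
Context {R : realType} {k p m : nat}.
Variables (d : 'rV[R]_k) (X : 'M[R]_(k, p)) (Q : 'M[R]_k) (W : 'M[R]_(k, m)) (c C lam b : R).
Hypotheses (c0 : 0 < c) (hc : forall i, c <= d 0 i) (lam0 : 0 < lam).
Hypothesis hC : forall i, d 0 i + lam <= C.
Hypothesis rX : \rank X = p.
Hypothesis b0 : 0 <= b.
Hypothesis k0 : (0 < k)%N.

Let d0 i : 0 < d 0 i. Proof. exact: lt_le_trans (hc i). Qed.
Let l0 : 0 <= lam. Proof. exact: ltW. Qed.
Local Notation A := (Amx d X lam).
Local Notation V := (Vmx d lam).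
Local Notation H := (Hmx d X lam).
Local Notation Vi := (diag_mx (precision d lam)).
Local Notation tau := (tau d lam).
Implicit Types M : 'M[R]_k.

Let Vi_V : Vi *m V = 1%:M. Proof. exact: vi_mulVmx. Qed.
Let V_Vi : V *m Vi = 1%:M. Proof. exact: mulVmx_vi. Qed.
Let AVA : A *m V *m A = A. Proof. exact: AVA_l. Qed.
Let AVH : A *m V *m H = 0.
Proof. by rewrite AmxE// (mulmxBl Vi H) (mulmxBl (Vi *m V)) Vi_V mul1mx HVH// subrr. Qed.

Definition main_mx M := A *m M *m A - 2 *: (Vi *m M *m A).
Definition corr1_mx M := H *m M *m A *m A.
Definition corr2_mx M := A *m A *m M *m A *m A.

Lemma tr_main_mx M : \tr (main_mx M *m V) = - \tr (M *m A).
Proof.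
rewrite /main_mx (mulmxBl (A *m M *m A)) [LHS]raddfB /= -scalemxAl mxtraceZ.
have -> : \tr (A *m M *m A *m V) = \tr (M *m A).
  by rewrite -!mulmxA mxtrace_mulC -!mulmxA [A *m (V *m A)]mulmxA AVA.
have -> : \tr (Vi *m M *m A *m V) = \tr (M *m A).
  by rewrite -!mulmxA mxtrace_mulC -!mulmxA V_Vi mulmx1.
by ring.
Qed.

(** Fitting residuals is void: A V H = 0. *)
Lemma tr_corr1_mx M : \tr (corr1_mx M *m V) = 0.
Proof.
rewrite /corr1_mx -!mulmxA mxtrace_mulC -!mulmxA [A *m (V *m H)]mulmxA AVH.
by rewrite !mulmx0 mxtrace0.
Qed.

Lemma tr_corr2_mx M : \tr (corr2_mx M *m V) = \tr (M *m A *m A *m A).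
Proof.
rewrite /corr2_mx -!mulmxA mxtrace_mulC -!mulmxA mxtrace_mulC -!mulmxA.
by rewrite [A *m (V *m (A *m _))]mulmxA [(A *m V) *m (A *m _)]mulmxA AVA.
Qed.

Variable M : 'M[R]_k.
Hypothesis hM : forall x y, `|dot x (M *m y)| <= b * (vn x * vn y).

Let tr_sum (B : 'M[R]_k) : \tr B = \sum_i dot (delta_mx i 0) (B *m (delta_mx i 0 : 'cV[R]_k)).
Proof. by apply: eq_bigr => i _; rewrite dot_delta. Qed.

Let hcol i := vn (H *m (delta_mx i 0 : 'cV[R]_k)).

Let sum_hcol_sqr : \sum_i hcol i ^+ 2 <= p%:R / c ^+ 2.
Proof.
have hp : c * \tr H <= p%:R.
  rewrite -(tr_HV d0 rX l0) VmxE tr_mul_diag /mxtrace mulr_sumr ler_sum// => i _.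
  rewrite mulrC ler_wpM2l//; first exact: psd_diag (psd_Hmx d0 rX l0).
  by rewrite !mxE (le_trans (hc i))// lerDl.
rewrite ler_pdivlMr ?exprn_gt0// mulrC expr2 -mulrA.
apply: le_trans hp; rewrite ler_wpM2l ?(ltW c0)//.
rewrite tr_sum mulr_sumr ler_sum// => i _.
by rewrite /hcol vn_sqr; exact: qH_ge.
Qed.

Let S := Num.sqrt (k%:R : R).
Let S0 : 0 < S. Proof. by rewrite sqrtr_gt0 ltr0n. Qed.
Let SE : S ^+ 2 = k%:R. Proof. by rewrite sqr_sqrtr. Qed.

(** The sum of the squares is bounded by a trace against H; the bound on the sum
itself then follows from t <= S t^2 + 1 / S. *)
Let sum_hcol : \sum_i hcol i <= S * (p%:R / c ^+ 2 + 1).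
Proof.
apply: (@le_trans _ _ (\sum_i (S * hcol i ^+ 2 + S^-1))).
  apply: ler_sum => i _.
  rewrite -(ler_pM2l S0) mulrDr mulfV ?gt_eqF//.
  have := sqr_ge0 (S * hcol i - 1 / 2).
  by move: (hcol i) => x; nra.
rewrite big_split /= -mulr_sumr sumr_const card_ord mulrDr lerD//.
  by rewrite ler_wpM2l// ltW.
by rewrite -mulr_natr -SE expr2 mulKf ?gt_eqF// mulr1.
Qed.

Let tr_le (B1 B2 : 'M[R]_k) (b1 b2 : R) : B1^T = B1 ->
  (forall x : 'cV[R]_k, vn (B1 *m x) <= b1 * vn x) ->
  (forall i, vn (B2 *m delta_mx i 0) <= b2 * hcol i) ->
  0 <= b2 -> `|\tr (B1 *m M *m B2)| <= b * b1 * b2 * (S * (p%:R / c ^+ 2 + 1)).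
Proof.
move=> sB h1 h2 b20; rewrite tr_sum (le_trans (ler_norm_sum _ _ _))//.
apply: (@le_trans _ _ (\sum_i b * b1 * b2 * hcol i)); last first.
  rewrite -mulr_sumr ler_wpM2l// mulr_ge0// mulr_ge0//.
  have := h1 (delta_mx (Ordinal k0) 0); rewrite vn_delta mulr1.
  by apply: le_trans; exact: vn_ge0.
apply: ler_sum => i _; rewrite -!mulmxA -(sym_dot _ _ sB) (le_trans (hM _ _))//.
rewrite -!mulrA ler_wpM2l// ler_pM ?vn_ge0//.
by rewrite (le_trans (h1 _))// vn_delta mulr1.
Qed.

Let ci0 : 0 <= c^-1. Proof. by rewrite invr_ge0 ltW. Qed.
Let vA (x : 'cV[R]_k) : vn (A *m x) <= c^-1 * vn x.
Proof. by rewrite mulrC; exact: (vn_Amx_le d0 rX c0 hc). Qed.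
Let vV (x : 'cV[R]_k) : vn (Vi *m x) <= c^-1 * vn x.
Proof. by rewrite mulrC; exact: vn_vi_le. Qed.

Let vAA (x : 'cV[R]_k) : vn (A *m A *m x) <= c^-1 ^+ 2 * vn x.
Proof. by rewrite -mulmxA expr2 -mulrA (le_trans (vA _))// ler_wpM2l. Qed.

(** Telescoping V^-1 = A + H, each term contains the factor H once. *)
Let cube_gap : `|\tr (M *m A *m A *m A) - \tr (M *m Vi *m Vi *m Vi)| <=
  3 * (b * c^-1 ^+ 2 * (S * (p%:R / c ^+ 2 + 1))).
Proof.
have -> : \tr (M *m A *m A *m A) - \tr (M *m Vi *m Vi *m Vi) =
    - (\tr (1%:M *m M *m (Vi *m Vi *m H)) + \tr (A *m M *m (Vi *m H))
       + \tr (A *m A *m M *m H)).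
  have e1 : \tr (1%:M *m M *m (Vi *m Vi *m H)) =
      \tr (M *m Vi *m Vi *m Vi) - \tr (M *m Vi *m Vi *m A).
    by rewrite AmxE// [M *m Vi *m Vi *m (Vi - H)](mulmxBr _ Vi H) raddfB /=
      opprB addrC subrK mul1mx !mulmxA.
  have e2 : \tr (A *m M *m (Vi *m H)) = \tr (M *m Vi *m Vi *m A) - \tr (M *m Vi *m A *m A).
    rewrite -mulmxA mxtrace_mulC.
    by rewrite -raddfB /= -(mulmxBl (M *m Vi *m Vi)) -(mulmxBr (M *m Vi) Vi A)
       {2}AmxE// opprB addrC subrK !mulmxA.
  have e3 : \tr (A *m A *m M *m H) = \tr (M *m Vi *m A *m A) - \tr (M *m A *m A *m A).
    rewrite -mulmxA mxtrace_mulC.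
    rewrite -raddfB /= -(mulmxBl (M *m Vi *m A)) -(mulmxBl (M *m Vi)) -(mulmxBr M Vi A).
    by rewrite {3}AmxE// opprB addrC subrK !mulmxA.
  by rewrite e1 e2 e3; ring.
rewrite normrN (le_trans (ler_normD _ _))// (_ : 3 = 1 + 1 + 1 :> R); last by ring.
rewrite !mulrDl !mul1r lerD//; first rewrite (le_trans (ler_normD _ _))// lerD//.
- have e x : vn ((1%:M : 'M[R]_k) *m x) <= 1 * vn x by rewrite mul1mx mul1r.
  rewrite -[X in X * c^-1 ^+ 2]mulr1; apply: (tr_le (trmx1 _ _) e _ (exprn_ge0 2 ci0)) => i.
  by rewrite -!mulmxA expr2 -mulrA (le_trans (vV _))// ler_wpM2l//; exact: vV.
- have -> : b * c^-1 ^+ 2 = b * c^-1 * c^-1 by ring.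
  apply: (tr_le (tr_Amx X d0 l0) vA _ ci0) => i.
  by rewrite -mulmxA; exact: vV.
- rewrite -[b * c^-1 ^+ 2]mulr1; apply: (tr_le _ vAA _ ler01); first by rewrite trmx_mul tr_Amx.
  by move=> i; rewrite mul1r.
Qed.

Let tau_gt0 : 0 < tau. Proof. exact: sum_inv_gt0. Qed.

Lemma tau_ge : k%:R / C <= tau.
Proof.
have -> : k%:R / C = \sum_(i < k) C^-1 by rewrite sumr_const card_ord mulrC mulr_natr.
by apply: ler_sum => i _; rewrite lef_pV2 ?posrE ?v_gt0// (lt_le_trans (v_gt0 d0 i l0)).
Qed.

Let C0 : 0 < C. Proof. exact: lt_le_trans (v_gt0 d0 (Ordinal k0) l0) (hC _). Qed.

Let cube_le : `|\tr (M *m A *m A *m A)| <= b * c^-1 ^+ 3 * k%:R.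
Proof.
rewrite tr_sum (le_trans (ler_norm_sum _ _ _))//.
apply: (@le_trans _ _ (\sum_(i < k) b * c^-1 ^+ 3)); last first.
  by rewrite sumr_const card_ord mulr_natr.
apply: ler_sum => i _; rewrite -!mulmxA (le_trans (hM _ _))// ler_wpM2l// vn_delta mul1r.
rewrite (le_trans (vA _))// exprS ler_wpM2l// mulmxA (le_trans (vAA _))// vn_delta.
by rewrite mulr1.
Qed.

Let sum_cube : \sum_i M i i * (d 0 i + lam)^-1 ^+ 3 = \tr (M *m Vi *m Vi *m Vi).
Proof.
rewrite -!mulmxA !mulmx_diag tr_mul_diag; apply: eq_bigr => i _; congr (_ * _).
by rewrite !mxE !exprS expr0 mulr1.
Qed.

Definition trace_gap_bound : R :=
  C ^+ 2 * (8 * b * c^-1 ^+ 3 + 6 * (b * c^-1 ^+ 2) * (p%:R / c ^+ 2 + 1)).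

(** Replacing A by V^-1 in the trace with A^3, and 2 k + 8 by 2 k, are errors of
order k^(-1/2): the hat matrix, by which A and V^-1 differ, has bounded trace. *)
Lemma trace_gap :
  S * `|(2 * k%:R + 8) / tau ^+ 2 * \tr (M *m A *m A *m A)
    - (\sum_i M i i * (d 0 i + lam)^-1 ^+ 3) * (2 * k%:R / tau ^+ 2)|
  <= trace_gap_bound.
Proof.
rewrite sum_cube.
have hc3 := cube_le; have hg := cube_gap.
move: hc3 hg; set t := \tr _; set u := \tr _ => hc3 hg.
have -> : (2 * k%:R + 8) / tau ^+ 2 * t - u * (2 * k%:R / tau ^+ 2) =
    (8 * t + 2 * k%:R * (t - u)) / tau ^+ 2 by ring.
have kR : 0 < k%:R :> R by rewrite ltr0n.
have t2 : 0 < tau ^+ 2 by rewrite exprn_gt0.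
have tk : k%:R ^+ 2 <= C ^+ 2 * tau ^+ 2.
  have h1 : k%:R <= C * tau by rewrite mulrC -ler_pdivrMr// tau_ge.
  by rewrite -exprMn; apply: lerXn2r => //; rewrite nnegrE ltW ?mulr_gt0.
have S1 : 1 <= S by rewrite -(@ler_pXn2r _ 2)// ?nnegrE ?(ltW S0)// expr1n SE ler1n.
rewrite normrM normfV (gtr0_norm t2) mulrA ler_pdivrMr// /trace_gap_bound.
set e1 := 8 * b * _; set e2 := 6 * _ * _.
have c10 : 0 <= p%:R / c ^+ 2 + 1 by rewrite addr_ge0// divr_ge0// exprn_ge0// ltW.
have e10 : 0 <= e1 by rewrite !mulr_ge0// exprn_ge0.
have e20 : 0 <= e2 by rewrite !mulr_ge0// exprn_ge0.
rewrite [leRHS]mulrAC; apply: (@le_trans _ _ (k%:R ^+ 2 * (e1 + e2))); last first.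
  by rewrite ler_wpM2r// addr_ge0.
apply: (@le_trans _ _ (S * (e1 * k%:R + k%:R * S * e2))).
  rewrite ler_wpM2l ?(ltW S0)// (le_trans (ler_normD _ _))// lerD//.
    have -> : e1 * k%:R = 8 * (b * c^-1 ^+ 3 * k%:R) by rewrite /e1; ring.
    by rewrite normrM normr_nat ler_wpM2l.
  rewrite !normrM !normr_nat.
  have -> : k%:R * S * e2 = 2 * k%:R * (3 * (b * c^-1 ^+ 2 * (S * (p%:R / c ^+ 2 + 1)))).
    by rewrite /e2; ring.
  by rewrite ler_wpM2l.
rewrite !mulrDr; apply: lerD; last first.
  by rewrite le_eqVlt; apply/orP; left; apply/eqP; rewrite -SE; ring.
rewrite mulrCA [leRHS]mulrC ler_wpM2l// expr2 ler_wpM2r ?(ltW kR)//.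
by rewrite -SE expr2 ler_peMl// ltW.
Qed.

End trace_gap.

Section expected_loss.
Context {R : realType} {disp : measure_display} {T : measurableType disp}.
Context (P : probability T R) {k p m : nat} (y mu : T -> 'cV[R]_k).
Variables (d : 'rV[R]_k) (X : 'M[R]_(k, p)) (Q : 'M[R]_k) (W : 'M[R]_(k, m)).
Variables (t : 'cV[R]_k -> 'cV[R]_m) (beta : 'cV[R]_p) (lam c : R).
Hypotheses (lam0 : 0 < lam) (c0 : 0 < c) (hc : forall i, c <= d 0 i).
Hypotheses (rX : \rank X = p) (rW : \rank W = m) (pQ : posdef Q) (pk : (p < k)%N).
Hypothesis mu_law : normal_vector P mu (X *m beta) (const_mx lam).
Hypothesis y_cond : cond_normal_vector P y mu d.
Hypothesis t_L2 : forall j : 'I_m, (fun w => t (y w) j 0) \in Lfun P 2%:E.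

Let d0 i : 0 < d 0 i. Proof. exact: lt_le_trans (hc i). Qed.
Let l0 : 0 <= lam. Proof. exact: ltW. Qed.
Let v0 i : 0 < d 0 i + lam. Proof. exact: v_gt0. Qed.
Let ry : random_vector y := y_cond.1.
Let law_y := marginal_law lam0 d0 mu_law y_cond.

Local Notation M := (Mmx d Q W).
Local Notation A := (Amx d X lam).
Local Notation z w := (y w - X *m beta).
Local Notation tau := (tau d lam).

Definition loss_error (v : 'cV[R]_k) : R :=
  loss d X lam v M - loss_main d X lam v M - loss_corr d X lam v M (xi0 d lam v / tau).

Let loss_mainE v : loss_main d X lam v M = dot v (main_mx d X lam M *m v).
Proof.
rewrite /loss_main /main_mx (mulmxBl (A *m M *m A)) -scalemxAl dotBr dotZr -!mulmxA.
by rewrite (sym_dot _ _ (tr_Amx X d0 l0)) (sym_dot _ _ (tr_vi d lam)).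
Qed.

Let loss_corrE v e : loss_corr d X lam v M e =
  2 * e * dot v (corr1_mx d X lam M *m v) + e ^+ 2 * dot v (corr2_mx d X lam M *m v).
Proof.
rewrite /loss_corr /corr1_mx /corr2_mx -!mulmxA (sym_dot _ _ (tr_Hmx d X lam)).
by rewrite !(sym_dot _ _ (tr_Amx X d0 l0)).
Qed.

Let xi0E w : xi0 d lam (z w) = \sum_i ((y w i 0 - (X *m beta) i 0) ^+ 2 / (d 0 i + lam) - 1).
Proof. by apply: eq_bigr => i _; rewrite [(y w - _) i 0]mxE [(- (X *m beta)) i 0]mxE. Qed.

Let tr_V (B : 'M[R]_k) : \sum_i B i i * (d 0 i + lam) = \tr (B *m Vmx d lam).
Proof. by rewrite VmxE tr_mul_diag; apply: eq_bigr => i _; rewrite !mxE. Qed.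

Let main_mean : P.-integrable setT (EFin \o (fun w => loss_main d X lam (z w) M)) /\
  \int[P]_w loss_main d X lam (z w) M = - \tr (M *m A).
Proof.
rewrite (funext (fun w => loss_mainE (z w))).
have := quad_mean v0 ry law_y (main_mx d X lam M).
by rewrite tr_V (tr_main_mx c0 hc).
Qed.

Let corr_mean : P.-integrable setT (EFin \o (fun w =>
    loss_corr d X lam (z w) M (xi0 d lam (z w) / tau))) /\
  \int[P]_w loss_corr d X lam (z w) M (xi0 d lam (z w) / tau) =
  (2 * k%:R + 8) / tau ^+ 2 * \tr (M *m A *m A *m A).
Proof.
have [i1 e1] := quad_mean1 v0 ry law_y (corr1_mx d X lam M).
have [i2 e2] := quad_mean2 v0 ry law_y (corr2_mx d X lam M).
move: e1 e2; rewrite !tr_V (tr_corr1_mx c0 hc) // (tr_corr2_mx c0 hc) // => e1 e2.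
have e w : loss_corr d X lam (z w) M (xi0 d lam (z w) / tau) =
   2 / tau * ((\sum_i ((y w i 0 - (X *m beta) i 0) ^+ 2 / (d 0 i + lam) - 1))
       * dot (z w) (corr1_mx d X lam M *m z w))
   + tau ^- 2 * ((\sum_i ((y w i 0 - (X *m beta) i 0) ^+ 2 / (d 0 i + lam) - 1)) ^+ 2
       * dot (z w) (corr2_mx d X lam M *m z w)).
  by rewrite loss_corrE xi0E expr_div_n; ring.
rewrite (funext e); have j1 := integrableZR (2 / tau) i1; have j2 := integrableZR (tau ^- 2) i2.
split; first exact: (integrableDR j1 j2).
apply: (etrans (RintegralD measurableT j1 j2)).
rewrite (RintegralZl _ measurableT i1) (RintegralZl _ measurableT i2) e1 e2.
by ring.
Qed.

Let lossE w : dot (direction d X (y w)) (M *m direction d X (y w))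
    - 2 * dot (diag_mx (precision d lam) *m (z w)) (M *m direction d X (y w)) =
  loss d X lam (z w) M.
Proof.
rewrite /loss -(direction_shift c0 hc rX (z w) beta); by rewrite subrK.
Qed.

(** Of the two quadratic forms in the correction only the second contributes: it
supplies the third term of the approximation. *)
Lemma Delta_U_expansion :
  P.-integrable setT (EFin \o (fun w => loss_error (z w))) /\
  Delta_U P d X Q W t y mu = - \tr (M *m A)
    + (2 * k%:R + 8) / tau ^+ 2 * \tr (M *m A *m A *m A) + \int[P]_w loss_error (z w).
Proof.
have i0 : P.-integrable setT (EFin \o (fun w => loss d X lam (z w) M)).
  have h := loss_integrable Q W lam0 c0 hc rX (ltnW pk) mu_law y_cond.
  by rewrite -(funext lossE).
have [i1 e1] := main_mean; have [i2 e2] := corr_mean.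
split; first exact: (integrableBR (integrableBR i0 i1) i2).
have hU := Delta_U_eq lam0 c0 hc rX rW pQ (ltnW pk) mu_law y_cond t_L2.
rewrite (funext lossE) in hU.
have h := RintegralB measurableT (integrableBR i0 i1) i2.
rewrite (RintegralB measurableT i0 i1) e1 e2 -hU in h.
rewrite /loss_error h; ring.
Qed.

End expected_loss.

(** * Uniformity in the dimension *)

Section uniform_bounds.
Context {R : realType}.

Lemma Mmx_bound k m (d : 'rV[R]_k) (Q : 'M[R]_k) (W : 'M[R]_(k, m)) (C q : R)
    (x y : 'cV[R]_k) :
  (0 < k)%N -> posdef Q -> \rank W = m -> (forall i, 0 < d 0 i <= C) -> Ch_max Q <= q ->
  `|dot x (Mmx d Q W *m y)| <= `|q| * C ^+ 2 * (vn x * vn y).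
Proof.
move=> k0 pQ rW hd hq; pose b := `|q| * C ^+ 2.
have b0 : 0 <= b by rewrite mulr_ge0// sqr_ge0.
have hb u : dot u (Mmx d Q W *m u) <= b * dot u u.
  have -> : dot u (Mmx d Q W *m u) = dot (Dmx d *m u) (QWmx Q W *m (Dmx d *m u)).
    by rewrite /Mmx -!mulmxA dot_mxr tr_Dmx.
  rewrite (le_trans (QWmx_le pQ rW _))//.
  rewrite (le_trans (qform_le_Ch_max k0 pQ.1 _))//.
  have h1 : dot (Dmx d *m u) (Dmx d *m u) <= C ^+ 2 * dot u u.
    rewrite !dotE mulr_sumr ler_sum// => i _; rewrite mul_diag_mx mxE.
    have /andP[d0 dC] := hd i.
    have -> : d 0 i * u i 0 * (d 0 i * u i 0) = d 0 i ^+ 2 * u i 0 ^+ 2 by ring.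
    rewrite -expr2 ler_wpM2r ?sqr_ge0// lerXn2r// nnegrE ?ltW//.
    exact: lt_le_trans d0 dC.
  rewrite (le_trans (ler_wpM2r (dot_ge0 _) (le_trans hq (ler_norm q))))//.
  by rewrite /b -mulrA ler_wpM2l.
have h := psd_CS x y (psd_Mmx d pQ rW); rewrite -/b; clearbody b.
have r0 : 0 <= b * (vn x * vn y) by apply: mulr_ge0 => //; apply: mulr_ge0; exact: vn_ge0.
rewrite -(@ler_pXn2r _ 2)// ?nnegrE// real_normK ?num_real//.
rewrite (le_trans h)// !exprMn !vn_sqr.
rewrite expr2 mulrACA.
by apply: ler_pM; rewrite ?hb//; have [_ h0] := psd_Mmx d pQ rW; exact: h0.
Qed.

(** Positive definiteness is an open condition. *)
Lemma eventually_coercive p (F : nat -> 'M[R]_p) (M : 'M[R]_p) : posdef M ->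
  F @ \oo --> M ->
  exists2 e, 0 < e & \forall k \near \oo, forall x : 'cV[R]_p, e * dot x x <= dot x (F k *m x).
Proof.
move=> pM FM; have [K K0 hK] := psd_unit_coercive (posdef_psd pM) (posdef_unit pM).
pose e := (2 * K)^-1; have e0 : 0 < e by rewrite invr_gt0 mulr_gt0.
exists e => //.
have cv : mxbound (F k - M) @[k --> \oo] --> (0 : R).
  have -> : 0 = \sum_i \sum_j `|(M - M) i j|.
    by rewrite big1// => i _; rewrite big1// => j _; rewrite !mxE subrr normr0.
  rewrite /mxbound; apply: cvg_finsum => i; apply: cvg_finsum => j.
  apply: cvg_norm; under eq_fun do rewrite !mxE.
  rewrite !mxE; apply: cvgB; last exact: cvg_cst.
  exact: (cvg_comp _ _ FM (@coord_continuous _ _ _ i j M)).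
have near_e : \forall k \near \oo, `|0 - mxbound (F k - M)| <= e.
  exact: ((cvgrPdist_le _ _).1 cv _ e0).
near=> k; have : `|0 - mxbound (F k - M)| <= e by near: k.
rewrite sub0r normrN ger0_norm ?mxbound_ge0// => hk x.
have h1 := dot_mxbound (F k - M) x x; rewrite -expr2 vn_sqr in h1.
have h2 : `|dot x ((F k - M) *m x)| <= e * dot x x.
  by rewrite (le_trans h1)// ler_wpM2r// dot_ge0.
have h3 : 2 * e * dot x x <= dot x (M *m x).
  by have := hK x; rewrite -ler_pdivrMl// /e invfM mulrA mulfV// mul1r.
have -> : F k = F k - M + M by rewrite subrK.
rewrite mulmxDl dotDr; move: h2 h3; rewrite ler_norml => /andP[h2 _] h3.
by rewrite -lerBlDr; move: h2 h3; lra.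
Unshelve. all: by end_near. Qed.

End uniform_bounds.

Section family.
Context {R : realType} {p m : nat}.
Variables (beta : 'cV[R]_p) (lam : R).
Variables (d : forall k : nat, 'rV[R]_k) (X : forall k : nat, 'M[R]_(k, p)).
Variables (W : forall k : nat, 'M[R]_(k, m)) (Q : forall k : nat, 'M[R]_k).
Variable t : forall k : nat, 'cV[R]_k -> 'cV[R]_m.
Context {disp : nat -> measure_display} (Om : forall k : nat, measurableType (disp k)).
Variable P : forall k : nat, probability (Om k) R.
Variables y mu : forall k : nat, Om k -> 'cV[R]_k.
Arguments y : clear implicits.
Arguments mu : clear implicits.
Arguments t : clear implicits.
Variables (dom : nat -> Prop) (c C B q e : R).
Hypotheses (lam0 : 0 < lam) (c0 : 0 < c) (e0 : 0 < e).
Hypothesis hd : forall k (i : 'I_k), c <= d k 0 i <= C.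
Hypothesis hB : forall k i j, `|X k i j| <= B.
Hypothesis dom_p : forall k, dom k -> (p + p < k)%N.
Hypothesis rX : forall k, dom k -> \rank (X k) = p.
Hypothesis rW : forall k, dom k -> \rank (W k) = m.
Hypothesis pQ : forall k, dom k -> posdef (Q k).
Hypothesis hq : forall k, dom k -> Ch_max (Q k) <= q.
Hypothesis mu_law : forall k, dom k -> normal_vector (P k) (mu k) (X k *m beta) (const_mx lam).
Hypothesis y_law : forall k, dom k -> cond_normal_vector (P k) (y k) (mu k) (d k).
Hypothesis t_L2 : forall k, dom k -> forall j : 'I_m,
  (fun w => t k (y k w) j 0) \in Lfun (P k) 2%:E.
Hypothesis coercive : forall k, dom k -> forall x : 'cV[R]_p,
  e * k%:R * dot x x <= dot x ((X k)^T *m diag_mx (precision (d k) lam) *m X k *m x).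

Let hc k (i : 'I_k) : c <= d k 0 i. Proof. by have /andP[] := hd i. Qed.
Let d0 k (i : 'I_k) : 0 < d k 0 i. Proof. exact: lt_le_trans (hc i). Qed.
Let l0 : 0 <= lam. Proof. exact: ltW. Qed.
Let v0 k (i : 'I_k) : 0 < d k 0 i + lam. Proof. exact: v_gt0. Qed.
Let vC k (i : 'I_k) : d k 0 i + lam <= C + lam.
Proof. by rewrite lerD2r; have /andP[] := hd i. Qed.
Let vc k (i : 'I_k) : c <= d k 0 i + lam. Proof. by rewrite (le_trans (hc i))// lerDl. Qed.
Let kp k : dom k -> (p < k)%N. Proof. by move=> /dom_p; apply: leq_ltn_trans; exact: leq_addr. Qed.
Let k0 k : dom k -> (0 < k)%N. Proof. by move=> /kp; exact: leq_ltn_trans. Qed.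
Let ry k (h : dom k) : random_vector (y k) := (y_law h).1.
Let law k (h : dom k) := marginal_law lam0 (@d0 k) (mu_law h) (y_law h).

Local Notation z k w := (y k w - X k *m beta).
Local Notation S k := (Num.sqrt (k%:R : R)).
Local Notation score k w := ((X k)^T *m (diag_mx (precision (d k) lam) *m z k w)).

Let zE k w (i : 'I_k) : (z k w) i 0 = y k w i 0 - (X k *m beta) i 0.
Proof. by rewrite [LHS]mxE [(- (X k *m beta)) i 0]mxE. Qed.

(** The constants in centred_sum_moment do not depend on the dimension. *)
Let bounded_centred (h : forall k, 'I_k -> R -> R) (A : R) : 0 < A ->
  (forall k i, measurable_fun setT (h k i)) ->
  (forall k (i : 'I_k) x, `|h k i x| <= A * (1 + (x - (X k *m beta) i 0) ^+ 2 / (d k 0 i + lam))) ->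
  (forall k (i : 'I_k), \int[obs_law (X k *m beta) lam (d k) i]_x h k i x = 0) ->
  bounded_moments P dom (fun k w => (\sum_i h k i (y k w i 0)) / S k).
Proof.
move=> A0 mh hA h0; split=> [k dk|n].
  apply: measurable_funM => //; apply: measurable_sum => i.
  exact: (measurable_fun_coord (ry dk)).
exists ((8 * A) ^+ n * (n`!%:R * (expR tilt_bound + expR tilt_bound))) => k dk; split.
  exact: (centred_sum_integrable (@v0 k) (ry dk) (law dk) (k0 dk) A0 (mh k) (hA k) n).
exact: (centred_sum_moment (@v0 k) (ry dk) (law dk) (k0 dk) A0 (mh k) (hA k) (h0 k) n).
Qed.

Let sqrtv k (i : 'I_k) : Num.sqrt (d k 0 i + lam) != 0.
Proof. by rewrite gt_eqF// sqrtr_gt0. Qed.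

Let mcentre (a : R) : measurable_fun setT (fun x : R => x - a).
Proof. exact: measurable_funB. Qed.

Let mean_sqr k (i : 'I_k) (g : R) :
  \int[obs_law (X k *m beta) lam (d k) i]_x
    (((x - (X k *m beta) i 0) ^+ 2 / (d k 0 i + lam) - 1) * g) = 0.
Proof.
have := @normal_mean_sqr R ((X k *m beta) i 0) _ g (sqrtv i).
by rewrite sqr_sqrtr ?(ltW (v0 i)).
Qed.

Let zeta_abs k (i : 'I_k) (x : R) :
  `|(x - (X k *m beta) i 0) ^+ 2 / (d k 0 i + lam) - 1| <=
  1 + (x - (X k *m beta) i 0) ^+ 2 / (d k 0 i + lam).
Proof.
rewrite (le_trans (ler_normB _ _))// normr1 addrC lerD2l ger0_norm//.
by rewrite divr_ge0 ?sqr_ge0 ?ltW.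
Qed.

Let bounded_xi0 : bounded_moments P dom (fun k w => xi0 (d k) lam (z k w) / S k).
Proof.
pose h k (i : 'I_k) (x : R) := ((x - (X k *m beta) i 0) ^+ 2 / (d k 0 i + lam) - 1) * 1.
have -> : (fun k w => xi0 (d k) lam (z k w) / S k) =
    (fun k w => (\sum_i h k i (y k w i 0)) / S k).
  apply/functional_extensionality_dep => k; apply/funext => w; congr (_ / _).
  by apply: eq_bigr => i _; rewrite zE /h mulr1.
apply: (@bounded_centred h 1) => // [k i|k i x|k i].
- apply: measurable_funM => //; apply: measurable_funB => //.
  by apply: measurable_funM => //; apply: measurable_funX.
- by rewrite /h mulr1 mul1r zeta_abs.
- exact: mean_sqr.
Qed.

Let bounded_eta0 : bounded_moments P dom (fun k w => eta0 (d k) lam (z k w) / S k).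
Proof.
pose h k (i : 'I_k) (x : R) :=
  ((x - (X k *m beta) i 0) ^+ 2 / (d k 0 i + lam) - 1) * (d k 0 i + lam)^-1.
have -> : (fun k w => eta0 (d k) lam (z k w) / S k) =
    (fun k w => (\sum_i h k i (y k w i 0)) / S k).
  apply/functional_extensionality_dep => k; apply/funext => w; congr (_ / _).
  by apply: eq_bigr => i _; rewrite zE /h.
apply: (@bounded_centred h c^-1) => // [|k i|k i x|k i].
- by rewrite invr_gt0.
- apply: measurable_funM => //; apply: measurable_funB => //.
  by apply: measurable_funM => //; apply: measurable_funX.
- rewrite /h normrM mulrC ler_pM// ?zeta_abs//.
  by rewrite normfV gtr0_norm// lef_pV2 ?posrE.
- exact: mean_sqr.
Qed.

Let bounded_score (j : 'I_p) : bounded_moments P dom (fun k w => score k w j 0 / S k).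
Proof.
pose h k (i : 'I_k) (x : R) := X k i j / (d k 0 i + lam) * (x - (X k *m beta) i 0).
have -> : (fun k w => score k w j 0 / S k) =
    (fun k w => (\sum_i h k i (y k w i 0)) / S k).
  apply/functional_extensionality_dep => k; apply/funext => w; congr (_ / _).
  rewrite mxE; apply: eq_bigr => i _; rewrite mul_diag_mx /h -zE.
  by rewrite [(X k)^T j i]mxE [X in _ * X]mxE [precision _ _ _ _]mxE mulrA.
have B0 : 0 < `|B| + 1 by rewrite ltr_wpDl.
apply: (@bounded_centred h ((`|B| + 1) * (c^-1 + 1))) => // [|k i|k i x|k i].
- by rewrite mulr_gt0// ltr_wpDl// invr_ge0 ltW.
- exact: measurable_funM.
- rewrite /h !normrM normfV (gtr0_norm (v0 i)) -mulrA -mulrA ler_pM//.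
    by rewrite mulr_ge0// invr_ge0 ltW.
    by rewrite (le_trans (hB i j))// (le_trans (ler_norm B))// lerDl.
  set u := x - _; have v := v0 i; have cv := vc i; move: v cv; move: (d k 0 i + lam) => v vp cv.
  rewrite -[u ^+ 2]real_normK ?num_real//; move: `|u| (normr_ge0 u) => s s0.
  have vi0 : 0 < v^-1 by rewrite invr_gt0.
  have vic : v^-1 <= c^-1 by rewrite lef_pV2 ?posrE.
  have h1 : 0 <= v^-1 * (s - v) ^+ 2 by apply: mulr_ge0; [exact: ltW|exact: sqr_ge0].
  have h2 : 2 * s <= s ^+ 2 / v + v.
    have -> : s ^+ 2 / v + v = v^-1 * (s - v) ^+ 2 + 2 * s by field; rewrite gt_eqF.
    by rewrite lerDr.
  have h3 : 2 * (v^-1 * s) <= v^-1 * (s ^+ 2 / v) + 1.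
    have := ler_wpM2l (ltW vi0) h2; rewrite mulrDr mulVf ?gt_eqF//.
    by rewrite mulrCA.
  have w0 : 0 <= s ^+ 2 / v by rewrite divr_ge0 ?sqr_ge0 ?ltW.
  have h4 : v^-1 * (s ^+ 2 / v) <= c^-1 * (s ^+ 2 / v) by rewrite ler_wpM2r.
  have ci0 : 0 <= c^-1 by rewrite invr_ge0 ltW.
  have vs0 : 0 <= v^-1 * s by rewrite mulr_ge0// ltW.
  by move: h3 h4 w0 ci0 vs0; move: (v^-1 * s) (s ^+ 2 / v) c^-1 => a1 a2 a3; nra.
- exact: (@normal_mean_lin R ((X k *m beta) i 0) _ (X k i j / (d k 0 i + lam)) (sqrtv i)).
Qed.

(** The scale in which all quantities of the expansion grow polynomially. *)
Let G k (w : Om k) : R := 1 + `|xi0 (d k) lam (z k w) / S k|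
  + `|eta0 (d k) lam (z k w) / S k| + \sum_(j < p) `|score k w j 0 / S k|.

Let bounded_G : bounded_moments P dom G.
Proof.
apply: bounded_momentsD; last first.
  by apply: bounded_moments_sum => j; exact: bounded_moments_norm (bounded_score j).
apply: bounded_momentsD; last exact: bounded_moments_norm bounded_eta0.
apply: bounded_momentsD; last exact: bounded_moments_norm bounded_xi0.
exact: bounded_moments_cst.
Qed.

Let b : R := `|q| * C ^+ 2.
Let b0 : 0 <= b. Proof. by rewrite mulr_ge0// sqr_ge0. Qed.

Let hM k (h : dom k) (u v : 'cV[R]_k) :
  `|dot u (Mmx (d k) (Q k) (W k) *m v)| <= b * (vn u * vn v).
Proof.
apply: (Mmx_bound u v (k0 h) (pQ h) (rW h) _ (hq h)) => i.
by rewrite d0; have /andP[] := hd i.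
Qed.

Let sM k (h : dom k) : (Mmx (d k) (Q k) (W k))^T = Mmx (d k) (Q k) (W k).
Proof. exact: (psd_Mmx (d k) (pQ h) (rW h)).1. Qed.

Let S1 k : dom k -> 1 <= S k.
Proof.
move=> /k0 h; have h1 : Num.sqrt (1 : R) <= S k by apply: ler_wsqrtr; rewrite ler1n.
by rewrite sqrtr1 in h1.
Qed.

Let S0 k : dom k -> 0 < S k.
Proof. by move=> /S1; exact: lt_le_trans. Qed.

Let SE k : S k ^+ 2 = k%:R.
Proof. by rewrite sqr_sqrtr. Qed.

Let G_ge1 k (w : Om k) : 1 <= G w.
Proof. by rewrite /G -!addrA lerDl !addr_ge0// sumr_ge0. Qed.

Let scaled k (h : dom k) (x g : R) : `|x / S k| <= g -> `|x| <= S k * g.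
Proof. by rewrite normrM normfV (gtr0_norm (S0 h)) ler_pdivrMr ?S0// mulrC. Qed.

Let sum_ge0 (n : nat) (f : 'I_n -> R) : 0 <= \sum_j `|f j|.
Proof. by rewrite sumr_ge0. Qed.

Let C0 k : dom k -> 0 < C + lam.
Proof. by move=> /k0 h; exact: lt_le_trans (v0 (Ordinal h)) (vC _). Qed.

Let I : Type := {k : nat & Om k}.

Let error_growth : 0 < C + lam -> growth (fun i : I => dom (tag i)) (fun i => G (tagged i))
  (fun i => S (tag i) * loss_error (d (tag i)) (X (tag i)) (Q (tag i)) (W (tag i)) lam
     (z (tag i) (tagged i))).
Proof.
move=> Cl.
apply: (@growth_error R I _ _ (fun i _ => G_ge1 (tagged i)) c (C + lam) e lam p%:R b
  (fun i => S (tag i)) (fun i => (tag i)%:R) (fun i => (tag i)%:R - p%:R)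
  (fun i => tau (d (tag i)) lam) (fun i => xi0 (d (tag i)) lam (z (tag i) (tagged i)))
  (fun i => eta0 (d (tag i)) lam (z (tag i) (tagged i)))
  (fun i => vn (score (tag i) (tagged i)))
  (fun i => vn (z (tag i) (tagged i)))
  (fun i => vn (Hmx (d (tag i)) (X (tag i)) lam *m z (tag i) (tagged i)))
  (fun i => dot (z (tag i) (tagged i)) (Hmx (d (tag i)) (X (tag i)) lam *m z (tag i) (tagged i)))
  (fun i => rss (d (tag i)) (X (tag i)) lam (z (tag i) (tagged i)) - ((tag i)%:R - p%:R))
  (fun i => dot (Amx (d (tag i)) (X (tag i)) lam *m z (tag i) (tagged i))
    (Amx (d (tag i)) (X (tag i)) lam *m z (tag i) (tagged i)) - tau (d (tag i)) lam)
  (fun i => lambda_hat (d (tag i)) (X (tag i)) (z (tag i) (tagged i)) - lam)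
  (fun i => xi0 (d (tag i)) lam (z (tag i) (tagged i)) / tau (d (tag i)) lam))
  => // -[k w] /= dk.
- exact: S1.
- have : (p + p)%:R <= k%:R :> R by rewrite ler_nat ltnW// dom_p.
  by rewrite natrD; lra.
- exact: (tau_ge c0 (@hc k) lam0 (@vC k)).
- rewrite mulrC; have -> : c^-1 * k%:R = \sum_(i < k) c^-1.
    by rewrite sumr_const card_ord mulr_natr.
  by apply: ler_sum => i _; rewrite lef_pV2 ?posrE.
- apply: scaled => //; rewrite /G -!addrA addrCA lerDl.
  by rewrite addr_ge0// addr_ge0.
- apply: scaled => //; rewrite /G -!addrA addrA addrCA lerDl.
  by rewrite addr_ge0// addr_ge0.
- rewrite ger0_norm ?vn_ge0// (le_trans (vn_le_sum _))//.
  rewrite (@le_trans _ _ (S k * \sum_(j < p) `|score k w j 0 / S k|))//.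
    rewrite mulr_sumr ler_sum// => j _.
    by rewrite normrM normfV (gtr0_norm (S0 dk)) mulrCA mulfV ?mulr1// gt_eqF ?S0.
  rewrite ler_wpM2l ?(ltW (S0 dk))// /G lerDr.
  by rewrite addr_ge0// addr_ge0.
- apply/andP; split; first exact: (hat_form_ge0 c0 (@hc k) (rX dk) lam0).
  apply: (hat_form_le c0 (@hc k) (rX dk) lam0); last exact: coercive.
  by rewrite mulr_gt0// ltr0n k0.
- exact: (hat_sqr_le c0 (@hc k) (rX dk) lam0).
- by rewrite vn_sqr; exact: (vn_sqr_xi0 c0 (@hc k) lam0 _ (@vC k)).
- exact: (xi_xi0 (X k) c0 (@hc k) lam0).
- exact: (eta_bound (X k) c0 (@hc k) lam0).
- by rewrite vn_sqr; exact: (delta_bound c0 (@hc k) (rX dk) lam0 _ (kp dk)).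
- rewrite vn_sqr; apply: (newton_step c0 (@hc k) (rX dk) lam0).
  by rewrite ltW// (lt_le_trans _ (tau_ge c0 (@hc k) lam0 (@vC k)))// divr_gt0 ?ltr0n ?k0.
- exact: (loss_expansion c0 (@hc k) (rX dk) lam0 _ (sM dk) b0 (hM dk)).
Qed.

(** The polynomial bound on the error is uniform in the dimension, and so are
the moments of its scale. *)
Lemma Delta_U_APR_gap : exists K, forall k, dom k ->
  S k * `|Delta_U (P k) (d k) (X k) (Q k) (W k) (t k) (y k) (mu k)
    - Delta_APR (d k) (X k) (Q k) (W k) lam| <= K.
Proof.
have [[k1 dk1]|ndom] := pselect (exists k, dom k); last first.
  by exists 0 => k dk; exfalso; apply: ndom; exists k.
have [K [n [K0 hK]]] := error_growth (C0 dk1).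
have [mG /(_ n)[K' hG]] := bounded_G.
exists (@trace_gap_bound R p c (C + lam) b + K * K') => k dk.
have [ig bG] := hG k dk.
have [ierr eU] := Delta_U_expansion lam0 c0 (@hc k) (rX dk) (rW dk) (pQ dk) (kp dk)
  (mu_law dk) (y_law dk) (t_L2 dk).
have gap := trace_gap c0 (@hc k) lam0 (@vC k) (rX dk) b0 (k0 dk) (hM dk).
have aE := Delta_APRE (X k) (Q k) (W k) (@d0 k) l0.
set T1 := (2 * k%:R + 8) / _ * _ in eU gap; set T2 := (\sum_i _) * _ in gap aE.
have -> : Delta_U (P k) (d k) (X k) (Q k) (W k) (t k) (y k) (mu k)
    - Delta_APR (d k) (X k) (Q k) (W k) lam = (T1 - T2) +
    \int[P k]_w loss_error (d k) (X k) (Q k) (W k) lam (z k w).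
  by rewrite eU aE; ring.
apply: (le_trans (ler_wpM2l (ltW (S0 dk)) (ler_normD _ _))).
rewrite mulrDr lerD//.
have i2 := integrableZR K ig.
have h1 := le_normr_Rintegral measurableT ierr.
have i3 : (P k).-integrable setT (EFin \o (fun w =>
    `|loss_error (d k) (X k) (Q k) (W k) lam (z k w)|)) by exact: (integrable_norm ierr).
apply: (le_trans (ler_wpM2l (ltW (S0 dk)) h1)).
rewrite -(RintegralZl (S k) measurableT i3).
apply: (@le_trans _ _ (\int[P k]_w (K * `|G w| ^+ n))).
  apply: (le_Rintegral measurableT (integrableZR (S k) i3) i2) => w _.
  have := hK (existT _ k w) dk; rewrite /= normrM (gtr0_norm (S0 dk)).
  by rewrite [`|G w|]ger0_norm// (le_trans _ (G_ge1 w)).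
rewrite (RintegralZl K measurableT ig) ler_wpM2l//.
Qed.

End family.

Theorem proposition4p3 (R : realType) (p m : nat)
    (beta : 'cV[R]_p) (lambda : R)
    (d : forall k : nat, 'rV[R]_k) (X : forall k : nat, 'M[R]_(k, p))
    (W : forall k : nat, 'M[R]_(k, m)) (Q : forall k : nat, 'M[R]_k)
    (t : forall k : nat, 'cV[R]_k -> 'cV[R]_m)
    (disp : nat -> measure_display)
    (Om : forall k : nat, measurableType (disp k))
    (P : forall k : nat, probability (Om k) R)
    (y mu : forall k : nat, Om k -> 'cV[R]_k)
    (lambda_gt0 : 0 < lambda)
    (d_gt0 : forall k (i : 'I_k), 0 < d k 0 i)
    (d_noninc : forall k (i j : 'I_k), (i <= j)%N -> d k 0 j <= d k 0 i)
    (rankX : forall k, (m < k)%N -> (p <= k)%N -> \rank (X k) = p)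
    (rankW : forall k, (m < k)%N -> (p <= k)%N -> \rank (W k) = m)
    (Q_posdef : forall k, (m < k)%N -> (p <= k)%N -> posdef (Q k))
    (mu_law : forall k, (m < k)%N -> (p <= k)%N ->
       normal_vector (P k) (mu k) (X k *m beta) (const_mx lambda))
    (y_law : forall k, (m < k)%N -> (p <= k)%N ->
       cond_normal_vector (P k) (y k) (mu k) (d k))
    (t_L2 : forall k, (m < k)%N -> (p <= k)%N -> forall j : 'I_m,
       (fun w => t k (y k w) j 0) \in Lfun (P k) 2%:E)
    (X_bounded : exists B : R, forall k i j, `|X k i j| <= B)
    (W_bounded : exists B : R, forall k i j, `|W k i j| <= B)
    (XVX_posdef : forall k, (m < k)%N -> (p <= k)%N ->
       posdef (k%:R^-1 *: ((X k)^T *m invmx (Vmx (d k) lambda) *m X k)))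
    (XVX_cvg : exists2 M : 'M[R]_p, posdef M &
       (fun k => k%:R^-1 *: ((X k)^T *m invmx (Vmx (d k) lambda) *m X k))
         @ \oo --> M)
    (d_bounded : exists c C : R, 0 < c /\
       forall k (i : 'I_k), c <= d k 0 i <= C) :
  [/\
    forall k, (m < k)%N -> (p <= k)%N ->
      (risk (P k) (Q k) (y k) (mu k) (mu_CEB (d k) (X k) (Q k) (W k) (t k))
         \is a fin_num) /\
      (risk (P k) (Q k) (y k) (mu k) (mu_CM (Q k) (W k) (t k))
         \is a fin_num),
    (exists q : R, forall k, (m < k)%N -> (p <= k)%N -> Ch_max (Q k) <= q) ->
      (fun k => Delta_U (P k) (d k) (X k) (Q k) (W k) (t k) (y k) (mu k) / k%:R
              - Delta_APR (d k) (X k) (Q k) (W k) lambda / k%:R)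
        =O_\oo (fun k => k%:R `^ (- (3 / 2))),
    forall k, (m < k)%N -> (p <= k)%N ->
      (forall lam : R, 0 < lam -> Delta_APR (d k) (X k) (Q k) (W k) lam <= 0) ->
      \tr (Dmx (d k) *m QWmx (Q k) (W k)) >=
        \tr (invmx ((X k)^T *m invmx (Dmx (d k)) *m X k)
              *m (X k)^T *m QWmx (Q k) (W k) *m X k)
        + \tr (QWmx (Q k) (W k) *m invmx (Dmx (d k)))
          * ((2 * k%:R) / \tr (invmx (Dmx (d k))) ^+ 2) &
    forall k, (m < k)%N -> (p <= k)%N ->
      inf [set \tr (Dmx (d k) *m QWmx (Q k) (W k) *m Dmx (d k)
                      *m invmx (Vmx (d k) lam))
               / Ch_max (Dmx (d k) *m QWmx (Q k) (W k) *m Dmx (d k)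
                      *m invmx (Vmx (d k) lam)) | lam in [set l : R | 0 < l]]
        >= p%:R + 2 * (k%:R * \tr (invmx (Dmx (d k)) *m invmx (Dmx (d k)))
                        / \tr (invmx (Dmx (d k))) ^+ 2) ->
      forall lam : R, 0 < lam -> Delta_APR (d k) (X k) (Q k) (W k) lam <= 0].
Proof.
have [c [C [c0 hd]]] := d_bounded; have l0 := ltW lambda_gt0.
have hc k (i : 'I_k) : c <= d k 0 i by have /andP[] := hd k i.
have kpos k : (m < k)%N -> (0 < k)%N by exact: leq_ltn_trans.
split=> [k mk pk|[q hq]|k mk pk|k mk pk].
- have rX := rankX k mk pk; split.
    exact (@risk_CEB_fin_num R _ _ (P k) k p m (y k) (mu k) (d k) (X k) (Q k) (W k) (t k)
      _ _ _ lambda_gt0 c0 (hc k) rX pk (mu_law k mk pk) (y_law k mk pk) (t_L2 k mk pk)).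
  exact (@risk_CM_fin_num R _ _ (P k) k m (y k) (mu k) (d k) (Q k) (W k) (t k)
    _ _ _ lambda_gt0 c0 (hc k) (mu_law k mk pk) (y_law k mk pk) (t_L2 k mk pk)).
- have [M pM FM] := XVX_cvg; have [B hB] := X_bounded.
  have [e e0 [N _ hN]] := eventually_coercive pM FM.
  (* The dimensions in which the information is bounded below and the degrees of
     freedom k - p are at least k / 2. *)
  pose dom k := [/\ (m < k)%N, (p + p < k)%N & (N <= k)%N].
  have dm k : dom k -> (m < k)%N by case.
  have dp k : dom k -> (p + p < k)%N by case.
  have dpk k : dom k -> (p <= k)%N by move=> /dp /ltnW; apply: leq_trans; exact: leq_addr.
  have coercive k : dom k -> forall x : 'cV[R]_p,
      e * k%:R * dot x x <= dot x ((X k)^T *m diag_mx (precision (d k) lambda) *m X k *m x).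
    move=> dk x; have kR : 0 < k%:R :> R by rewrite ltr0n kpos// dm.
    have [_ _ Nk] := dk; have := hN k Nk x.
    rewrite (invVmx (d_gt0 k) l0) -scalemxAl dotZr => h.
    by rewrite mulrAC -ler_pdivlMr// [leRHS]mulrC.
  have [K hK] := @Delta_U_APR_gap R p m beta lambda d X W Q t disp Om P y mu dom c C B q e
    lambda_gt0 c0 e0 hd hB dp (fun k dk => rankX k (dm k dk) (dpk k dk))
    (fun k dk => rankW k (dm k dk) (dpk k dk)) (fun k dk => Q_posdef k (dm k dk) (dpk k dk))
    (fun k dk => hq k (dm k dk) (dpk k dk)) (fun k dk => mu_law k (dm k dk) (dpk k dk))
    (fun k dk => y_law k (dm k dk) (dpk k dk)) (fun k dk => t_L2 k (dm k dk) (dpk k dk)) coercive.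
  (* The gap is of order k^(-1/2) before the division by k. *)
  apply/eqO_exP; exists (`|K| + 1); first by rewrite ltr_wpDl.
  near=> k.
  have dk : dom k by split; near: k; exact: nbhs_infty_ge.
  have kR : 0 < k%:R :> R by rewrite ltr0n kpos// dm.
  have S0 : 0 < Num.sqrt (k%:R : R) by rewrite sqrtr_gt0.
  have -> : k%:R `^ (- (3 / 2)) = (k%:R * Num.sqrt k%:R)^-1 :> R.
    rewrite powRN (_ : 3 / 2 = 1 + 2^-1 :> R); last by field.
    rewrite powRD; last by rewrite gt_eqF ?implybT.
    by rewrite powRr1 ?ltW// powR12_sqrt ?ltW.
  have kS : 0 < k%:R * Num.sqrt (k%:R : R) by rewrite mulr_gt0.
  rewrite -mulrBl normrM normfV (gtr0_norm kR) normfV (gtr0_norm kS).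
  rewrite ler_pdivlMr// (_ : _ / _ * _ = Num.sqrt k%:R * `|Delta_U (P k) (d k) (X k) (Q k)
     (W k) (t k) (y k) (mu k) - Delta_APR (d k) (X k) (Q k) (W k) lambda|); last first.
    by field; rewrite gt_eqF.
  by rewrite (le_trans (hK k dk))// (le_trans (ler_norm K))// lerDl.
- have rX := rankX k mk pk; have rW := rankW k mk pk; have pQ := Q_posdef k mk pk.
  by apply: necessary_condition => //; exact: kpos.
- have rX := rankX k mk pk; have rW := rankW k mk pk; have pQ := Q_posdef k mk pk.
  by apply: sufficient_condition => //; exact: kpos.
Unshelve. all: by end_near. Qed.
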